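(* Let $M^n$ be a connected, compact, closed, smooth manifold of dimension $n$ with a fixed smooth triangulation, and let $M^n=C^n\cup K^{n-1}$ be the decomposition into a cell $C^n$ and its complement $K^{n-1}$ obtained by extending a coordinate neighborhood from an initial $n$-simplex $\delta_0^n$ (as described in the context). Then the space $K^{n-1}$ is connected, and if $M^n$ is simply connected then $K^{n-1}$ is simply connected too.
   Context: ''Closed'' means without boundary. The standard simplex is $\Delta^l=\{x\in\mathbf{R}^l : 0\le x_i\le 1,\ x_1+\dots+x_l\le 1\}$. Smooth triangulation: for each $l$, $0\le l\le n$, there is a finite set $\Phi^l$ of maps $\varphi:\Delta^l\to M^n$, each being the restriction of a diffeomorphism of an open neighborhood of $\Delta^l$ in $\mathbf{R}^l$ onto its image in $M^n$, such that (a) $M^n$ is the disjoint union of the images $\varphi(\mathrm{Int}\,\Delta^l)$, over all $l$ and all $\varphi\in\Phi^l$; (b) if $\varphi\in\Phi^l$, $l\ge 1$, then $\varphi\circ\varepsilon_i\in\Phi^{l-1}$ for every $i$, where $\varepsilon_i:\Delta^{l-1}\to\Delta^l$ is the linear map sending the vertexes $v_0,\dots,v_{l-1}$ of $\Delta^{l-1}$ to the vertexes $v_0,\dots,\hat v_i,\dots,v_l$ of $\Delta^l$. The $l$-simplexes of the triangulation are the sets $\varphi(\Delta^l)$; the interior of such a simplex is the image under $\varphi$ of $\mathrm{Int}\,\Delta^l$. The decomposition $M^n=C^n\cup K^{n-1}$: start with an $n$-simplex $\delta_0^n$ of the triangulation and put $\sigma_0=\delta_0^n$, $C_0=\mathrm{Int}\,\delta_0^n$.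 Given $\sigma_{k-1}$ (a union of $k$ $n$-simplexes) and the ''white'' set $C_{k-1}$, choose, as long as possible, an $n$-simplex $\delta_k^n$ not contained in $\sigma_{k-1}$ which has a common $(n-1)$-face $\tau_k$ with some $n$-simplex of $\sigma_{k-1}$; put $\sigma_k=\sigma_{k-1}\cup\delta_k^n$ and $C_k=C_{k-1}\cup\mathrm{Int}\,\tau_k\cup\mathrm{Int}\,\delta_k^n$. The process stops when all $n$-simplexes have been used; $C^n$ is the last white set $C_k$ (it is an $n$-dimensional cell) and $K^{n-1}=M^n\setminus C^n$, which is a union of finitely many $(n-1)$-simplexes of the triangulation. *)

(* Defs.v *)
From HB Require Import structures.
From mathcomp Require Import all_boot all_order all_algebra.
From mathcomp Require Import all_classical all_reals all_analysis.
Set Implicit Arguments.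
Unset Strict Implicit.
Unset Printing Implicit Defensive.
Import Order.TTheory GRing.Theory Num.Theory.
Import numFieldNormedType.Exports.
Local Open Scope classical_set_scope.
Local Open Scope ring_scope.

(* C^k and C^infty maps on a set U, meant for U open *)
Fixpoint Ck (R : realType) (V W : normedModType R) (k : nat) (U : set V)
    (f : V -> W) : Prop :=
  if k is k'.+1 then
    (forall x, U x -> differentiable f x) /\
    (forall v, Ck k' U (fun x => 'D_v f x))
  else forall x, U x -> {for x, continuous f}.

Definition smooth_on (R : realType) (V W : normedModType R) (U : set V)
  (f : V -> W) : Prop := forall k, Ck k U f.

(* Charts take values in the whole of R^n, with open image: no boundary. *)
Record chart (R : realType) (n : nat) (M : topologicalType) := Chart {
  chart_dom : set M;
  chart_map : M -> 'rV[R]_n;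
  chart_inv : 'rV[R]_n -> M;
  chart_dom_open : open chart_dom;
  chart_img_open : open (chart_map @` chart_dom);
  chart_mapK : forall x, chart_dom x -> chart_inv (chart_map x) = x;
  chart_map_continuous :
    forall x, chart_dom x -> {for x, continuous chart_map};
  chart_inv_continuous :
    forall y, (chart_map @` chart_dom) y -> {for y, continuous chart_inv} }.

Record smooth_atlas (R : realType) (n : nat) (M : topologicalType) :=
  SmoothAtlas {
  charts : set (chart R n M);
  charts_cover : forall x, exists2 c, charts c & chart_dom c x;
  charts_compatible : forall c d, charts c -> charts d ->
    smooth_on (chart_map c @` (chart_dom c `&` chart_dom d))
              (chart_map d \o chart_inv c) }.

Section Maps.
Context (R : realType) (n : nat) (M : topologicalType).
Variable A : smooth_atlas R n M.

Definition smooth_into (l : nat) (U : set 'rV[R]_l) (f : 'rV[R]_l -> M) :=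
  (forall x, U x -> {for x, continuous f}) /\
  (forall c, charts A c ->
     smooth_on (U `&` f @^-1` chart_dom c) (chart_map c \o f)).

Definition smooth_from (l : nat) (W : set M) (g : M -> 'rV[R]_l) :=
  forall c, charts A c ->
    smooth_on (chart_map c @` (W `&` chart_dom c)) (g \o chart_inv c).

(* Smoothness on an arbitrary subset S of M (for l < n the image of an open
   subset of R^l is not open in M): g extends locally to a smooth map defined
   on an open subset of M. *)
Definition smooth_on_subset (l : nat) (S : set M) (g : M -> 'rV[R]_l) :=
  forall y, S y -> exists (W : set M) (h : M -> 'rV[R]_l),
    [/\ open W, W y, smooth_from W h & forall z, S z -> W z -> h z = g z].

Definition diffeo_onto_image (l : nat) (U : set 'rV[R]_l)
    (f : 'rV[R]_l -> M) :=
  smooth_into U f /\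
  exists2 g : M -> 'rV[R]_l,
    forall x, U x -> g (f x) = x & smooth_on_subset (f @` U) g.

End Maps.

Definition simplex (R : realType) (l : nat) : set 'rV[R]_l :=
  [set x | (forall i, 0 <= x 0 i <= 1) /\ \sum_i x 0 i <= 1].
Arguments simplex : clear implicits.

(* v_0 = 0 and v_i is the i-th vector of the canonical basis for 0 < i *)
Definition vertex (R : realType) (l : nat) (i : 'I_l.+1) : 'rV[R]_l :=
  \row_(j < l) (i == lift ord0 j)%:R.

(* The point with barycentric coordinates (1 - sum x, x_1, ..., x_l) is sent to
   the point with the same coordinates relative to v_0, .., ^v_i, .., v_(l+1);
   note that lift i enumerates 'I_l.+2 without i in increasing order. *)
Definition face_map (R : realType) (l : nat) (i : 'I_l.+2) (x : 'rV[R]_l) :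
    'rV[R]_l.+1 :=
  (1 - \sum_j x 0 j) *: vertex R (lift i ord0) +
  \sum_j x 0 j *: vertex R (lift i (lift ord0 j)).

Definition is_face (R : realType) (M : Type) (l : nat)
    (psi : 'rV[R]_l -> M) (phi : 'rV[R]_l.+1 -> M) :=
  exists i : 'I_l.+2,
    forall x, simplex R l x -> psi x = phi (face_map i x).

(* A map on the standard simplex is represented by a map on R^l of which only
   the values on the simplex matter; disjointness of the open simplexes
   prevents two elements of Phi^l from agreeing on the simplex. *)
Record triangulation (R : realType) (n : nat) (M : topologicalType)
    (A : smooth_atlas R n M) := Triangulation {
  Phi :> forall l, set ('rV[R]_l -> M);
  Phi_finite : forall l, finite_set (@Phi l);
  Phi_dim : forall l, (n < l)%N -> @Phi l = set0;
  Phi_diffeo : forall l phi, @Phi l phi ->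
    exists (U : set 'rV[R]_l) (f : 'rV[R]_l -> M),
      [/\ open U, simplex R l `<=` U, diffeo_onto_image A U f &
          forall x, simplex R l x -> f x = phi x];
  Phi_cover : forall y, exists l, exists2 phi, @Phi l phi &
    (phi @` (simplex R l)°) y;
  Phi_disjoint :
    trivIset [set s : {l : nat & 'rV[R]_l -> M} | @Phi (tag s) (tagged s)]
             (fun s => tagged s @` (simplex R (tag s))°);
  Phi_face : forall l phi (i : 'I_l.+2), @Phi l.+1 phi ->
    exists2 psi, @Phi l psi &
      forall x, simplex R l x -> psi x = phi (face_map i x) }.
Arguments Phi {R n M A} t l _.

(* white_stage T sigma C: (sigma, C) = (sigma_k, C_k) for some k and some
   admissible choices of the first k+1 simplexes of dimension n+1. *)
Inductive white_stage (R : realType) (n : nat) (M : topologicalType)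
    (A : smooth_atlas R n.+1 M) (T : triangulation A) :
    set M -> set M -> Prop :=
| White_start (delta : 'rV[R]_n.+1 -> M) :
    T n.+1 delta ->
    white_stage T (delta @` simplex R n.+1) (delta @` (simplex R n.+1)°)
| White_step (sigma C : set M) (delta delta' : 'rV[R]_n.+1 -> M)
    (tau : 'rV[R]_n -> M) :
    white_stage T sigma C ->
    T n.+1 delta -> ~ (delta @` simplex R n.+1 `<=` sigma) ->
    T n.+1 delta' -> delta' @` simplex R n.+1 `<=` sigma ->
    T n tau -> is_face tau delta -> is_face tau delta' ->
    white_stage T (sigma `|` delta @` simplex R n.+1)
      (C `|` tau @` (simplex R n)° `|` delta @` (simplex R n.+1)°).

Definition cell_decomposition (R : realType) (n : nat) (M : topologicalType)
    (A : smooth_atlas R n.+1 M) (T : triangulation A) (C K : set M) :=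
  (exists2 sigma, white_stage T sigma C &
     forall delta, T n.+1 delta -> delta @` simplex R n.+1 `<=` sigma) /\
  K = ~` C.

Section SimplyConnected.
Context (R : realType) (X : topologicalType).

Local Notation I := (`[0, 1]%classic : set R).

Definition path_in (B : set X) (x y : X) (g : R -> X) :=
  [/\ {within I, continuous g}, g 0 = x, g 1 = y &
      forall t, I t -> B (g t)].

Definition null_homotopic_in (B : set X) (x : X) (g : R -> X) :=
  exists H : R * R -> X,
    [/\ {within I `*` I, continuous H},
        forall p, (I `*` I) p -> B (H p),
        forall s, I s -> H (s, 0) = g s /\ H (s, 1) = x &
        forall t, I t -> H (0, t) = x /\ H (1, t) = x].

Definition simply_connected (B : set X) :=
  [/\ B !=set0,
      forall x y, B x -> B y -> exists g, path_in B x y g &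
      forall x g, B x -> path_in B x x g -> null_homotopic_in B x g].

End SimplyConnected.

(* Main.v *)
Require Import Defs.
From mathcomp Require Import all_boot all_order all_algebra.
From mathcomp Require Import all_classical all_reals all_analysis.
From mathcomp Require Import ring lra.
Set Implicit Arguments.
Unset Strict Implicit.
Unset Printing Implicit Defensive.
Import Order.TTheory GRing.Theory Num.Theory.
Import numFieldNormedType.Exports.
Local Open Scope classical_set_scope.
Local Open Scope ring_scope.

(** The complement [K] of the cell, the final black set, is obtained from the complement of the interior
    of the first simplex by elementary collapses. Let [tau] be the simplex crossed
    when [d] is added. Both sides of [tau] are the interiors of exactly two top
    simplexes ([other_coface]), namely [d] and one that is already white, so [tau]
    is a free face of [d] in the black set, and this set retracts onto what is
    left of it ([collapse]). A retract of a connected or simply connected set has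
    the same property, hence it is enough to study the complement of one open top
    simplex ([retract_along_stage]), except in low dimensions.

    Connectedness, in dimension at least two: the boundary of a simplex is
    connected, so its interior can be removed from [M] without disconnecting it
    ([outside_opencell_connected]).

    Simple connectedness, in dimension at least three: a loop in the complement of
    the open simplex contracts in [M]. By general position the homotopy, a map from
    a square, can be made to miss a point of the simplex: near the barycenter it is
    replaced by a piecewise linear map, with values on finitely many planes. It
    is then pushed off the simplex radially from that point ([push_off]).

    In dimension two, [K] is a graph, to be shown a tree. Let [e] be an edge of [K].
    The two triangles adjacent to [e] are connected through white edges, and together
    with [e] these form a cocycle modulo 2 that vanishes on all other edges of [K]
    ([black_edge_cocycle]). It defines a real line bundle on [M], realized as a
    continuous field of lines in the space of barycentric coordinates
    ([line_field]), along which a closed path through [e] in [K] reverses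
    orientation if it crosses [e] once. Line fields over a square are trivial
    ([line_lift]), so this is impossible in the simply connected space [M]: the ends
    of [e] are not joined by a path of [K] outside [e] ([black_edge_bridge]). A
    connected graph with this property is built from a vertex by attaching edges at
    one end, and remains a retract of a normed space during this process
    ([normed_retract_attach]); such retracts are simply connected.

    In dimension one the white set is an arc whose two ends meet at a single
    point, which is all of [K] ([dim1_point]). *)


(** * Continuity on subsets, finite sums and segments *)

Lemma within_comp (X Y Z : topologicalType) (A : set X) (B : set Y)
    (f : X -> Y) (g : Y -> Z) :
  {within A, continuous f} -> {within B, continuous g} ->
  (forall x, A x -> B (f x)) -> {within A, continuous (g \o f)}.
Proof.
move=> /subspace_continuousP cf /subspace_continuousP cg AB.
apply/subspace_continuousP => x Ax.
apply: cvg_comp (cg _ (AB _ Ax)) => W /=.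
rewrite /within /= => gW; have := cf _ Ax _ gW.
rewrite /nbhs /= /within /=; apply: filterS => y /= + Ay.
by move=> /(_ Ay); apply; exact: AB.
Qed.

Lemma within_comp_cont (X Y Z : topologicalType) (A : set X)
    (f : X -> Y) (g : Y -> Z) :
  {within A, continuous f} -> continuous g -> {within A, continuous (g \o f)}.
Proof.
move=> cf cg; apply: (within_comp (B := setT)) => //.
exact: continuous_subspaceT.
Qed.

Lemma eq_within (X Y : topologicalType) (A : set X) (f g : X -> Y) :
  (forall x, A x -> f x = g x) ->
  {within A, continuous f} -> {within A, continuous g}.
Proof.
by move=> fg; apply: subspace_eq_continuous => x; rewrite inE => /fg.
Qed.

(** Closed subsets of the compact set [Q] have compact, hence closed, images, so
    [p] is a quotient map from [Q] onto [p @` Q]. This is how continuity on [M] is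
    reduced to continuity on standard simplexes. *)
Lemma compact_quotient (X M Y : topologicalType) (Q : set X) (p : X -> M)
    (f : M -> Y) : hausdorff_space M -> compact Q -> {within Q, continuous p} ->
  {within Q, continuous (f \o p)} -> {within p @` Q, continuous f}.
Proof.
move=> hM cQ cp cfp; apply/continuous_closedP => Z cZ.
apply/closed_subspaceP.
move/continuous_closedP: cfp => /(_ _ cZ)/closed_subspaceP[V cV VZ].
exists (p @` (Q `&` V)).
  apply: compact_closed => //; apply: continuous_compact.
    by apply: continuous_subspaceW cp => x [].
  exact: compact_closedI.
rewrite predeqE => y; split.
  move=> [[x [Qx Vx] <-{y}] _]; split; last by exists x.
  by have : (V `&` Q) x by []; rewrite VZ => -[].
move=> [fy [x Qx xy]]; subst y; split; last by exists x.
exists x => //; split => //.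
by have : ((f \o p) @^-1` Z `&` Q) x by []; rewrite -VZ => -[].
Qed.

Lemma within_bigcup (X Y : topologicalType) (I : choiceType) (D : set I)
    (A : I -> set X) (f : X -> Y) :
  finite_set D -> (forall i, D i -> closed (A i)) ->
  (forall i, D i -> {within A i, continuous f}) ->
  {within \bigcup_(i in D) A i, continuous f}.
Proof.
move=> fD cA cf; apply/continuous_closedP => Z cZ; apply/closed_subspaceP.
exists (\bigcup_(i in D) (A i `&` f @^-1` Z)).
  apply: closed_bigcup => // i Di.
  move/continuous_closedP: (cf i Di) => /(_ _ cZ)/closed_subspaceP[V cV VZ].
  by rewrite setIC -VZ; apply: closedI => //; exact: cA.
rewrite predeqE => x; split; first by move=> [[i Di [Aix fx]] _]; split=> //; exists i.
by move=> [fx [i Di Aix]]; split; exists i.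
Qed.

Lemma continuous_mx (X : topologicalType) (R : realType) m n
    (f : X -> 'M[R]_(m, n)) :
  (forall i j, continuous (fun x => f x i j)) -> continuous f.
Proof.
move=> cf x B /= [P nP PB].
have : \forall y \near x, forall ij : 'I_m * 'I_n, P ij.1 ij.2 (f y ij.1 ij.2).
  by apply: filter_forall => -[i j]; exact: (cf i j x _ (nP i j)).
by apply: filterS => y Py; apply: PB => i j; exact: (Py (i, j)).
Qed.

Lemma continuous_sumr (X : topologicalType) (R : realType)
    (V : normedModType R) (I : Type) (s : seq I) (P : pred I) (f : I -> X -> V) :
  (forall i, P i -> continuous (f i)) ->
  continuous (fun x => \sum_(i <- s | P i) f i x).
Proof.
move=> cf; elim: s => [|i s IH].
  by under eq_fun do rewrite big_nil; exact: cst_continuous.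
rewrite (_ : (fun x => _) = fun x => if P i then f i x + \sum_(j <- s | P j) f j x
    else \sum_(j <- s | P j) f j x); last first.
  by apply/funext => x; rewrite big_cons.
case Pi: (P i) => x; [exact: (cvgD (cf i Pi x) (IH x))|exact: IH].
Qed.

Lemma continuous_bigmin (X : topologicalType) (R : realType)
    (I : Type) (s : seq I) (P : pred I) (f : I -> X -> R) (c : R) :
  (forall i, P i -> continuous (f i)) ->
  continuous (fun x => \big[Order.min/c]_(i <- s | P i) f i x).
Proof.
move=> cf; elim: s => [|i s IH].
  by under eq_fun do rewrite big_nil; exact: cst_continuous.
rewrite (_ : (fun x => _) = fun x => if P i then
      Order.min (f i x) (\big[Order.min/c]_(j <- s | P j) f j x)
    else \big[Order.min/c]_(j <- s | P j) f j x); last first.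
  by apply/funext => x; rewrite big_cons.
case Pi: (P i) => x; [exact: (continuous_min (cf i Pi x) (IH x))|exact: IH].
Qed.

Lemma line_cvg0 (R : realType) (V : normedModType R) (x v : V) :
  (fun t : R => x + t *: v) @ 0 --> x.
Proof.
rewrite -[in X in _ --> X](addr0 x) -(scale0r v).
by apply: cvgD; [exact: cvg_cst|apply: cvgZr_tmp; exact: cvg_id].
Qed.

Lemma uniform_diagonal (R : realType) (X : pseudoMetricType R) (K : set X) (Q : X -> X -> Prop) :
  compact K ->
  (forall x, K x -> exists2 e, 0 < e & forall a b, ball x e a -> ball x e b -> Q a b) ->
  exists2 delta, 0 < delta & forall z z', K z -> ball z delta z' -> Q z z'.
Proof.
move=> /compact_near_coveringP cK HQ.
have : \forall delta \near (0 : R)^'+, K `<=` (fun z => forall z', ball z delta z' -> Q z z').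
  apply: cK => x Kx; have [e e0 he] := HQ x Kx.
  exists (ball x (e / 2), [set d : R | d < e / 2]) => /=.
    split; first by apply: nbhsx_ballx; rewrite divr_gt0.
    by apply: nbhs_right_lt; rewrite divr_gt0.
  move=> [z d] /= [xz de] z' zz'; apply: he.
    by apply: le_ball xz; lra.
  apply: (@le_ball _ _ _ (e / 2 + d)); first by lra.
  exact: ball_triangle zz'.
move=> H; have [d [Hd d0]] : exists d : R,
    (K `<=` fun z => forall z', ball z d z' -> Q z z') /\ 0 < d.
  by near (0 : R)^'+ => d; exists d; split; [near: d|near: d; exact: nbhs_right_gt].
by exists d => // z z' Kz; exact: Hd.
Unshelve. all: by end_near.
Qed.

Lemma nbhs_line (R : realType) (V : normedModType R) (x v : V) (B : set V) :
  nbhs x B -> exists2 t : R, 0 < t <= 1 & B (x + t *: v).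
Proof.
move=> nB; have /nbhs_ballP [e /= e0 he] := @line_cvg0 _ _ x v _ nB.
pose t := Num.min 1 (e / 2).
have t0 : 0 < t by rewrite lt_min ltr01 divr_gt0.
exists t; first by rewrite t0 ge_min lexx.
apply: he; rewrite /ball /= sub0r normrN gtr0_norm // gt_min; apply/orP; right.
by rewrite ltr_pdivrMr // ltr_pMr // ltr1n.
Qed.

Lemma ball_segment (R : realType) (V : normedModType R) (x z w : V) (e t : R) :
  ball x e z -> ball x e w -> 0 <= t <= 1 -> ball x e (w + t *: (z - w)).
Proof.
rewrite -!ball_normE /= => xz xw /andP[t0 t1].
have -> : x - (w + t *: (z - w)) = t *: (x - z) + (1 - t) *: (x - w).
  have -> : z - w = (x - w) - (x - z) by rewrite opprB [RHS]addrC addrA subrK.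
  rewrite opprD addrA; move: (x - w) (x - z) => a b.
  by rewrite scalerBr opprB scalerBl scale1r addrCA.
apply: (le_lt_trans (ler_normD _ _)); rewrite !normrZ !ger0_norm ?subr_ge0 //.
have [->|tn0] := eqVneq t 0; first by rewrite mul0r add0r subr0 mul1r.
have tp : 0 < t by rewrite lt_neqAle eq_sym tn0.
nra.
Qed.

(** * The standard simplex in barycentric coordinates *)

Section Simplex.
Variable R : realType.
Implicit Types l : nat.

Definition bary l (x : 'rV[R]_l) (i : 'I_l.+1) : R :=
  if unlift ord0 i is Some j then x 0 j else 1 - \sum_j x 0 j.

Definition of_bary l (b : 'I_l.+1 -> R) : 'rV[R]_l := \row_j b (lift ord0 j).

Lemma bary0 l (x : 'rV[R]_l) : bary x ord0 = 1 - \sum_j x 0 j.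
Proof. by rewrite /bary unlift_none. Qed.

Lemma baryS l (x : 'rV[R]_l) j : bary x (lift ord0 j) = x 0 j.
Proof. by rewrite /bary liftK. Qed.

Lemma sum_bary l (x : 'rV[R]_l) : \sum_i bary x i = 1.
Proof.
rewrite big_ord_recl bary0.
rewrite [X in _ + X](_ : _ = \sum_j x 0 j) ?subrK //.
by apply: eq_bigr => j _; rewrite baryS.
Qed.

Lemma bary_inj l (x y : 'rV[R]_l) : bary x =1 bary y -> x = y.
Proof. by move=> xy; apply/rowP => j; rewrite -!baryS xy. Qed.

Lemma bary_of l (b : 'I_l.+1 -> R) i : \sum_i b i = 1 -> bary (of_bary b) i = b i.
Proof.
move=> b1; case: (unliftP ord0 i) => [j|] ->; first by rewrite baryS mxE.
rewrite bary0; under eq_bigr do rewrite mxE.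
by rewrite -b1 big_ord_recl addrK.
Qed.

Lemma bary_continuous l i : continuous (fun x : 'rV[R]_l => bary x i).
Proof.
case: (unliftP ord0 i) => [j|] ->.
  by under eq_fun do rewrite baryS; exact: coord_continuous.
under eq_fun do rewrite bary0.
move=> x; apply: continuousB; first exact: cst_continuous.
by apply: continuous_sumr => j _; exact: coord_continuous.
Qed.

Lemma bary_comb l (x y z : 'rV[R]_l) t i :
  bary (x + t *: (y - z)) i = bary x i + t * (bary y i - bary z i).
Proof.
case: (unliftP ord0 i) => [j|] ->; first by rewrite !baryS !mxE.
rewrite !bary0; under eq_bigr do rewrite !mxE.
rewrite big_split /= -mulr_sumr big_split /= sumrN; ring.
Qed.

Lemma simplexE l (x : 'rV[R]_l) : simplex R l x <-> forall i, 0 <= bary x i.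
Proof.
split=> [[x01 x1] i|x0].
  case: (unliftP ord0 i) => [j|] ->; first by rewrite baryS; case/andP: (x01 j).
  by rewrite bary0 subr_ge0.
have x1 : \sum_i x 0 i <= 1 by rewrite -subr_ge0 -bary0.
split=> // i; have xi j : 0 <= x 0 j by rewrite -baryS.
rewrite xi /=; apply: le_trans x1.
by rewrite (bigD1 i) //= lerDl sumr_ge0.
Qed.

Lemma bary_vertex l (i j : 'I_l.+1) : bary (vertex R i) j = (i == j)%:R.
Proof.
case: (unliftP ord0 j) => [k|] ->; first by rewrite baryS mxE.
rewrite bary0; under eq_bigr do rewrite mxE.
case: (unliftP ord0 i) => [k|] ->.
  rewrite (bigD1 k) //= eqxx big1 ?addr0 ?subrr; last first.
    by move=> m mk; rewrite (inj_eq lift_inj) eq_sym (negbTE mk).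
  by [].
by rewrite eqxx big1 ?subr0 // => k _; rewrite (negbTE (neq_lift _ _)).
Qed.

Definition positive_bary l : set 'rV[R]_l := [set x | forall i, 0 < bary x i].

Lemma open_positive_bary l : open (@positive_bary l).
Proof.
move=> x x0.
have : \forall y \near x, forall i, 0 < bary y i.
  have FF : Filter (nbhs x) by exact: nbhs_filter.
  refine (@filter_forall _ _ (fun i y => 0 < bary y i) _ FF _) => i.
  exact: (bary_continuous (lt_nbhsr (x0 i))).
by [].
Qed.

(** Moving away from the [i]th vertex decreases the [i]th coordinate, so no
    coordinate vanishes at an interior point. *)
Lemma simplex_interior l : (simplex R l)° = @positive_bary l.
Proof.
rewrite predeqE => x; split; last first.
  move=> x0; apply: filterS (open_positive_bary x0) => y y0.
  by apply/simplexE => i; exact/ltW.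
move=> xint i; rewrite lt_neqAle; apply/andP; split; last first.
  by have := (simplexE x).1 (interior_subset xint).
apply/eqP => xi0; have : exists v, bary (vertex R v) i = 1.
  by exists i; rewrite bary_vertex eqxx.
move=> [v vi].
have [t /andP[t0 _]] := nbhs_line (x - vertex R v) xint.
move=> /simplexE/(_ i); rewrite bary_comb -xi0 vi add0r sub0r mulrN1 oppr_ge0.
by rewrite leNgt t0.
Qed.

Lemma sub_positive_bary l : @positive_bary l `<=` simplex R l.
Proof. by move=> x x0; apply/simplexE => i; exact/ltW. Qed.

Lemma bary_face l (i : 'I_l.+2) (x : 'rV[R]_l) j :
  bary (face_map i x) j = if unlift i j is Some k then bary x k else 0.
Proof.
have E : bary (face_map i x) j = \sum_k bary x k * (lift i k == j)%:R.
  have -> : face_map i x = vertex R (lift i ord0) +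
      \sum_k x 0 k *: (vertex R (lift i (lift ord0 k)) - vertex R (lift i ord0)).
    rewrite /face_map scalerBl scale1r -addrA; congr (_ + _).
    under [in RHS]eq_bigr do rewrite scalerBr.
    by rewrite big_split /= sumrN addrC -scaler_suml.
  have sumE (s : seq 'I_l) y : bary (y + \sum_(k <- s) x 0 k *:
      (vertex R (lift i (lift ord0 k)) - vertex R (lift i ord0))) j =
      bary y j + \sum_(k <- s) x 0 k * (bary (vertex R (lift i (lift ord0 k))) j
        - bary (vertex R (lift i ord0)) j).
    elim: s y => [|k s IH] y; first by rewrite !big_nil !addr0.
    by rewrite !big_cons !addrA IH bary_comb.
  rewrite sumE big_ord_recl bary0 !bary_vertex mulrBl mul1r -addrA.
  congr (_ + _); under [LHS]eq_bigr do rewrite bary_vertex mulrBr.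
  rewrite big_split /= sumrN -mulr_suml addrC; congr (_ + _).
  by apply: eq_bigr => k _; rewrite baryS.
rewrite E; case: (unliftP i j) => [k|] ->; last first.
  by rewrite big1 // => k _; rewrite eq_sym (negbTE (neq_lift _ _)) mulr0.
rewrite (bigD1 k) //= eqxx mulr1 big1 ?addr0 // => m mk.
by rewrite (inj_eq lift_inj) (negbTE mk) mulr0.
Qed.

Lemma bary_face_lift l (i : 'I_l.+2) (x : 'rV[R]_l) k :
  bary (face_map i x) (lift i k) = bary x k.
Proof. by rewrite bary_face liftK. Qed.

Lemma bary_face_self l (i : 'I_l.+2) (x : 'rV[R]_l) : bary (face_map i x) i = 0.
Proof. by rewrite bary_face unlift_none. Qed.

Lemma face_map_simplex l (i : 'I_l.+2) (x : 'rV[R]_l) :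
  simplex R l x -> simplex R l.+1 (face_map i x).
Proof.
move=> /simplexE x0; apply/simplexE => j; rewrite bary_face.
by case: unliftP.
Qed.

Lemma bary_eq0_face l (i : 'I_l.+2) (x : 'rV[R]_l.+1) :
  bary x i = 0 -> exists2 y, x = face_map i y & forall k, bary y k = bary x (lift i k).
Proof.
move=> xi0; have s1 : \sum_k bary x (lift i k) = 1.
  rewrite -(sum_bary x) (bigD1_ord i) //= xi0 add0r.
  by apply: eq_bigr.
exists (of_bary (fun k => bary x (lift i k))); last by move=> k; rewrite bary_of.
apply: bary_inj => j; case: (unliftP i j) => [k|] ->; last by rewrite bary_face_self.
by rewrite bary_face_lift bary_of.
Qed.

Lemma simplex_boundary l (x : 'rV[R]_l) : simplex R l x -> ~ positive_bary x ->
  exists i, bary x i = 0.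
Proof.
move=> /simplexE x0; rewrite /positive_bary /= => /existsNP[i].
move/negP; rewrite -leNgt => xi; exists i; apply/eqP.
by rewrite eq_le xi x0.
Qed.

Lemma positive_bary0 (x : 'rV[R]_0) : positive_bary x.
Proof. by move=> i; rewrite (ord1 i) bary0 big_ord0 subr0. Qed.

Lemma simplex_compact l : compact (simplex R l).
Proof.
have -> : simplex R l = [set v : 'rV[R]_l | forall i, `[0, 1]%classic (v ord0 i)]
    `&` [set x | 0 <= bary x ord0].
  rewrite predeqE => x; rewrite /= bary0 subr_ge0 /simplex /=.
  by split=> -[h1 h2]; split=> // i; have := h1 i; rewrite /= in_itv.
apply: compact_closedI.
  by apply: (@rV_compact R l (fun=> `[0, 1]%classic)) => i; exact: segment_compact.
apply: (@closed_comp _ _ (fun x : 'rV[R]_l => bary x ord0) [set y | 0 <= y]).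
  by move=> x _; exact: bary_continuous.
exact: closed_ge.
Qed.

Lemma vertex_simplex l i : simplex R l (vertex R i).
Proof. by apply/simplexE => j; rewrite bary_vertex ler0n. Qed.

Definition barycenter l : 'rV[R]_l := of_bary (fun=> l.+1%:R^-1).

Lemma bary_barycenter l i : bary (barycenter l) i = l.+1%:R^-1.
Proof.
by rewrite bary_of // sumr_const card_ord -[LHS]mulr_natl divff // pnatr_eq0.
Qed.

Lemma barycenter_positive l : positive_bary (barycenter l).
Proof. by move=> i; rewrite bary_barycenter invr_gt0 ltr0n. Qed.

Lemma segment_positive l (x y : 'rV[R]_l) t : positive_bary x ->
  simplex R l y -> 0 < t <= 1 -> positive_bary (y + t *: (x - y)).
Proof.
move=> x0 /simplexE y0 /andP[t0 t1] i; rewrite bary_comb.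
have := x0 i; have := y0 i; nra.
Qed.

Lemma simplex_closure l : simplex R l `<=` closure (@positive_bary l).
Proof.
move=> y sy B nB.
have [t t01 Bt] := nbhs_line (barycenter l - y) nB.
exists (y + t *: (barycenter l - y)); split => //.
by apply: segment_positive => //; exact: barycenter_positive.
Qed.

Lemma simplex_convex l (x y : 'rV[R]_l) t : simplex R l x -> simplex R l y ->
  0 <= t <= 1 -> simplex R l (x + t *: (y - x)).
Proof.
move=> /simplexE x0 /simplexE y0 /andP[t0 t1]; apply/simplexE => i.
by rewrite bary_comb; have := x0 i; have := y0 i; nra.
Qed.

Lemma bary_le1 l (x : 'rV[R]_l) k : simplex R l x -> bary x k <= 1.
Proof.
move=> /simplexE x0; rewrite -(sum_bary x) (bigD1 k) //= lerDl.
by apply: sumr_ge0.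
Qed.

Lemma face_map_vertex l (k : 'I_l.+2) (i : 'I_l.+1) :
  face_map k (vertex R i) = vertex R (lift k i).
Proof.
apply: bary_inj => j; rewrite bary_face bary_vertex.
case: (unliftP k j) => [j'|] ->; first by rewrite bary_vertex (inj_eq lift_inj).
by rewrite eq_sym (negbTE (neq_lift _ _)).
Qed.

End Simplex.

Lemma ord2P (i : 'I_2) : i = ord0 \/ i = ord_max.
Proof. by case: i => [[|[|//]] lt]; [left|right]; apply: val_inj. Qed.

(** * Open maps from smooth left inverses *)

Section RowNorm.
Variable R : realType.

Lemma row_norm_coord n (x : 'rV[R]_n) j : `|x 0 j| <= `|x|.
Proof.
rewrite [leRHS]/Num.norm/= mx_normrE.
exact: (@le_bigmax _ _ _ 0 (fun i : 'I_1 * 'I_n => `|x i.1 i.2|) (0, j)).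
Qed.

Lemma row_subE n (x y : 'rV[R]_n) j : (x - y) 0 j = x 0 j - y 0 j.
Proof. by rewrite !mxE. Qed.

Lemma row_sum_diff n m (a : 'I_n -> R) (x y : 'I_n -> 'rV[R]_m) j :
  (\sum_k a k *: x k) 0 j - (\sum_k a k *: y k) 0 j =
  \sum_k a k * (x k 0 j - y k 0 j).
Proof.
by rewrite !summxE -sumrB; apply: eq_bigr => k _; rewrite !mxE mulrBr.
Qed.

Lemma row_norm_le n (x : 'rV[R]_n) e : 0 <= e ->
  (forall j, `|x 0 j| <= e) -> `|x| <= e.
Proof.
move=> e0 xe; rewrite [leLHS]/Num.norm/= mx_normrE.
by apply/bigmax_leP; split => // -[i j] _ /=; rewrite (ord1 i).
Qed.

End RowNorm.

Section MeanValue.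
Variables (R : realType) (n m : nat).
Implicit Types (h : 'rV[R]_n -> 'rV[R]_m).

Lemma is_derive_line h (w v : 'rV[R]_n) j t :
  differentiable h (w + t *: v) ->
  is_derive t 1 (fun s : R => h (w + s *: v) 0 j) ('D_v h (w + t *: v) 0 j).
Proof.
move=> dh.
have /cvg_ex[l hl] : derivable h (w + t *: v) v by exact: diff_derivable.
have hl' : 'D_v h (w + t *: v) = l by exact: (cvg_lim _ hl).
have H : (fun k : R => k^-1 *: (((fun s : R => h (w + s *: v) 0 j) \o shift t) (k *: 1)
    - h (w + t *: v) 0 j)) @ 0^' --> l 0 j.
  have -> : (fun k : R => k^-1 *: (((fun s : R => h (w + s *: v) 0 j) \o shift t) (k *: 1)
    - h (w + t *: v) 0 j)) = (fun M : 'rV[R]_m => M 0 j) \o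
    (fun k : R => k^-1 *: ((h \o shift (w + t *: v)) (k *: v) - h (w + t *: v))).
    apply/funext => k /=; rewrite !mxE; congr (_ * (h _ _ _ - _)).
    by rewrite [k%:A]mulr1 scalerDl addrCA.
  by apply: cvg_comp hl _; exact: coord_continuous.
by apply: DeriveDef; [apply/cvg_ex; exists (l 0 j)|rewrite hl'; exact: cvg_lim].
Qed.

(** Mean value inequality: the partial derivatives are continuous, so on a small
    ball [h - 'd h y] has small partial derivatives and a small Lipschitz
    constant. *)
Lemma C1_strict_diff (U : set 'rV[R]_n) h y :
  open U -> U y -> (forall x, U x -> differentiable h x) ->
  (forall v x, U x -> {for x, continuous (fun z => 'D_v h z)}) ->
  forall eta, 0 < eta -> exists2 e, 0 < e &
    (forall z w, ball y e z -> ball y e w ->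
      `|h z - h w - 'd h y (z - w)| <= eta * `|z - w|).
Proof.
move=> oU Uy dh ch eta eta0.
pose e' := eta / n.+1%:R.
have e'0 : 0 < e' by rewrite divr_gt0.
pose b k : 'rV[R]_n := delta_mx 0 k.
have : \forall x \near y, U x /\ forall k, `|'D_(b k) h y - 'D_(b k) h x| < e'.
  apply: filterI; first exact: open_nbhs_nbhs.
  have FF : Filter (nbhs y) by exact: nbhs_filter.
  refine (@filter_forall _ _ (fun k x => `|'D_(b k) h y - 'D_(b k) h x| < e') _ FF _) => k.
  by have /cvgrPdist_lt/(_ _ e'0) := ch (b k) y Uy.
move=> /nbhs_ballP[e /= e0 he]; exists e => // z w yz yw.
have ysegm t : 0 <= t <= 1 -> ball y e (w + t *: (z - w)) by exact: ball_segment.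
apply: row_norm_le => [|j]; first by rewrite mulr_ge0 // ltW.
set v := z - w.
have dlin (x : 'rV[R]_n) : U x -> 'D_v h x = \sum_k v 0 k *: 'D_(b k) h x.
  move=> Ux; rewrite deriveE; last exact: dh.
  rewrite [X in 'd h x X](row_sum_delta v) linear_sum; apply: eq_bigr => k _.
  by rewrite linearZ deriveE //; exact: dh.
have Useg t : 0 <= t <= 1 -> U (w + t *: v) by move=> /ysegm/he[].
have drv (t : R) : 0 <= t <= 1 -> is_derive t 1 (fun s : R => h (w + s *: v) 0 j)
    ('D_v h (w + t *: v) 0 j).
  by move=> t01; apply: is_derive_line; exact: dh (Useg _ t01).
have [c c01 hc] : exists2 c, c \in `[0, 1]%R & h (w + 1 *: v) 0 j - h (w + 0 *: v) 0 j
    = 'D_v h (w + c *: v) 0 j * (1 - 0).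
  apply: (@MVT_segment R (fun s : R => h (w + s *: v) 0 j)
    (fun t => 'D_v h (w + t *: v) 0 j)); first exact: ler01.
    move=> x; rewrite in_itv /= => /andP[x0 x1].
    by apply: drv; rewrite !ltW.
  apply: continuous_in_subspaceT => x; rewrite inE /= in_itv /= => x01.
  by apply: differentiable_continuous; apply/derivable1_diffP; case: (drv x x01).
have {}hc : (h z - h w) 0 j = 'D_v h (w + c *: v) 0 j.
  by rewrite row_subE -[RHS]mulr1 -[X in _ * X]subr0 -hc scale1r scale0r addr0 subrKC.
rewrite in_itv /= in c01.
have -> : (h z - h w - 'd h y v) 0 j =
   \sum_k v 0 k * ('D_(b k) h (w + c *: v) 0 j - 'D_(b k) h y 0 j).
  rewrite row_subE hc -deriveE; last exact: dh.
  rewrite !dlin //; last exact: Useg.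
  exact: (row_sum_diff _ (fun k => 'D_(b k) h (w + c *: v))
    (fun k => 'D_(b k) h y)).
apply: le_trans (ler_norm_sum _ _ _) _.
apply: (@le_trans _ _ (\sum_(k < n) `|v| * e')).
  apply: ler_sum => k _; rewrite normrM; apply: ler_pM => //; first exact: row_norm_coord.
  have [_ /(_ k)/ltW] := he _ (ysegm _ c01).
  apply: le_trans; rewrite -normrN opprB.
  by rewrite -row_subE; exact: row_norm_coord.
rewrite sumr_const card_ord -mulrnAr mulrC; apply: ler_wpM2r => //.
rewrite /e' -mulr_natr -mulrA -[leRHS]mulr1; apply: ler_wpM2l; first exact: ltW.
by rewrite mulrC ler_pdivrMr // mul1r ler_nat.
Qed.

End MeanValue.

(** As dimensions agree, the differential of the left inverse [h] at [f x] is also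
    injective, so [h] is injective near [f x]. Since [h (f (h z)) = h z], all points
    [z] near [f x] are values of [f]. This replaces the inverse function theorem. *)
Lemma left_inverse_open (R : realType) (n : nat) (U W : set 'rV[R]_n)
    (f h : 'rV[R]_n -> 'rV[R]_n) x :
  open U -> U x -> open W -> (forall z, U z -> W (f z)) ->
  differentiable f x -> {for x, continuous f} ->
  (forall z, W z -> differentiable h z) ->
  (forall v z, W z -> {for z, continuous (fun z => 'D_v h z)}) ->
  (forall z, U z -> h (f z) = z) ->
  forall V, nbhs x V -> nbhs (f x) (f @` V).
Proof.
move=> oU Ux oW UW df cf dh ch hf V nV.
have Wy := UW _ Ux; set y := f x in Wy *.
pose A := lin1_mx ('d h y); pose B := lin1_mx ('d f x).
have BA : B *m A = 1%:M.
  apply/row_matrixP => i; rewrite !rowE mulmxA !mul_rV_lin1 mulmx1.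
  have := diff_comp df (dh _ Wy).
  move=> /(congr1 (fun F => F (delta_mx 0 i))) /= <-.
  rewrite -deriveE; last exact: (differentiable_comp df (dh _ Wy)).
  have -> : 'D_(delta_mx 0 i) (h \o f) x = 'D_(delta_mx 0 i) id x.
    apply: near_eq_derive; near=> z; apply: hf; near: z.
    exact: open_nbhs_nbhs.
  by rewrite derive_id.
have AB : A *m B = 1%:M by exact: mulmx1C.
have [K K0 hK] := linear_lipschitz (diff_continuous df).
have AK v : `|v| <= K * `|'d h y v|.
  rewrite -{1}(mulmx1 v) -AB mulmxA mul_rV_lin1 mul_rV_lin1; exact: hK.
have eta0 : 0 < (2 * K)^-1 by rewrite invr_gt0 mulr_gt0.
have [e e0 he] := C1_strict_diff oW Wy dh ch eta0.
have inj z w : ball y e z -> ball y e w -> h z = h w -> z = w.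
  move=> yz yw zw; have := he _ _ yz yw; rewrite zw subrr sub0r normrN => hd.
  have := AK (z - w) => hd2; apply/eqP; rewrite -subr_eq0 -normr_le0.
  have : K * `|'d h y (z - w)| <= K * ((2 * K)^-1 * `|z - w|) by rewrite ler_pM2l.
  rewrite invfM mulrA mulrCA mulfV ?gt_eqF // mulr1.
  by move: hd2; set a := `|z - w|; set bb := K * _; lra.
have ch0 : {for y, continuous h} by exact: differentiable_continuous (dh _ Wy).
have hy : h y = x by exact: hf.
have nV' : nbhs x (V `&` U `&` f @^-1` (ball y e)).
  apply: filterI; first by apply: filterI => //; exact: open_nbhs_nbhs.
  by apply: cf; exact: nbhsx_ballx.
rewrite -hy in nV'; have ny : nbhs y (h @^-1` (V `&` U `&` f @^-1` (ball y e))) := ch0 _ nV'.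
refine (filterS _ (filterI ny (nbhsx_ballx y e e0))).
move=> z [[[Vhz Uhz] fhz] yz]; exists (h z) => //.
by apply: inj => //; exact: hf.
Unshelve. all: by end_near.
Qed.

(** * Top dimensional simplexes have open interiors *)

Lemma chart_image_open (R : realType) n (M : topologicalType) (c : chart R n M)
  (W : set M) : open W -> open (chart_map c @` (W `&` chart_dom c)).
Proof.
move=> oW; rewrite openE => _ [z [Wz cz] <-].
have cu : (chart_map c @` chart_dom c) (chart_map c z) by exists z.
have n1 : nbhs (chart_map c z) (chart_map c @` chart_dom c).
  by apply: open_nbhs_nbhs; split => //; exact: chart_img_open.
have n2 : nbhs (chart_map c z) (chart_inv c @^-1` W).
  apply: (chart_inv_continuous cu); rewrite chart_mapK //.
  exact: open_nbhs_nbhs.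
apply: filterS (filterI n1 n2) => _ [[z' cz' <-] /=].
by rewrite chart_mapK // => Wz'; exists z'.
Qed.

(** Read in a chart, the smooth left inverse of an embedding is a smooth map
    between spaces of equal dimension, so the embedding is an open map. *)
Lemma diffeo_open_map (R : realType) n (M : topologicalType)
    (A : smooth_atlas R n M) (U : set 'rV[R]_n) (f : 'rV[R]_n -> M) :
  open U -> diffeo_onto_image A U f ->
  forall x V, U x -> nbhs x V -> nbhs (f x) (f @` V).
Proof.
move=> oU [[cf sf] [g gf sg]] x V Ux nV.
have [c Ac cy] := charts_cover A (f x).
have [W [hh [oW Wy sW hg]]] := sg (f x) (imageP f Ux).
set U0 := U `&` f @^-1` (chart_dom c `&` W).
have oU0 : open U0.
  rewrite openE => z [Uz fz]; apply: filterI; first exact: open_nbhs_nbhs.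
  apply: (cf z Uz); apply: open_nbhs_nbhs; split=> //.
  by apply: openI => //; exact: chart_dom_open.
have U0x : U0 x by [].
pose W0 := chart_map c @` (W `&` chart_dom c).
have oW0 : open W0 by exact: chart_image_open.
pose f1 := chart_map c \o f; pose h1 := hh \o chart_inv c.
have UW z : U0 z -> W0 (f1 z) by move=> [_ [? ?]]; exists (f z).
have df1 : differentiable f1 x by have [dd _] := sf c Ac 1%N; exact: (dd x (conj Ux cy)).
have cf1 : {for x, continuous f1} by have dd := sf c Ac 0%N; exact: (dd x (conj Ux cy)).
have [dh1 ch1] := sW c Ac 1%N.
have hf z : U0 z -> h1 (f1 z) = z.
  move=> [Uz [cz Wz]]; rewrite /h1 /f1 /= chart_mapK // (hg _ (imageP f Uz) Wz).
  exact: gf.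
have nV0 : nbhs x (V `&` U0) by apply: filterI => //; exact: open_nbhs_nbhs.
have n1 : nbhs (f x) (chart_map c @^-1` (f1 @` (V `&` U0))) :=
  chart_map_continuous cy
    (left_inverse_open oU0 U0x oW0 UW df1 cf1 dh1 ch1 hf nV0).
have n2 : nbhs (f x) (chart_dom c).
  by apply: open_nbhs_nbhs; split => //; exact: chart_dom_open.
refine (filterS _ (filterI n1 n2)) => z [[v [Vv [Uv [cv Wv]]] vz] cz].
exists v => //; by rewrite -(chart_mapK cz) -vz /f1 /= chart_mapK.
Qed.

(** * Simplexes of the triangulation and their carriers *)

Section Triangulation.
Variables (R : realType) (n : nat) (M : topologicalType).
Variables (A : smooth_atlas R n M) (T : triangulation A).
Hypothesis hM : hausdorff_space M.
Implicit Types l : nat.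

Definition cell l (phi : 'rV[R]_l -> M) := phi @` simplex R l.
Definition opencell l (phi : 'rV[R]_l -> M) := phi @` (simplex R l)°.

Lemma opencellE l (phi : 'rV[R]_l -> M) : opencell phi = phi @` @positive_bary R l.
Proof. by rewrite /opencell simplex_interior. Qed.

Lemma opencell_sub l (phi : 'rV[R]_l -> M) : opencell phi `<=` cell phi.
Proof. by apply: image_subset; exact: interior_subset. Qed.

Lemma Phi_dim_le l (phi : 'rV[R]_l -> M) : T l phi -> (l <= n)%N.
Proof.
move=> Tphi; rewrite leqNgt; apply/negP => /(Phi_dim T) T0.
by rewrite T0 in Tphi.
Qed.

Lemma Phi_continuous l (phi : 'rV[R]_l -> M) :
  T l phi -> {within simplex R l, continuous phi}.
Proof.
move=> Tphi; have [U [f [oU sU [[cf _] _] fphi]]] := Phi_diffeo Tphi.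
apply: (eq_within fphi); apply: continuous_in_subspaceT => x; rewrite inE => sx.
by apply: cf; exact: sU.
Qed.

Lemma Phi_inj l (phi : 'rV[R]_l -> M) x y :
  T l phi -> simplex R l x -> simplex R l y -> phi x = phi y -> x = y.
Proof.
move=> Tphi sx sy; have [U [f [oU sU [_ [g gf _]] fphi]]] := Phi_diffeo Tphi.
rewrite -!fphi // => fxy.
by rewrite -(gf x (sU _ sx)) fxy gf //; exact: sU.
Qed.

Lemma cell_compact l (phi : 'rV[R]_l -> M) : T l phi -> compact (cell phi).
Proof.
move=> Tphi; apply: continuous_compact; last exact: simplex_compact.
exact: Phi_continuous.
Qed.

Lemma cell_closed l (phi : 'rV[R]_l -> M) : T l phi -> closed (cell phi).
Proof. by move=> Tphi; apply: compact_closed => //; exact: cell_compact. Qed.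

Lemma opencell_eq l k (phi : 'rV[R]_l -> M) (psi : 'rV[R]_k -> M) p :
  T l phi -> T k psi -> opencell phi p -> opencell psi p ->
  existT (fun l => 'rV[R]_l -> M) l phi = existT _ k psi.
Proof.
move=> Tphi Tpsi pp ps.
apply: (@Phi_disjoint _ _ _ _ T (existT _ l phi) (existT _ k psi)) => //=.
by exists p.
Qed.

Lemma opencell_inj l (phi psi : 'rV[R]_l -> M) p :
  T l phi -> T l psi -> opencell phi p -> opencell psi p -> phi = psi.
Proof. by move=> h1 h2 h3 h4; exact: existT_inj2 (opencell_eq h1 h2 h3 h4). Qed.


Lemma boundary_not_opencell l (d : 'rV[R]_l -> M) x i :
  T l d -> simplex R l x -> bary x i = 0 -> ~ opencell d (d x).
Proof.
move=> Td sx xi; rewrite opencellE => -[y py].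
move/(Phi_inj Td (sub_positive_bary py) sx) => E; have := py i.
by rewrite E xi ltxx.
Qed.

Lemma cell_face l (phi : 'rV[R]_l.+1 -> M) p : T l.+1 phi -> cell phi p ->
  opencell phi p \/ exists2 psi, T l psi & is_face psi phi /\ cell psi p.
Proof.
move=> Tphi [x sx <-{p}].
have [px|npx] := pselect (positive_bary x).
  by left; rewrite opencellE; exists x.
right; have [i xi0] := simplex_boundary sx npx.
have [y xy yb] := bary_eq0_face xi0.
have [psi Tpsi psiE] := Phi_face i Tphi.
have sy : simplex R l y by apply/simplexE => k; rewrite yb; exact/(simplexE x).1.
by exists psi => //; split; [exists i|exists y => //; rewrite psiE // xy].
Qed.

(** Each point of a closed simplex is interior to one of its faces; with the
    disjointness of open simplexes this determines how closed and open simplexes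
    meet. *)
Lemma cell_carrier l (phi : 'rV[R]_l -> M) p : T l phi -> cell phi p ->
  exists k, (k <= l)%N /\ exists2 psi, T k psi & opencell psi p.
Proof.
elim: l phi => [|l IH] phi Tphi.
  move=> [x _ xp]; exists 0%N; split => //; exists phi => //.
  by rewrite opencellE; exists x => //; exact: positive_bary0.
move=> /(cell_face Tphi)[op|[psi Tpsi [_ /(IH _ Tpsi)[k [kl kpsi]]]]].
  by exists l.+1; split => //; exists phi.
by exists k; split => //; exact: leqW.
Qed.

Lemma cell_opencell_le l k (phi : 'rV[R]_l -> M) (psi : 'rV[R]_k -> M) p :
  T l phi -> T k psi -> cell phi p -> opencell psi p -> (k <= l)%N.
Proof.
move=> Tphi Tpsi /(cell_carrier Tphi)[j [jl [chi Tchi cp]]] pp.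
by rewrite (existT_inj1 (opencell_eq Tpsi Tchi pp cp)).
Qed.

Lemma cell_opencell_eq l (phi psi : 'rV[R]_l -> M) p :
  T l phi -> T l psi -> cell phi p -> opencell psi p -> phi = psi.
Proof.
case: l phi psi => [|l] phi psi Tphi Tpsi cp op.
  apply: (opencell_inj (p := p)) => //; case: cp => x _ xp.
  by rewrite opencellE; exists x => //; exact: positive_bary0.
case: (cell_face Tphi cp) => [op'|[chi Tchi [_ cchi]]]; first exact: opencell_inj op.
by have := cell_opencell_le Tchi Tpsi cchi op; rewrite ltnn.
Qed.

Lemma cell_opencell_face l (phi : 'rV[R]_l.+1 -> M) (psi : 'rV[R]_l -> M) p :
  T l.+1 phi -> T l psi -> cell phi p -> opencell psi p -> is_face psi phi.
Proof.
move=> Tphi Tpsi cp op.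
case: (cell_face Tphi cp) => [op'|[chi Tchi [fchi cchi]]].
  by have /eqP := existT_inj1 (opencell_eq Tphi Tpsi op' op); rewrite gtn_eqF.
by rewrite -(cell_opencell_eq Tchi Tpsi cchi op).
Qed.

Lemma face_cell l (phi : 'rV[R]_l.+1 -> M) (psi : 'rV[R]_l -> M) :
  is_face psi phi -> cell psi `<=` cell phi.
Proof.
move=> [i ip] _ [x sx <-]; exists (face_map i x); last by rewrite ip.
exact: face_map_simplex.
Qed.

Definition cells : set (set M) :=
  [set C | exists l, exists2 phi, T l phi & C = @cell l phi].

Lemma cells_finite : finite_set cells.
Proof.
apply: (@sub_finite_set _ _ (\bigcup_(l in `I_n.+1) (@cell l @` T l))).
  move=> C [l [phi Tphi ->]]; exists l; last by exists phi.
  by rewrite /= ltnS; exact: (Phi_dim_le Tphi).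
apply: bigcup_finite; first exact: finite_II.
by move=> l _; apply: finite_image; exact: Phi_finite.
Qed.

Lemma closed_cells (D : set (set M)) : D `<=` cells ->
  closed (\bigcup_(C in D) C).
Proof.
move=> Dc; apply: closed_bigcup; first exact: sub_finite_set Dc cells_finite.
by move=> C /Dc[l [phi Tphi ->]]; exact: cell_closed.
Qed.

Lemma continuous_cells (Y : topologicalType) (f : M -> Y) (D : set (set M)) :
  D `<=` cells ->
  (forall l phi, T l phi -> D (@cell l phi) ->
    {within simplex R l, continuous (f \o phi)}) ->
  {within \bigcup_(C in D) C, continuous f}.
Proof.
move=> Dc cf; apply: within_bigcup; first exact: sub_finite_set Dc cells_finite.
  by move=> C /Dc[l [phi Tphi ->]]; exact: cell_closed.
move=> C DC; have [l [phi Tphi Cphi]] := Dc _ DC; rewrite Cphi in DC *.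
apply: compact_quotient => //; first exact: simplex_compact.
  exact: Phi_continuous.
exact: cf.
Qed.

Lemma cells_cover : \bigcup_(C in cells) C = setT.
Proof.
rewrite -subTset => y _; have [l [phi Tphi py]] := Phi_cover T y.
exists (cell phi); first by exists l, phi.
exact: opencell_sub.
Qed.

(** The union of the closed simplexes avoiding [p] is closed, hence the points near
    [p] only lie on simplexes containing [p]. *)
Lemma star_nbhs p : exists O, [/\ open O, O p &
  forall l (phi : 'rV[R]_l -> M) x, T l phi -> cell phi x -> O x -> cell phi p].
Proof.
exists (~` \bigcup_(C in cells `&` [set C | ~ C p]) C); split.
- by rewrite openC; apply: closed_cells => C [].
- by move=> [C []].
- move=> l phi x Tphi cx Ox; apply: contrapT => ncp; apply: Ox.
  by exists (cell phi) => //; split => //; exists l, phi.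
Qed.

Lemma cell_closure l (phi : 'rV[R]_l -> M) :
  T l phi -> cell phi `<=` closure (opencell phi).
Proof.
move=> Tphi _ [x sx <-] B nB.
have /subspace_continuousP/(_ x sx _ nB) := Phi_continuous Tphi.
rewrite /nbhs /= /within /= => nx.
have [z [pz Bz]] := simplex_closure sx nx.
exists (phi z); split; last by apply: Bz; exact: sub_positive_bary.
by rewrite opencellE; exists z.
Qed.

Lemma top_extension (phi : 'rV[R]_n -> M) : T n phi ->
  exists U f, [/\ open U, simplex R n `<=` U,
    forall x y, U x -> U y -> f x = f y -> x = y,
    (forall x, U x -> {for x, continuous f}) /\
    (forall x V, U x -> nbhs x V -> nbhs (f x) (f @` V)) &
    forall x, simplex R n x -> f x = phi x].
Proof.
move=> Tphi; have [U [f [oU sU df fphi]]] := Phi_diffeo Tphi.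
exists U, f; split => //.
- by case: df => _ [g gf _] x y Ux Uy fxy; rewrite -(gf x Ux) fxy gf.
- by split; [case: df => -[]|exact: (diffeo_open_map oU df)].
Qed.

Lemma top_opencell_open (phi : 'rV[R]_n -> M) : T n phi -> open (opencell phi).
Proof.
move=> Tphi; have [U [f [oU sU fi [_ fo] fphi]]] := top_extension Tphi.
rewrite opencellE openE => _ [x px <-]; rewrite /interior -fphi; last exact: sub_positive_bary.
have nx : nbhs x (@positive_bary R n).
  by apply: open_nbhs_nbhs; split => //; exact: open_positive_bary.
refine (filterS _ (fo x _ (sU _ (sub_positive_bary px)) nx)).
move=> _ [z pz <-]; exists z => //; rewrite fphi //; exact: sub_positive_bary.
Qed.

End Triangulation.

Lemma convex_connected (R : realType) (V : normedModType R) (S : set V) :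
  (forall x y t, S x -> S y -> 0 <= t <= 1 -> S (x + t *: (y - x))) ->
  connected S.
Proof.
move=> cS; have [->|/set0P[x Sx]] := eqVneq S set0; first exact: connected0.
pose seg y : set V := (fun t : R => x + t *: (y - x)) @` `[0, 1]%classic.
have -> : S = \bigcup_(y in S) seg y.
  rewrite predeqE => z; split=> [Sz|[y Sy [t]]].
    exists z => //; exists 1; first by rewrite /= in_itv /= ler01 lexx.
    by rewrite scale1r subrKC.
  by rewrite /= in_itv /= => t01 <-; exact: cS.
apply: bigcup_connected.
  exists x => y Sy; exists 0; first by rewrite /= in_itv /= ler01 lexx.
  by rewrite scale0r addr0.
move=> y Sy; apply: connected_continuous_connected; first exact: segment_connected.
apply: continuous_subspaceT => t; apply: cvgD; first exact: cvg_cst.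
by apply: cvgZr_tmp; exact: cvg_id.
Qed.

(** * A simplex of codimension one lies between two top simplexes *)

Section Cofaces.
Variables (R : realType) (m : nat) (M : topologicalType).
Variables (A : smooth_atlas R m.+1 M) (T : triangulation A).
Hypothesis hM : hausdorff_space M.

(** In the coordinates of [d1] near a point [p] interior to [tau], [d1] is a half
    ball. By [star_nbhs], the opposite open half ball is covered by the disjoint
    open interiors of the other top simplexes having [tau] as a face; it is
    connected, so there is exactly one of them. *)
Lemma other_coface (tau : 'rV[R]_m -> M) (d1 : 'rV[R]_m.+1 -> M) :
  T m tau -> T m.+1 d1 -> is_face tau d1 ->
  exists d2, [/\ T m.+1 d2, is_face tau d2, d2 <> d1 &
    forall d, T m.+1 d -> is_face tau d -> d = d1 \/ d = d2].
Proof.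
move=> Ttau Td1 [i ti].
pose y0 := barycenter R m; pose p := tau y0; pose x1 := face_map i y0.
have sy0 : simplex R m y0 by apply: sub_positive_bary; exact: barycenter_positive.
have optau : opencell tau p.
  by rewrite opencellE; exists y0 => //; exact: barycenter_positive.
have [N [oN Np hN]] := star_nbhs T hM p.
have [U [f [oU sU fi [fc fo] fd]]] := top_extension Td1.
have sx1 : simplex R m.+1 x1 by exact: face_map_simplex.
have fx1 : f x1 = p by rewrite fd // /p ti.
have Ux1 : U x1 by exact: sU.
have : \forall x \near x1, U x /\ N (f x) /\ forall k, 0 < bary x (lift i k).
  apply: filterI; first exact: open_nbhs_nbhs.
  apply: filterI; first by apply: (fc x1 Ux1); rewrite fx1; exact: open_nbhs_nbhs.
  have FF : Filter (nbhs x1) by exact: nbhs_filter.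
  refine (@filter_forall _ _ (fun k x => 0 < bary x (lift i k)) _ FF _) => k.
  apply: (bary_continuous (lt_nbhsr _)); rewrite bary_face_lift.
  exact: barycenter_positive.
move=> /nbhs_ballP[e /= e0 he].
pose B := ball x1 e.
have BU x : B x -> U x by move=> /he[].
pose Bm := B `&` [set x | bary x i < 0].
have tauB x (y : 'rV[R]_m) : U x -> simplex R m y -> f x = tau y -> bary x i = 0.
  move=> Ux sy; rewrite ti // -fd; last exact: face_map_simplex.
  move=> /fi -> //; first by rewrite bary_face_self.
  by apply: sU; exact: face_map_simplex.
have d1B x : U x -> opencell d1 (f x) -> 0 < bary x i.
  move=> Ux; rewrite opencellE => -[z pz]; rewrite -fd; last exact: sub_positive_bary.
  by move=> /fi <- //; apply: sU; exact: sub_positive_bary.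
(* points of the opposite half ball are interior to the other cofaces of [tau] *)
have cellBm x : Bm x -> exists d, [/\ T m.+1 d, is_face tau d, d <> d1 &
    opencell d (f x)].
  move=> [Bx xi]; rewrite /= in xi; have [Ux [Nx _]] := he _ Bx.
  have [l [phi Tphi ophi]] := Phi_cover T (f x).
  have cphi := hN _ _ _ Tphi (opencell_sub ophi) Nx.
  have ml := cell_opencell_le Tphi Ttau cphi optau.
  have lm : (l <= m.+1)%N. by exact: (Phi_dim_le Tphi).
  have [lE|lE] : l = m \/ l = m.+1.
    by move: ml; rewrite leq_eqVlt => /orP[/eqP <-|]; [left|right; apply/anti_leq/andP].
    subst l; have E := cell_opencell_eq Tphi Ttau cphi optau; subst phi.
    have [y sy yf] := opencell_sub ophi.
    by have x0 := tauB _ _ Ux sy (esym yf); rewrite x0 ltxx in xi.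
  subst l; exists phi; split => //; first exact: (cell_opencell_face Tphi Ttau cphi optau).
  by move=> E; subst phi; have := d1B _ Ux ophi; rewrite ltNge ltW.
have Bm0 : Bm !=set0.
  have [t /andP[t0 _] Bt] := nbhs_line (x1 - vertex R i) (nbhsx_ballx x1 e e0).
  exists (x1 + t *: (x1 - vertex R i)); split => //=.
  by rewrite bary_comb bary_face_self bary_vertex eqxx add0r sub0r mulrN1 oppr_lt0.
have cBm : connected Bm.
  apply: convex_connected => x y t [Bx xi] [By yi] t01; split.
    exact: ball_segment.
  rewrite /= bary_comb; rewrite /= in xi yi; move/andP: t01 => [t0 t1].
  have [->|tn0] := eqVneq t 0; first by rewrite mul0r addr0.
  have tp : 0 < t by rewrite lt_neqAle eq_sym tn0.
  nra.
have op_d (D : set ('rV[R]_m.+1 -> M)) : D `<=` T m.+1 ->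
    open (U `&` f @^-1` (\bigcup_(d in D) opencell d)).
  move=> DT; rewrite openE => x [Ux [d Dd dx]].
  apply: filterI; first exact: open_nbhs_nbhs.
  apply: (fc x Ux); apply: open_nbhs_nbhs; split; last by exists d.
  by apply: bigcup_open => d' /DT; exact: top_opencell_open.
(* connectedness: a coface met by the opposite half ball contains all of it *)
have sameBm d2 x y : T m.+1 d2 -> Bm x -> Bm y -> opencell d2 (f x) -> opencell d2 (f y).
  move=> Td2 Bx By d2x.
  suff : Bm `&` f @^-1` (opencell d2) = Bm.
    by rewrite predeqE => /(_ y)[_ /(_ By)[]].
  apply: cBm; first by exists x.
    exists (U `&` f @^-1` (\bigcup_(d in [set d2]) opencell d)).
      by apply: op_d => _ ->.
    rewrite bigcup_set1 predeqE => z; split => [[Bz dz]|[Bz [_ dz]]] //.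
    by split => //; split => //; apply: BU; case: Bz.
  exists (~` (U `&` f @^-1` (\bigcup_(d in T m.+1 `\ d2) opencell d))).
    by rewrite closedC; apply: op_d => d [].
  rewrite predeqE => z; split => [[Bz dz]|[Bz dz]]; split => //.
    by move=> [_ [d [Td /=]]] dd2 od; apply: dd2; exact: (opencell_inj Td Td2 od dz).
  have [d [Td _ _ od]] := cellBm _ Bz.
  have [<-//|dd2] := pselect (d = d2).
  exfalso; apply: dz; split; first by apply: BU; case: Bz.
  by exists d.
have [x0 Bx0] := Bm0; have [d2 [Td2 fd2 d21 od2]] := cellBm _ Bx0.
exists d2; split => // d Td fad; have [->|dd1] := pselect (d = d1); first by left.
(* [p] is in the closure of the interior of [d], which therefore meets [f @` B] *)
right; have cd : cell d p.
  by apply: (face_cell fad); exact: opencell_sub.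
have nf : nbhs p (f @` B) by rewrite -fx1; apply: fo => //; exact: nbhsx_ballx.
have [q [od [x Bx xq]]] := cell_closure Td cd nf; rewrite -{q}xq in od.

suff Bmx : Bm x by apply: (opencell_inj Td Td2 od); exact: (sameBm _ _ _ Td2 Bx0 Bmx od2).
split => //=; have [Ux [_ xpos]] := he _ Bx.
case: (ltgtP (bary x i) 0) => // xi; exfalso; last first.
  have [y xy yb] := bary_eq0_face xi.
  have py : positive_bary y by move=> k; rewrite yb.
  have : opencell tau (f x).
    rewrite opencellE; exists y => //; rewrite ti; last exact: sub_positive_bary.
    by rewrite xy fd //; apply: face_map_simplex; exact: sub_positive_bary.
  by move=> ot; have /eqP := existT_inj1 (opencell_eq Td Ttau od ot); rewrite gtn_eqF.
apply: dd1; apply: (opencell_inj Td Td1 od); rewrite opencellE; exists x.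
  by move=> j; case: (unliftP i j) => [k|] ->.
by rewrite fd //; apply: sub_positive_bary => j; case: (unliftP i j) => [k|] ->.
Qed.

End Cofaces.

(** * Elementary collapses of the black complement *)

Section CellInverse.
Variables (R : realType) (n : nat) (M : topologicalType).
Variables (A : smooth_atlas R n M) (T : triangulation A).
Hypothesis hM : hausdorff_space M.

Definition cinv l (phi : 'rV[R]_l -> M) (p : M) : 'rV[R]_l :=
  xget 0 [set x | simplex R l x /\ phi x = p].

Lemma cinvP l (phi : 'rV[R]_l -> M) p : cell phi p ->
  simplex R l (cinv phi p) /\ phi (cinv phi p) = p.
Proof.
move=> [x sx xp]; rewrite /cinv; case: xgetP => [y -> //|/(_ x)].
by move=> H; exfalso; apply: H.
Qed.

Lemma cinvK l (phi : 'rV[R]_l -> M) x : T l phi -> simplex R l x ->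
  cinv phi (phi x) = x.
Proof.
move=> Tphi sx; have [s1 s2] := @cinvP _ phi (phi x) (imageP phi sx).
exact: (Phi_inj Tphi).
Qed.

Lemma cinv_continuous l (phi : 'rV[R]_l -> M) : T l phi ->
  {within cell phi, continuous (cinv phi)}.
Proof.
move=> Tphi; apply: compact_quotient => //; first exact: simplex_compact.
  exact: (Phi_continuous Tphi).
apply: (eq_within (f := id)); first by move=> x sx; rewrite /= cinvK.
by apply: continuous_subspaceT => x; exact: cvg_id.
Qed.

End CellInverse.

Section HornRetraction.
Variables (R : realType) (l : nat) (i : 'I_l.+2).
Implicit Types x : 'rV[R]_l.+1.

Definition horn_depth x : R := \big[Order.min/1]_(k < l.+1) bary x (lift i k).

(** Retraction of the simplex onto the union of its faces other than the [i]th. The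
    point moves towards the [i]th vertex: all coordinates but the [i]th decrease
    at the same speed until one of them vanishes. *)
Definition horn_retract x : 'rV[R]_l.+1 :=
  x + horn_depth x *: (l.+2%:R *: (vertex R i - barycenter R l.+1) - 0).

Lemma bary_horn x k : bary (horn_retract x) k =
  bary x k + horn_depth x * (l.+2%:R * (i == k)%:R - 1).
Proof.
have -> : horn_retract x = x + (horn_depth x * l.+2%:R) *:
    (vertex R i - barycenter R l.+1) by rewrite /horn_retract subr0 scalerA.
by rewrite bary_comb bary_vertex bary_barycenter -mulrA mulrBr mulfV // pnatr_eq0.
Qed.

Lemma horn_depth_le x k : horn_depth x <= bary x (lift i k).
Proof. exact: bigmin_le_cond. Qed.

Lemma horn_depth_ge0 x : simplex R l.+1 x -> 0 <= horn_depth x.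
Proof.
move=> /simplexE x0; by apply/bigmin_geP; split; first exact: ler01.
Qed.

Lemma horn_depth_attained x : simplex R l.+1 x ->
  exists k, horn_depth x = bary x (lift i k).
Proof.
move=> sx; apply: contrapT => /forallNP H.
suff : horn_depth x < horn_depth x by rewrite ltxx.
have lt k : horn_depth x < bary x (lift i k).
  by rewrite lt_neqAle horn_depth_le andbT; apply/eqP.
rewrite {2}/horn_depth; apply/bigmin_gtP; split => //.
exact: lt_le_trans (lt ord0) (bary_le1 _ sx).
Qed.

Lemma horn_retract_simplex x : simplex R l.+1 x -> simplex R l.+1 (horn_retract x).
Proof.
move=> sx; apply/simplexE => k; rewrite bary_horn.
have d0 := horn_depth_ge0 sx.
case: (unliftP i k) => [j|] ->.
  by rewrite (negbTE (neq_lift _ _)) mulr0 sub0r mulrN1 subr_ge0 horn_depth_le.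
rewrite eqxx mulr1; apply: addr_ge0; first exact: (simplexE x).1.
by rewrite mulr_ge0 // subr_ge0 (ler_nat _ 1).
Qed.

Lemma horn_retract_face x : simplex R l.+1 x ->
  exists k, bary (horn_retract x) (lift i k) = 0.
Proof.
move=> sx; have [k kx] := horn_depth_attained sx; exists k.
by rewrite bary_horn (negbTE (neq_lift _ _)) mulr0 sub0r mulrN1 kx subrr.
Qed.

Lemma horn_retract_id x k : simplex R l.+1 x -> bary x (lift i k) = 0 ->
  horn_retract x = x.
Proof.
move=> sx xk; have d0 : horn_depth x = 0.
  by apply/eqP; rewrite eq_le horn_depth_ge0 // -xk horn_depth_le.
by rewrite /horn_retract d0 scale0r addr0.
Qed.

Lemma horn_retract_continuous : continuous horn_retract.
Proof.
have cd : continuous horn_depth.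
  by apply: continuous_bigmin => k _; exact: bary_continuous.
move=> x; exact: (cvgD cvg_id (cvgZr_tmp (cd x))).
Qed.

End HornRetraction.

Section Stages.
Variables (R : realType) (m : nat) (M : topologicalType).
Variables (A : smooth_atlas R m.+1 M) (T : triangulation A).
Hypothesis hM : hausdorff_space M.
Implicit Types (D : set ('rV[R]_m.+1 -> M)) (E : set ('rV[R]_m -> M)).

(** The stages [white_stage] indexed by the sets of the simplexes whose interiors
    have been joined to the white set: [D] in the top dimension, [E] below it. *)
Inductive stage : set ('rV[R]_m.+1 -> M) -> set ('rV[R]_m -> M) -> Prop :=
| stage_start d : T m.+1 d -> stage [set d] set0
| stage_step D E d d' tau : stage D E -> T m.+1 d -> ~ D d -> D d' -> T m tau ->
    is_face tau d -> is_face tau d' -> stage (D `|` [set d]) (E `|` [set tau]).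

Definition white D E : set M :=
  (\bigcup_(d in D) opencell d) `|` (\bigcup_(tau in E) opencell tau).

(** By [other_coface], the two top simplexes adjacent to a simplex of [E] are those
    between which it was crossed, so both are in [D]. *)
Lemma stage_inv D E : stage D E ->
  [/\ D `<=` T m.+1, E `<=` T m &
     forall tau d, E tau -> T m.+1 d -> is_face tau d -> D d].
Proof.
elim=> [d Td|{}D {}E d d' tau _ [DT ET DE] Td nDd Dd' Ttau fd fd'].
  by split => // _ ->.
split.
- by move=> x [/DT//|->].
- by move=> x [/ET//|->].
- move=> t x [Et|->] Tx tx; first by left; exact: DE tx.
  have [d2 [_ _ d2d H]] := other_coface hM Ttau Td fd.
  have dd' : d' <> d by move=> E'; rewrite E' in Dd'.
  have [//|E2] := H _ (DT _ Dd') fd'; rewrite -E2 in H.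
  by have [->|->] := H _ Tx tx; [right|left].
Qed.

Lemma cell_sub_stage D d : D `<=` T m.+1 -> T m.+1 d ->
  cell d `<=` \bigcup_(x in D) cell x -> D d.
Proof.
move=> DT Td dD; pose p := d (barycenter R m.+1).
have op : opencell d p.
  by rewrite opencellE; exists (barycenter R m.+1) => //; exact: barycenter_positive.
have [x Dx cx] := dD _ (opencell_sub op).
by rewrite -(cell_opencell_eq (DT _ Dx) Td cx op).
Qed.

Lemma white_stageP sigma C : white_stage T sigma C ->
  exists D E, [/\ stage D E, sigma = \bigcup_(d in D) cell d & C = white D E].
Proof.
elim=> [d Td|{}sigma {}C d d' tau _ [D [E [st -> ->]]] Td nd Td' cd' Ttau fd fd'].
  exists [set d], set0; split; first exact: stage_start.
    by rewrite bigcup_set1.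
  by rewrite /white bigcup_set1 bigcup_set0 setU0.
have [DT _ _] := stage_inv st.
exists (D `|` [set d]), (E `|` [set tau]); split.
- apply: (stage_step st Td _ _ Ttau fd fd').
    by move=> Dd; apply: nd => x dx; exists d.
  exact: cell_sub_stage.
- by rewrite bigcup_setU bigcup_set1.
- by rewrite /white !bigcup_setU !bigcup_set1 setUACA -setUA [X in _ `|` X]setUC.
Qed.

Lemma white_open D E : stage D E -> open (white D E).
Proof.
move=> st; have [DT ET DE] := stage_inv st.
rewrite openE => p [[d Dd dp]|[tau Etau taup]].
  have := top_opencell_open (DT _ Dd); rewrite openE => /(_ _ dp).
  by apply: filterS => x dx; left; exists d.
have [N [oN Np hN]] := star_nbhs T hM p.
have nN : nbhs p N by exact: open_nbhs_nbhs.
refine (filterS _ nN) => x Nx.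
have [l [phi Tphi ophi]] := Phi_cover T x.
have cphi := hN _ _ _ Tphi (opencell_sub ophi) Nx.
have ml := cell_opencell_le Tphi (ET _ Etau) cphi taup.
have lm : (l <= m.+1)%N. by exact: (Phi_dim_le Tphi).
have [lE|lE] : l = m \/ l = m.+1.
  by move: ml; rewrite leq_eqVlt => /orP[/eqP <-|]; [left|right; apply/anti_leq/andP].
  subst l; have E' := cell_opencell_eq Tphi (ET _ Etau) cphi taup; subst phi.
  by right; exists tau.
subst l; left; exists phi => //; apply: (DE tau) => //.
exact: (cell_opencell_face Tphi (ET _ Etau) cphi taup).
Qed.

Lemma cell_not_white D E d : stage D E -> T m.+1 d -> ~ D d ->
  forall x, cell d x -> ~ white D E x.
Proof.
move=> st Td nDd x cx; have [DT ET DE] := stage_inv st.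
case=> [[d' Dd' od']|[t Et ot]].
  by apply: nDd; rewrite (cell_opencell_eq Td (DT _ Dd') cx od').
by apply: nDd; apply: (DE t) => //; exact: (cell_opencell_face Td (ET _ Et) cx ot).
Qed.

(** The elementary collapse of [d] through [tau]: the other coface of [tau] is
    already white, hence [tau] is a free face of [d] in the black set, which is
    pushed by [horn_retract] onto the union of the remaining faces of [d]. *)
Lemma collapse D E d tau : stage D E -> stage (D `|` [set d]) (E `|` [set tau]) ->
  T m.+1 d -> ~ D d -> T m tau -> is_face tau d ->
  exists r : M -> M, [/\ {within ~` white D E, continuous r},
    forall x, ~ white D E x -> ~ white (D `|` [set d]) (E `|` [set tau]) (r x) &
    forall x, ~ white (D `|` [set d]) (E `|` [set tau]) x -> r x = x].
Proof.
move=> st st' Td nDd Ttau [i ti].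
set W := white D E; set W' := white _ _.
have WW' : W' = W `|` (opencell d `|` opencell tau).
  by rewrite /W' /W /white !bigcup_setU !bigcup_set1 setUACA.
(* the part of [d] that becomes white, in barycentric coordinates *)
have oE z : simplex R m.+1 z -> (opencell d (d z) \/ opencell tau (d z)) <->
    forall k, 0 < bary z (lift i k).
  move=> sz; split.
    case; rewrite opencellE => -[y py].
      move/(Phi_inj Td (sub_positive_bary py) sz) => <- k; exact: py.
    rewrite ti; last exact: sub_positive_bary.
    move/(Phi_inj Td (face_map_simplex _ (sub_positive_bary py)) sz) => <- k.
    by rewrite bary_face_lift.
  move=> zk; have [zi|zi] := eqVneq (bary z i) 0.
    right; have [y zy yb] := bary_eq0_face zi.
    have py : positive_bary y by move=> k; rewrite yb.
    rewrite opencellE; exists y => //; rewrite ti ?zy //; exact: sub_positive_bary.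
  left; rewrite opencellE; exists z => // j; case: (unliftP i j) => [k|] -> //.
  by rewrite lt_neqAle eq_sym zi; exact: (simplexE z).1.
pose r x := if `[< cell d x >] then d (horn_retract i (cinv d x)) else x.
have rW' x : ~ W' x -> r x = x.
  rewrite /r; case: asboolP => // cx; rewrite WW' => nW.
  have [sz dz] := cinvP cx.
  have : ~ forall k, 0 < bary (cinv d x) (lift i k).
    by move=> /(oE _ sz); rewrite dz => od; apply: nW; right.
  move=> /existsNP[k /negP]; rewrite -leNgt => k0.
  rewrite (@horn_retract_id _ _ _ _ k) ?dz //; apply/eqP.
  by rewrite eq_le k0; exact: (simplexE _).1.
exists r; split => //; last first.
  move=> x nWx; have [cx|ncx] := pselect (cell d x).
    have [sz dz] := cinvP cx; have sr := horn_retract_simplex i sz.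
    rewrite /r asboolT // WW' => -[|/(oE _ sr) H].
      by apply: (cell_not_white st Td nDd); exists (horn_retract i (cinv d x)).
    by have [k k0] := horn_retract_face i sz; have := H k; rewrite k0 ltxx.
  rewrite /r asboolF // WW' => -[//|[/opencell_sub//|/opencell_sub cx]].
  by apply: ncx; apply: face_cell cx; exists i.
have cW' : closed (~` W') by rewrite closedC; exact: white_open.
have -> : ~` W = ~` W' `|` cell d.
  rewrite predeqE => x; split.
    move=> nW; have [cx|ncx] := pselect (cell d x); first by right.
    left; rewrite WW' => -[//|[/opencell_sub//|/opencell_sub cx]].
    by apply: ncx; apply: face_cell cx; exists i.
  case=> [nW' W1|]; first by apply: nW'; rewrite WW'; left.
  exact: (cell_not_white st Td nDd).
apply: withinU_continuous => //; first exact: (cell_closed hM Td).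
  apply: (eq_within (f := id)); first by move=> x /rW' ->.
  by apply: continuous_subspaceT => x; exact: cvg_id.
apply: (eq_within (f := d \o (horn_retract i \o cinv d))).
  by move=> x cx; rewrite /r asboolT.
apply: (within_comp (B := simplex R m.+1)); last first.
- by move=> x /cinvP[sz _]; exact: horn_retract_simplex.
- exact: (Phi_continuous Td).
- apply: within_comp_cont; first exact: (cinv_continuous hM Td).
  exact: horn_retract_continuous.
Qed.

End Stages.

(** * Connectedness and simple connectedness along the collapses *)

Definition retraction (M : topologicalType) (B B' : set M) (r : M -> M) :=
  [/\ {within B, continuous r}, forall x, B x -> B' (r x), B' `<=` B &
      forall x, B' x -> r x = x].

Lemma retract_nonempty (M : topologicalType) (B B' : set M) r :
  retraction B B' r -> B !=set0 -> B' !=set0.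
Proof. by move=> [_ rB _ _] [x /rB Bx]; exists (r x). Qed.

Lemma retract_connected (M : topologicalType) (B B' : set M) r :
  retraction B B' r -> connected B -> connected B'.
Proof.
move=> [cr rB BB rid] cB; have <- : r @` B = B'.
  rewrite predeqE => y; split; first by move=> [x /rB ? <-].
  by move=> By; exists y; [exact: BB|exact: rid].
exact: connected_continuous_connected.
Qed.

Lemma retract_simply_connected (R : realType) (M : topologicalType)
    (B B' : set M) r :
  retraction B B' r -> simply_connected R B -> simply_connected R B'.
Proof.
move=> rB [B0 Bp Bh]; have [cr rBB BB rid] := rB.
split; first exact: retract_nonempty rB B0.
  move=> x y Bx By; have [g [cg g0 g1 gB]] := Bp x y (BB _ Bx) (BB _ By).
  exists (r \o g); split; rewrite /= ?g0 ?g1 ?rid //.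
    by apply: within_comp cr _.
  by move=> t /gB/rBB.
move=> x g Bx [cg g0 g1 gB].
have /(Bh x g (BB _ Bx))[H [cH HB H1 H2]] : path_in B x x g.
  by split => // t /gB/BB.
exists (r \o H); split.
- exact: within_comp cr HB.
- by move=> p /HB/rBB.
- by move=> s Is /=; have [-> ->] := H1 s Is; rewrite !rid //; exact: gB.
- by move=> t It /=; have [-> ->] := H2 t It; rewrite !rid.
Qed.

Lemma connected_closed_cover (M : topologicalType) (X1 X2 : set M) :
  connected [set: M] -> closed X1 -> closed X2 ->
  (forall x, X1 x \/ X2 x) -> (forall x, X1 x -> ~ X2 x) ->
  X1 !=set0 -> X2 = set0.
Proof.
move=> cM c1 c2 cov dis X10.
have : X1 = setT.
  apply: cM => //; last by exists X1 => //; rewrite setTI.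
  exists (~` X2); first by rewrite openC.
  rewrite setTI predeqE => x; split; first exact: dis.
  by move=> n2; have [|//] := cov x.
move=> E; rewrite predeqE => x; split => // x2.
by apply: (dis x) => //; rewrite E.
Qed.

Section SimplexBoundary.
Variables (R : realType) (l : nat).

Definition simplex_face (i : 'I_l.+3) : set 'rV[R]_l.+2 :=
  [set x | simplex R l.+2 x /\ bary x i = 0].

Lemma simplex_face_connected i : connected (simplex_face i).
Proof.
apply: convex_connected => x y t [sx xi] [sy yi] t01; split.
  exact: simplex_convex.
by rewrite bary_comb xi yi subr0 mulr0 addr0.
Qed.

Lemma third_index (i : 'I_l.+3) : exists k, k != ord0 /\ k != i.
Proof.
have [->|ni] := eqVneq i ord_max; last by exists ord_max; split=> //; rewrite eq_sym.
exists (inord 1); rewrite -!val_eqE /= !inordK //.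
Qed.

Lemma simplex_boundary_connected :
  connected [set x | simplex R l.+2 x /\ exists i, bary x i = 0].
Proof.
have -> : [set x | simplex R l.+2 x /\ exists i, bary x i = 0] =
    \bigcup_(i in setT) (simplex_face i `|` simplex_face ord0).
  rewrite predeqE => x; split=> [[sx [i xi]]|[i _ [] [sx xi]]].
  - by exists i => //; left.
  - by split=> //; exists i.
  - by split=> //; exists ord0.
have vf k i : k != i -> simplex_face i (vertex R k).
  by move=> ki; split; [exact: vertex_simplex|rewrite bary_vertex (negbTE ki)].
apply: bigcup_connected.
  by exists (vertex R ord_max) => i _; right; exact: vf.
move=> i _; apply: connectedU; try exact: simplex_face_connected.
have [k [k0 ki]] := third_index i.
by exists (vertex R k); split; exact: vf.
Qed.

End SimplexBoundary.

Section StageConnected.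
Variables (R : realType) (m : nat) (M : topologicalType).
Variables (A : smooth_atlas R m.+1 M) (T : triangulation A).
Hypothesis hM : hausdorff_space M.

(** What retractions preserve passes from the complement of the first open simplex
    to the complement of the final cell. *)
Lemma retract_along_stage (P : set M -> Prop) :
  (forall B B' r, retraction B B' r -> P B -> P B') ->
  (forall d, T m.+1 d -> P (~` opencell d)) ->
  forall D E, stage T D E -> P (~` white D E).
Proof.
move=> Pr P0 D E; elim=> [d Td|{}D {}E d d' tau st PD Td nDd Dd' Ttau fd fd'].
  rewrite /white bigcup_set1 bigcup_set0 setU0; exact: P0.
have st' := stage_step st Td nDd Dd' Ttau fd fd'.
have [r [cr rB rid]] := collapse hM st st' Td nDd Ttau fd.
apply: (Pr _ _ r) PD; split => // x nW' W; apply: nW'.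
by case: W => [[y Dy yx]|[y Ey yx]]; [left|right]; exists y => //; left.
Qed.

Lemma outside_opencell_nonempty d : T m.+1 d -> ~` opencell d !=set0.
Proof.
move=> Td; exists (d (vertex R ord0)).
apply: (boundary_not_opencell (i := ord_max) Td); first exact: vertex_simplex.
by rewrite bary_vertex.
Qed.

End StageConnected.

(** The boundary of [d] is connected in dimension at least two, so a separation of
    the complement of the interior of [d] leaves it on one side; adding [d] to this
    side yields a separation of [M]. *)
Lemma outside_opencell_connected (R : realType) (l : nat) (M : topologicalType)
    (A : smooth_atlas R l.+2 M) (T : triangulation A) d :
  hausdorff_space M -> connected [set: M] ->
  T l.+2 d -> connected (~` opencell d).
Proof.
move=> hM cM Td B B0 [G1 oG1 BG] [F1 cF1 BF].
set K := ~` opencell d.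
have cK : closed K by rewrite closedC; exact: (top_opencell_open Td).
have cB : closed B by rewrite BF; exact: closedI.
have cB' : closed (K `&` ~` G1) by apply: closedI => //; rewrite closedC.
pose bd := d @` [set x | simplex R l.+2 x /\ exists i, bary x i = 0].
have cbd : connected bd.
  apply: connected_continuous_connected; first exact: simplex_boundary_connected.
  by apply: continuous_subspaceW (Phi_continuous Td) => x [].
have bdE x : bd x <-> cell d x /\ K x.
  split=> [[z [sz [i zi]] <-]|[[z sz <-] Kz]].
    split; first by exists z.
    exact: (boundary_not_opencell Td sz zi).
  exists z => //; split => //; apply: simplex_boundary => // pz.
  by apply: Kz; rewrite opencellE; exists z.
have bdB : (bd `<=` B) \/ (forall x, bd x -> ~ B x).
  have [[x [bx Bx]]|nb] := pselect (bd `&` B !=set0); last first.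
    by right=> x bx Bx; apply: nb; exists x.
  left; suff E : bd `&` B = bd by rewrite -E => y [].
  apply: cbd; first by exists x.
    exists G1 => //; rewrite BG predeqE => y; split=> [[by_ [_ Oy]]|[by_ Oy]] //.
    by split=> //; split=> //; case/bdE: by_.
  exists F1 => //; rewrite BF predeqE => y; split=> [[by_ [_ Oy]]|[by_ Oy]] //.
  by split=> //; split=> //; case/bdE: by_.
have ccd : closed (cell d) by exact: (cell_closed hM Td).
case: bdB => bdB.
  have E : K `&` ~` G1 = set0.
    apply: (@connected_closed_cover _ (B `|` cell d)) => //; first exact: closedU.
    - move=> x; have [ox|nox] := pselect (opencell d x).
        by left; right; exact: opencell_sub.
      have [Ox|nOx] := pselect (G1 x); last by right.
      by left; left; rewrite BG.
    - move=> x Bcx [Kx nO]; suff : B x by rewrite BG => -[_ /nO].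
      by case: Bcx => // cx; apply: bdB; apply/bdE.
    - by case: B0 => x Bx; exists x; left.
  rewrite BG predeqE => x; split => [[]//|Kx]; split=> //.
  by apply: contrapT => nO; have : (K `&` ~` G1) x by []; rewrite E.
exfalso; have E : (K `&` ~` G1) `|` cell d = set0.
  apply: (@connected_closed_cover _ B) => //; first exact: closedU.
  - move=> x; have [ox|nox] := pselect (opencell d x).
      by right; right; exact: opencell_sub.
    have [Ox|nOx] := pselect (G1 x); last by right; left.
    by left; rewrite BG.
  - move=> x Bx [[_ nO]|cx]; first by move: Bx; rewrite BG => -[_ /nO].
    by apply: (bdB x) => //; apply/bdE; split => //; move: Bx; rewrite BG => -[].
have : ((K `&` ~` G1) `|` cell d) (d (vertex R ord0)).
  by right; exists (vertex R ord0) => //; exact: vertex_simplex.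
by rewrite E.
Qed.

(** * Pushing squares off an open simplex, in dimension at least three *)

Section RadialRetraction.
Variables (R : realType) (l : nat) (q : 'rV[R]_l).
Hypothesis q0 : positive_bary q.
Implicit Types x : 'rV[R]_l.

(** [1 - radial_depth x] is the gauge of the simplex, centred at [q]. *)
Definition radial_depth x : R := \big[Order.min/1]_(i < l.+1) (bary x i / bary q i).

Definition radial_retract x : 'rV[R]_l := q + (1 - radial_depth x)^-1 *: (x - q).

Lemma radial_depth_le x i : radial_depth x * bary q i <= bary x i.
Proof. by rewrite -ler_pdivlMr //; exact: bigmin_le_cond. Qed.

Lemma radial_depth_lt1 x : x != q -> radial_depth x < 1.
Proof.
move=> xq; rewrite ltNge; apply/negP => H.
have ge i : bary q i <= bary x i.
  by apply: le_trans (radial_depth_le x i); rewrite ler_peMl // ltW.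
move/eqP: xq; apply; apply: bary_inj => i; apply/eqP; rewrite eq_le ge andbT.
have := sum_bary x; rewrite -(sum_bary q) (bigD1 i) //= [RHS](bigD1 i) //= => E.
have : \sum_(j < l.+1 | j != i) bary q j <= \sum_(j < l.+1 | j != i) bary x j.
  by apply: ler_sum => j _; exact: ge.
by move: E; lra.
Qed.

Lemma radial_depth_ge0 x : simplex R l x -> 0 <= radial_depth x.
Proof.
move=> /simplexE x0; apply/bigmin_geP; split => // i _.
by rewrite divr_ge0 // ltW.
Qed.

Lemma radial_depth_attained x : x != q ->
  exists i, bary x i = radial_depth x * bary q i.
Proof.
move=> xq; apply: contrapT => /forallNP H.
suff : radial_depth x < radial_depth x by rewrite ltxx.
rewrite {2}/radial_depth; apply/bigmin_gtP; split; first exact: radial_depth_lt1.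
move=> i _; rewrite ltr_pdivlMr // lt_neqAle radial_depth_le andbT.
by apply/eqP => E; exact: (H i).
Qed.

Lemma bary_radial x i : bary (radial_retract x) i =
  bary q i + (1 - radial_depth x)^-1 * (bary x i - bary q i).
Proof. exact: bary_comb. Qed.

Lemma radial_retract_simplex x : x != q -> simplex R l (radial_retract x).
Proof.
move=> xq; apply/simplexE => i; rewrite bary_radial.
have h1 := radial_depth_lt1 xq; have h2 := radial_depth_le x i.
have d0 : 0 < 1 - radial_depth x by rewrite subr_gt0.
rewrite -(pmulr_rge0 _ d0) mulrDr mulVKf ?gt_eqF //; lra.
Qed.

Lemma radial_retract_face x : x != q -> exists i, bary (radial_retract x) i = 0.
Proof.
move=> xq; have [i ix] := radial_depth_attained xq; exists i.
have d0 : 0 < 1 - radial_depth x by rewrite subr_gt0 radial_depth_lt1.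
by rewrite bary_radial ix; field; rewrite gt_eqF.
Qed.

Lemma radial_retract_id x i : simplex R l x -> bary x i = 0 -> radial_retract x = x.
Proof.
move=> sx xi; have d0 : radial_depth x = 0.
  apply/eqP; rewrite eq_le radial_depth_ge0 // andbT.
  have := radial_depth_le x i; rewrite xi pmulr_lle0 //.
by rewrite /radial_retract d0 subr0 invr1 scale1r subrKC.
Qed.

Lemma radial_retract_continuous x : x != q -> {for x, continuous radial_retract}.
Proof.
move=> xq; have cd : continuous radial_depth.
  apply: continuous_bigmin => i _ y.
  exact: (cvgM (@bary_continuous R l i y) (cvg_cst _)).
have n0 : 1 - radial_depth x != 0 by rewrite gt_eqF // subr_gt0 radial_depth_lt1.
exact: (cvgD (cvg_cst _) (cvgZ (cvgV n0 (cvgB (cvg_cst _) (cd x)))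
  (cvgB cvg_id (cvg_cst _)))).
Qed.

End RadialRetraction.

Section RadialRetractionM.
Variables (R : realType) (n : nat) (M : topologicalType).
Variables (A : smooth_atlas R n M) (T : triangulation A).
Hypothesis hM : hausdorff_space M.

(** Removing a neighbourhood [V] of the centre, rather than the centre alone, makes
    both pieces of the domain closed. *)
Lemma outside_retraction (d : 'rV[R]_n -> M) q V :
  T n d -> positive_bary q -> open V -> V (d q) -> V `<=` opencell d ->
  exists r, retraction (~` V) (~` opencell d) r.
Proof.
move=> Td q0 oV Vq Vd.
pose r x := if `[< cell d x >] then d (radial_retract q (cinv d x)) else x.
have notq x : cell d x -> ~ V x -> cinv d x != q.
  by move=> cx nV; apply/eqP => E; apply: nV; have [_ <-] := cinvP cx; rewrite E.
have rid x : ~ opencell d x -> r x = x.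
  move=> nx; rewrite /r; case: asboolP => // cx; have [sz dz] := cinvP cx.
  have np : ~ positive_bary (cinv d x).
    by move=> pz; apply: nx; rewrite opencellE; exists (cinv d x).
  have [i zi] := simplex_boundary sz np.
  by rewrite (radial_retract_id q0 sz zi) dz.
exists r; split.
- have -> : ~` V = ~` opencell d `|` (cell d `&` ~` V).
    rewrite predeqE => x; split=> [nV|[nx Vx|[]//]]; last exact: nx (Vd _ Vx).
    have [ox|] := pselect (opencell d x); last by left.
    by right; split => //; exact: opencell_sub.
  have ccd := cell_closed hM Td.
  have cV : closed (~` V) by rewrite closedC.
  apply: withinU_continuous.
  + by rewrite closedC; exact: (top_opencell_open Td).
  + exact: closedI.
  + apply: (eq_within (f := id)); first by move=> x /rid ->.
    by apply: continuous_subspaceT => x; exact: cvg_id.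
  apply: (eq_within (f := d \o (radial_retract q \o cinv d))).
    by move=> x [cx _]; rewrite /r asboolT.
  apply: (within_comp (B := simplex R n)); last first.
  + by move=> x [cx nV]; apply: radial_retract_simplex => //; exact: notq.
  + exact: (Phi_continuous Td).
  apply: (within_comp (B := [set x | x != q])); last first.
  + by move=> x [cx nV]; exact: notq.
  + apply: continuous_in_subspaceT => x; rewrite inE => xq.
    exact: radial_retract_continuous.
  by apply: continuous_subspaceW (cinv_continuous hM Td) => x [].
- move=> x nV; have [cx|ncx] := pselect (cell d x).
    rewrite /r asboolT //; have xq := notq _ cx nV.
    have [i xi] := radial_retract_face q0 xq.
    by apply: (boundary_not_opencell Td _ xi); exact: radial_retract_simplex.
  by rewrite /r asboolF // => /opencell_sub.
- by move=> x nx /Vd.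
- exact: rid.
Qed.

End RadialRetractionM.

Lemma uniform_on_compact (R : realType) (X : pseudoMetricType R)
    (V : normedModType R) (K : set X) (F : X -> V) :
  compact K -> continuous F -> forall eps, 0 < eps ->
  exists2 delta, 0 < delta &
    forall z z', K z -> ball z delta z' -> `|F z - F z'| < eps.
Proof.
move=> cK cF eps eps0; apply: uniform_diagonal => // x _.
have e20 : 0 < eps / 2 by rewrite divr_gt0.
have /cvgrPdist_lt/(_ _ e20)/nbhs_ballP[e /= e0 he] := cF x.
exists e => // a b xa xb; rewrite -(subrK (F x) (F a)) -addrA (splitr eps).
by apply: (le_lt_trans (ler_normD _ _)); rewrite distrC ltrD //; exact: he.
Qed.

Section Hats.
Variable R : realType.

(** The function that is affine on the triangles cut from the unit squares by the
    diagonals of direction (1, 1), equal to 1 at the origin and to 0 at the other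
    vertices. *)
Definition hat (x y : R) : R :=
  Order.max 0 (1 - Order.max (Order.max `|x| `|y|) `|x - y|).

Lemma hat_eq0 x y : 1 <= `|x| \/ 1 <= `|y| \/ 1 <= `|x - y| -> hat x y = 0.
Proof.
move=> H; apply/max_idPl; rewrite subr_le0 !le_max.
by case: H => [->|[->|->]]; rewrite ?orbT.
Qed.

Lemma hat_in x y : 0 <= y -> y <= x -> x <= 1 ->
  [/\ hat x y = 1 - x, hat (x - 1) y = x - y & hat (x - 1) (y - 1) = y].
Proof.
move=> y0 yx x1; rewrite /hat; split.
- rewrite !ger0_norm; try lra.
  rewrite (max_l yx) [Order.max x _]max_l; last lra.
  by rewrite max_r //; lra.
- rewrite [`|x - 1|]ler0_norm; last lra.
  rewrite [`|y|]ger0_norm // [`|x - 1 - y|]ler0_norm; last lra.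
  rewrite [Order.max _ (- (x - 1 - y))]max_r; last by rewrite ge_max; apply/andP; split; lra.
  by rewrite max_r; lra.
- rewrite [`|x - 1|]ler0_norm; last lra.
  rewrite [`|y - 1|]ler0_norm; last lra.
  rewrite [`|x - 1 - (y - 1)|]ger0_norm; last lra.
  rewrite [Order.max (- (x - 1)) _]max_r; last lra.
  rewrite [Order.max (- (y - 1)) _]max_l; last lra.
  by rewrite max_r; lra.
Qed.

Lemma hatC x y : hat x y = hat y x.
Proof. by rewrite /hat (maxC `|x|) distrC. Qed.

Lemma hat_continuous : continuous (fun z : R * R => hat z.1 z.2).
Proof.
have c1 : continuous (fun z : R * R => z.1) by move=> z; exact: cvg_fst.
have c2 : continuous (fun z : R * R => z.2) by move=> z; exact: cvg_snd.
have ca : continuous (fun x : R => `|x|) by exact: norm_continuous.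
move=> z; rewrite /hat.
have n1 := continuous_comp (c1 z) (@ca _).
have n2 := continuous_comp (c2 z) (@ca _).
have n12 := continuous_comp (continuousB (c1 z) (c2 z)) (@ca _).
have m1 := continuous_max n1 n2.
have m2 := continuous_max m1 n12.
have m3 := continuousB (@cst_continuous _ _ (1 : R) z) m2.
have m4 := continuous_max (@cst_continuous _ _ (0 : R) z) m3.
exact: m4.
Qed.

Lemma grid_cell (N : nat) (x : R) : 0 <= x <= N.+1%:R ->
  exists a : nat, (a <= N)%N /\ (a%:R <= x <= a%:R + 1).
Proof.
elim: N => [|N IH] /andP[x0 xN]; first by exists 0%N; rewrite x0 add0r xN.
have [xN'|xN'] := leP x N.+1%:R.
  by have [|a [aN ax]] := IH _; [rewrite x0|exists a; split => //; exact: leqW].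
by exists N.+1; rewrite leqnn (ltW xN') natr1.
Qed.

Lemma hat_far (x : R) (a i : nat) y : a%:R <= x <= a%:R + 1 ->
  i != a -> i != a.+1 -> hat (x - i%:R) y = 0.
Proof.
move=> /andP[ax xa] ia ia1; apply: hat_eq0; left.
have [lt|lt] := ltnP i a.
  have : (i.+1%:R : R) <= a%:R by rewrite ler_nat.
  by rewrite -natr1 => H; rewrite ger0_norm; lra.
have : (a.+2%:R : R) <= i%:R.
  by rewrite ler_nat ltn_neqAle eq_sym ia1 /= ltn_neqAle eq_sym ia.
by rewrite -!natr1 => H; rewrite ler0_norm; lra.
Qed.

(** At a point of a triangle of the subdivision, only the hats of the three vertices
    of this triangle can be nonzero; they are the barycentric coordinates of the
    point. *)
Lemma hats3 (N : nat) (x y : R) : 0 <= x <= N.+1%:R -> 0 <= y <= N.+1%:R ->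
  exists p : 'I_3 -> 'I_N.+2 * 'I_N.+2, 
  [/\ injective p, forall ij, (forall t, ij != p t) ->
      hat (x - ij.1%:R) (y - ij.2%:R) = 0,
      \sum_t hat (x - (p t).1%:R) (y - (p t).2%:R) = 1 &
      forall t, [/\ 0 <= hat (x - (p t).1%:R) (y - (p t).2%:R),
        `|x - (p t).1%:R| <= 1 & `|y - (p t).2%:R| <= 1] ].
Proof.
move=> xN yN.
have [a [aN ax]] := grid_cell xN; have [b [bN bx]] := grid_cell yN.
have aL : (a < N.+2)%N by exact: leqW.
have aL1 : (a.+1 < N.+2)%N by [].
have bL : (b < N.+2)%N by exact: leqW.
have bL1 : (b.+1 < N.+2)%N by [].
have hge0 u v : 0 <= hat u v by rewrite le_max lexx.
(* the reflection exchanging the coordinates preserves the subdivision *)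
wlog yx : x y a b xN yN aN ax bN bx aL aL1 bL bL1 / y - b%:R <= x - a%:R.
  move=> H; have [le|/ltW le] := leP (y - b%:R) (x - a%:R); first exact: (H x y a b).
  have [p [pi p0 p1 p2]] := H y x b a yN xN bN bx aN ax bL bL1 aL aL1 le.
  exists (fun t => ((p t).2, (p t).1)); split => /=.
  - move=> s t [e2 e1]; apply: pi; case: (p s) (p t) e1 e2 => [u v] [u' v'] /=.
    by move=> -> ->.
  - move=> [i j] ij; rewrite hatC; apply: (p0 (j, i)) => t; apply/eqP => E.
    by have /eqP := ij t; rewrite -E.
  - by rewrite -[RHS]p1; apply: eq_bigr => t _; rewrite hatC.
  - by move=> t; have [h1 h2 h3] := p2 t.
pose p0 : 'I_N.+2 * 'I_N.+2 := (Ordinal aL, Ordinal bL).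
pose p1 : 'I_N.+2 * 'I_N.+2 := (Ordinal aL1, Ordinal bL).
pose p2 : 'I_N.+2 * 'I_N.+2 := (Ordinal aL1, Ordinal bL1).
pose p (t : 'I_3) := nth p0 [:: p0; p1; p2] t.
case/andP: (ax) => ax1 ax2; case/andP: (bx) => bx1 bx2.
have [] := @hat_in (x - a%:R) (y - b%:R); try lra.
have eS (u : R) k : u - k%:R - 1 = u - k.+1%:R by rewrite -natr1 opprD addrA.
rewrite !eS => h0 h1 h2.
exists p; split.
- have u3 : uniq [:: p0; p1; p2].
    by rewrite /= !inE !xpair_eqE -!val_eqE /= !eqn_leq !ltnn !andbF.
  move=> s t /eqP; rewrite /p nth_uniq //; by move/eqP/val_inj.
- move=> [i j] ij /=.
  have [ia|ia] := eqVneq (val i) a; last first.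
    have [ia1|ia1] := eqVneq (val i) a.+1; last exact: hat_far ax ia ia1.
    rewrite hatC; apply: (hat_far _ bx); apply/eqP => jb.
      have /eqP := ij (inord 1); apply; rewrite /p inordK //=.
      by congr (_, _); apply: val_inj.
    have /eqP := ij (inord 2); apply; rewrite /p inordK //=.
    by congr (_, _); apply: val_inj.
  have [jb|jb] := eqVneq (val j) b.
    have /eqP := ij (inord 0); case; rewrite /p inordK //=.
    by congr (_, _); apply: val_inj.
  have [jb1|jb1] := eqVneq (val j) b.+1; last by rewrite hatC; exact: hat_far bx jb jb1.
  apply: hat_eq0; right; right; rewrite ia jb1 -natr1 ger0_norm; lra.
- by rewrite !big_ord_recl big_ord0 /= h0 h1 h2; ring.
- move=> [[|[|[|//]]] t3] /=; split => //=; rewrite ler_norml;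
  by apply/andP; split; rewrite -?(natr1 _ a) -?(natr1 _ b); lra.
Qed.

End Hats.

Lemma poly_nonroot (R : realType) (P : {poly R}) (e : R) : P != 0 -> 0 < e ->
  exists2 t, 0 < t < e & P.[t] != 0.
Proof.
move=> P0 e0; apply: contrapT => H.
pose s := [seq e / k.+2%:R | k <- iota 0 (size P)].
have : (size s < size P)%N.
  apply: max_poly_roots => //.
    apply/allP => _ /mapP[k _ ->]; apply/eqP; apply: contrapT => /eqP nz.
    apply: H; exists (e / k.+2%:R) => //.
    by rewrite divr_gt0 //= ltr_pdivrMr // ltr_pMr // (ltr_nat _ 1).
  rewrite map_inj_uniq ?iota_uniq // => i j /(mulfI (lt0r_neq0 e0))/invr_inj/eqP.
  by rewrite eqr_nat => /eqP[].
by rewrite size_map size_iota ltnn.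
Qed.

Section AvoidPlanes.
Variables (R : realType) (k : nat).

Let hom (v : 'rV[R]_k) : 'rV[R]_k.+1 :=
  \row_j (if unlift ord0 j is Some j' then v 0 j' else 1).

Let homE (u : 'rV[R]_k.+1) (x : 'rV[R]_k) :
  \sum_j hom x 0 j * u 0 j = u 0 ord0 + \sum_j x 0 j * u 0 (lift ord0 j).
Proof.
rewrite big_ord_recl !mxE unlift_none mul1r; congr (_ + _).
by apply: eq_bigr => j _; rewrite mxE liftK.
Qed.

(** Each triple [v i] lies on a hyperplane since [3 <= k]. The moment curve
    [c + (t, t^2, ..., t^k)] meets any hyperplane for finitely many [t] only, as its
    equation becomes a nonzero polynomial in [t]; hence a point of this curve
    close to [c] avoids all the planes. *)
Lemma avoid_planes (I : finType) (v : I -> 'I_3 -> 'rV[R]_k) (c : 'rV[R]_k) e :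
  (3 <= k)%N -> 0 < e ->
  exists2 q, `|q - c| < e & forall i (w : 'I_3 -> R), \sum_t w t = 1 ->
    \sum_t w t *: v i t != q.
Proof.
move=> k3 e0.
(* an equation of a hyperplane containing the three points, in homogeneous form *)
have ann i : exists u : 'rV[R]_k.+1, u != 0 /\
    forall t, \sum_j hom (v i t) 0 j * u 0 j = 0.
  pose B : 'M[R]_(3, k.+1) := \matrix_t hom (v i t).
  have : kermx B^T != 0.
    rewrite kermx_eq0 /row_free mxrank_tr; apply/eqP => rk.
    by have := rank_leq_row B; rewrite rk leqNgt ltnS k3.
  move=> /rowV0Pn[u /sub_kermxP uB u0]; exists u; split => // t.
  have := congr1 (fun N : 'M[R]_(1, 3) => N 0 t) uB; rewrite mxE [RHS]mxE => uBt.
  by rewrite -[RHS]uBt; apply: eq_bigr => j _; rewrite mulrC !mxE.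
have [u uP] := choice ann.
(* coefficients of the equation of the [i]th hyperplane along the curve *)
pose coef i j : R := if unlift ord0 (inord j : 'I_k.+1) is Some j' then
  u i 0 (lift ord0 j') else \sum_j hom c 0 j * u i 0 j.
pose P i := \poly_(j < k.+1) coef i j.
have P0 i : P i != 0.
  apply/eqP => Pi0; have [/eqP ui0 _] := uP i; apply: ui0.
  have cz (j : 'I_k.+1) : coef i j = 0.
    have := congr1 (fun p : {poly R} => p`_j) Pi0.
    by rewrite coef_poly ltn_ord coef0.
  have uz j : u i 0 (lift ord0 j) = 0.
    by have := cz (lift ord0 j); rewrite /coef inord_val liftK.
  apply/rowP => j; rewrite [RHS]mxE; case: (unliftP ord0 j) => [j'|] -> //.
  have := cz ord0; rewrite /coef inord_val unlift_none homE //.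
  by rewrite big1 ?addr0 // => j' _; rewrite uz mulr0.
pose Q := \prod_i P i.
have Q0 : Q != 0 by apply/prodf_neq0 => i _; exact: P0.
have e10 : 0 < Num.min e 1 by rewrite lt_min e0 ltr01.
have [t /andP[t0 te] Qt] := poly_nonroot Q0 e10.
have [te' t1] : t < e /\ t < 1 by move: te; rewrite lt_min => /andP[].
exists (c + \row_(j < k) t ^+ j.+1).
  rewrite addrC addKr; apply: le_lt_trans te'.
  apply: row_norm_le => [|j]; first exact: ltW.
  rewrite mxE ger0_norm; last by rewrite exprn_ge0 // ltW.
  by rewrite exprS ger_pMr // exprn_ile1 // ltW.
move=> i w w1; apply/eqP => E.
have [_ ui] := uP i.
have : \sum_j hom (\sum_t w t *: v i t) 0 j * u i 0 j = 0.
  rewrite homE //; under eq_bigr do rewrite summxE mulr_suml.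
  rewrite exchange_big /= -[u i 0 ord0]mul1r -w1 mulr_suml -big_split /= big1 // => s _.
  have := congr1 (fun x => w s * x) (ui s); rewrite homE // mulr0 mulrDr => E0.
  rewrite -[RHS]E0; congr (_ + _); rewrite mulr_sumr; apply: eq_bigr => j _.
  by rewrite mxE mulrA.
rewrite E => E2; have : (P i).[t] = 0.
  rewrite horner_poly -[RHS]E2 homE // big_ord_recl /coef.
  have -> : (inord (ord0 : 'I_k.+1)) = ord0 :> 'I_k.+1 by rewrite inord_val.
  rewrite unlift_none homE // expr0 mulr1 -addrA; congr (_ + _).
  rewrite -big_split /=; apply: eq_bigr => j _.
  have -> : inord (bump 0 j) = lift ord0 j by rewrite -[RHS]inord_val.
  by rewrite liftK !mxE mulrDl [X in _ + X]mulrC.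
move=> Pt; move/eqP: Qt; apply; rewrite /Q horner_prod (bigD1 i) //= Pt mul0r //.
Qed.

End AvoidPlanes.

(** Piecewise linear interpolation of [F] on a fine grid: the values on a triangle
    lie on the plane spanned by the values at its vertices. *)
Lemma pl_approximation (R : realType) (k : nat) (F : R * R -> 'rV[R]_k) eps :
  continuous F -> 0 < eps ->
  exists h : R * R -> 'rV[R]_k, [/\ continuous h,
    forall z, (`[0, 1] `*` `[0, 1]) z -> `|h z - F z| <= eps &
    exists (I : finType) (v : I -> 'I_3 -> 'rV[R]_k),
    forall z, (`[0, 1] `*` `[0, 1]) z -> exists i (w : 'I_3 -> R),
      \sum_t w t = 1 /\ h z = \sum_t w t *: v i t].
Proof.
move=> cF eps0.
have cI : compact (`[0, 1]%classic `*` `[0, 1]%classic : set (R * R)).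
  by apply: compact_setX; exact: segment_compact.
have [delta d0 hd] := uniform_on_compact cI cF eps0.
pose N := Num.truncn (delta^-1); pose n : R := N.+1%:R.
have n0 : 0 < n by rewrite ltr0n.
have nd : n^-1 < delta.
  rewrite -[ltRHS]invrK ltf_pV2 ?posrE ?invr_gt0 //.
  by rewrite /n /N; exact: truncnS_gt.
pose v (ij : 'I_N.+2 * 'I_N.+2) := F (ij.1%:R / n, ij.2%:R / n).
pose c (ij : 'I_N.+2 * 'I_N.+2) (z : R * R) := hat (n * z.1 - ij.1%:R) (n * z.2 - ij.2%:R).
pose h z := \sum_ij c ij z *: v ij.
have cc ij : continuous (c ij).
  move=> z; have c1 : {for z, continuous (fun z : R * R => n * z.1 - ij.1%:R)}.
    apply: continuousB; last exact: cst_continuous.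
    by apply: continuousM; [exact: cst_continuous|exact: cvg_fst].
  have c2 : {for z, continuous (fun z : R * R => n * z.2 - ij.2%:R)}.
    apply: continuousB; last exact: cst_continuous.
    by apply: continuousM; [exact: cst_continuous|exact: cvg_snd].
  have hc := @hat_continuous R (n * z.1 - ij.1%:R, n * z.2 - ij.2%:R).
  exact: (@continuous2_cvg _ R R R (nbhs z) _ _ _ (@hat R) _ _ hc c1 c2).
have sc z : (`[0, 1] `*` `[0, 1]) z -> 0 <= n * z.1 <= N.+1%:R /\ 0 <= n * z.2 <= N.+1%:R.
  move=> [/=]; rewrite !in_itv /= => /andP[a1 a2] /andP[b1 b2].
  have H x : 0 <= x -> x <= 1 -> 0 <= n * x <= N.+1%:R.
    move=> x0 x1; apply/andP; split; first exact: mulr_ge0 (ltW n0) x0.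
    by rewrite -[leRHS]mulr1 ler_pM2l.
  by split; exact: H.
have hE z : (`[0, 1] `*` `[0, 1]) z -> exists p : 'I_3 -> 'I_N.+2 * 'I_N.+2,
    [/\ h z = \sum_t c (p t) z *: v (p t), \sum_t c (p t) z = 1 &
      forall t, [/\ 0 <= c (p t) z, `|n * z.1 - (p t).1%:R| <= 1 &
        `|n * z.2 - (p t).2%:R| <= 1]].
  move=> Iz; have [z1 z2] := sc z Iz.
  have [p [pi p0 p1 p2]] := hats3 z1 z2; exists p; split => //.
  rewrite /h (bigID (mem (codom p))) /= [X in _ + X]big1 ?addr0; last first.
    move=> ij nij; rewrite /c p0 ?scale0r // => t; apply: contra nij => /eqP ->.
    exact: codom_f.
  rewrite -big_uniq /=; last by rewrite /codom /image_mem map_inj_uniq // enum_uniq.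
  by rewrite big_map big_enum.
exists h; split.
- apply: continuous_sumr => ij _ z.
  by apply: cvgZr_tmp; exact: cc.
- move=> z Iz; have [p [-> w1 wp]] := hE z Iz.
  have -> : F z = \sum_t c (p t) z *: F z by rewrite -scaler_suml w1 scale1r.
  rewrite -sumrB; apply: le_trans (ler_norm_sum _ _ _) _.
  rewrite -[leRHS]mul1r -w1 mulr_suml; apply: ler_sum => t _.
  have [w0 a1 a2] := wp t.
  rewrite -scalerBr normrZ ger0_norm //; apply: ler_wpM2l => //.
  rewrite distrC; apply/ltW/hd => //.
  have cl (x : R) (j : nat) : `|n * x - j%:R| <= 1 -> `|x - j%:R / n| < delta.
    move=> H; apply: le_lt_trans nd; rewrite -(ler_pM2l n0) mulfV ?gt_eqF //.
    by rewrite -{1}(ger0_norm (ltW n0)) -normrM mulrBr mulrCA mulfV ?gt_eqF // mulr1.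
  by split; rewrite /ball /=; exact: cl.
- exists {ffun 'I_3 -> 'I_N.+2 * 'I_N.+2},
    (fun (p : {ffun 'I_3 -> 'I_N.+2 * 'I_N.+2}) t => v (p t)) => z Iz.
  have [p [-> w1 wp]] := hE z Iz.
  exists [ffun t => p t], (fun t => c (p t) z); split => //.
  by apply: eq_bigr => t _; rewrite ffunE.
Qed.

Section Clamp.
Variable R : realType.

Definition clamp (t : R) : R := Order.max 0 (Order.min 1 t).

Lemma clamp_continuous : continuous clamp.
Proof.
move=> t; exact: (continuous_max (@cst_continuous _ _ (0 : R) t)
  (continuous_min (@cst_continuous _ _ (1 : R) t) (@cvg_id _ (nbhs t)))).
Qed.

Lemma clamp_bounds t : 0 <= clamp t <= 1.
Proof. by rewrite /clamp; apply/andP; split; rewrite ?le_max ?lexx // ge_max ler01 ge_min lexx. Qed.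

Lemma clamp_id t : 0 <= t <= 1 -> clamp t = t.
Proof. by move=> /andP[t0 t1]; rewrite /clamp min_r // max_r. Qed.

Lemma clamp_extend (Y : topologicalType) (f : R -> Y) :
  {within `[0, 1], continuous f} -> continuous (f \o clamp).
Proof.
move=> cf; apply/continuous_subspace_setT; apply: within_comp cf _.
  by apply: continuous_subspaceT; exact: clamp_continuous.
by move=> t _; rewrite /= in_itv /=; exact: clamp_bounds.
Qed.

Definition clamp2 (z : R * R) : R * R := (clamp z.1, clamp z.2).

Lemma clamp2_continuous : continuous clamp2.
Proof.
move=> z.
have c1 : {for z, continuous (fun z : R * R => clamp z.1)}.
  exact: (continuous_comp cvg_fst (@clamp_continuous _)).
have c2 : {for z, continuous (fun z : R * R => clamp z.2)}.
  exact: (continuous_comp cvg_snd (@clamp_continuous _)).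
exact: (cvg_pair c1 c2).
Qed.

Lemma clamp2_in z : (`[0, 1]%classic `*` `[0, 1]%classic) (clamp2 z).
Proof. by split; rewrite /= in_itv /=; exact: clamp_bounds. Qed.

Lemma clamp2_id z : (`[0, 1]%classic `*` `[0, 1]%classic) z -> clamp2 z = z.
Proof.
case: z => a b [] /=; rewrite !in_itv /= => a01 b01.
by rewrite /clamp2 /= !clamp_id.
Qed.

Lemma clamp2_extend (Y : topologicalType) (f : R * R -> Y) :
  {within `[0, 1] `*` `[0, 1], continuous f} -> continuous (f \o clamp2).
Proof.
move=> cf; apply/continuous_subspace_setT; apply: within_comp cf _.
  by apply: continuous_subspaceT; exact: clamp2_continuous.
by move=> t _; exact: clamp2_in.
Qed.

End Clamp.

Section PushOff.
Variables (R : realType) (n : nat) (M : topologicalType).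
Variables (A : smooth_atlas R n M) (T : triangulation A).
Hypothesis hM : hausdorff_space M.
Variable d : 'rV[R]_n -> M.
Hypothesis Td : T n d.
Local Notation II := (`[0, 1]%classic `*` `[0, 1]%classic : set (R * R)).

Lemma cell_or y : cell d y \/ ~ opencell d y.
Proof.
by have [/opencell_sub|] := pselect (opencell d y); [left|right].
Qed.

Lemma glue_cell (Y : topologicalType) (f : M -> Y) :
  {within cell d, continuous f} -> {within ~` opencell d, continuous f} ->
  continuous f.
Proof.
move=> c1 c2; apply/continuous_subspace_setT.
have -> : [set: M] = cell d `|` ~` opencell d.
  by apply/esym; rewrite -subTset => y _; exact: cell_or.
apply: withinU_continuous => //; first exact: (cell_closed hM Td).
by rewrite closedC; exact: (top_opencell_open Td).
Qed.

Let q0 := barycenter R n.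

(** General position. In the coordinates of [d], near the barycenter [q0], the map is
    replaced by a piecewise linear one: [nu] is a bump function centred at [q0],
    [chi \o nu] interpolates between the map and its approximation [h], and [E]
    extends the coordinates of [d] near [q0] to [M]. The result [G] misses a
    point [d q]: where [chi = 1] it is [h], whose values lie on finitely many planes,
    and elsewhere it stays away from [q0]. Then [G] is pushed radially from [d q]. *)
Lemma push_off (H : R * R -> M) : (3 <= n)%N ->
  {within II, continuous H} ->
  exists H', [/\ {within II, continuous H'},
    forall z, II z -> ~ opencell d (H' z) &
    forall z, II z -> ~ opencell d (H z) -> H' z = H z].
Proof.
move=> n3 cH.
pose Ht := H \o @clamp2 R.
have cHt : continuous Ht by exact: clamp2_extend.
have HtE z : II z -> Ht z = H z by move=> Iz; rewrite /Ht /= clamp2_id.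
have [rho rho0 hrho] : exists2 rho, 0 < rho &
    forall x : 'rV[R]_n, `|x - q0| <= rho -> positive_bary x.
  have : nbhs q0 (@positive_bary R n).
    apply: open_nbhs_nbhs; split; first exact: open_positive_bary.
    exact: barycenter_positive.
  move=> /nbhs_ballP[e /= e0 he]; exists (e / 2); first exact: divr_gt0.
  move=> x xq; apply: he; rewrite -ball_normE /= distrC.
  by apply: (le_lt_trans xq); rewrite ltr_pdivrMr // ltr_pMr // ltr1n.
pose a y := `|cinv d y - q0|.
pose nu y := if `[< cell d y >] then Order.max 0 (1 - a y / rho) else 0.
pose E y := if `[< cell d y >] then
  q0 + Order.min 1 (3 * nu y) *: (cinv d y - q0) else q0.
pose chi (s : R) := Order.max 0 (Order.min 1 (3 * s - 1)).
have ca : {within cell d, continuous a}.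
  apply: (@within_comp_cont _ _ _ (cell d) (cinv d) (fun x => `|x - q0|)).
    exact: (cinv_continuous hM Td).
  by move=> x; exact: (cvg_norm (cvgB cvg_id (cvg_cst _))).
have nuE y : cell d y -> nu y = Order.max 0 (1 - a y / rho).
  by move=> cy; rewrite /nu asboolT.
have nu0 y : ~ opencell d y -> nu y = 0.
  move=> no; rewrite /nu; case: asboolP => // cy; apply/max_idPl.
  rewrite subr_le0 ler_pdivlMr // mul1r leNgt; apply/negP => /ltW/hrho pz.
  by apply: no; rewrite opencellE; exists (cinv d y) => //; have [] := cinvP cy.
have cnu : continuous nu.
  apply: glue_cell; last first.
    by apply: (eq_within (f := fun=> 0)) => [y /nu0 ->//|];
      apply: continuous_subspaceT => y; exact: cvg_cst.
  apply: (eq_within (f := (fun t => Order.max 0 (1 - t / rho)) \o a)).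
    by move=> y cy; rewrite nuE.
  apply: within_comp_cont => // t.
  exact: (continuous_max (@cst_continuous _ _ (0 : R) t)
    (continuousB (@cst_continuous _ _ (1 : R) t)
      (continuousM (@cvg_id _ (nbhs t)) (@cst_continuous _ _ (rho^-1) t)))).
have cE : continuous E.
  apply: glue_cell; last first.
    apply: (eq_within (f := fun=> q0)) => [y no|].
      rewrite /E nu0 //; case: asboolP => // cy.
      by rewrite mulr0 min_r ?ler01 // scale0r addr0.
    by apply: continuous_subspaceT => y; exact: cvg_cst.
  apply: (eq_within (f := fun y => q0 + Order.min 1 (3 * nu y) *: (cinv d y - q0))).
    by move=> y cy; rewrite /E asboolT.
  have cc := cinv_continuous hM Td.
  have cm : {within cell d, continuous (fun y => Order.min 1 (3 * nu y))}.
    apply: continuous_subspaceT => y.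
    exact: (continuous_min (@cst_continuous _ _ (1 : R) y)
      (continuousM (@cst_continuous _ _ (3 : R) y) (cnu y))).
  move=> y; exact: (cvgD (cvg_cst _) (cvgZ (cm y) (cvgB (cc y) (cvg_cst _)))).
have e0 : 0 < rho / 9 by rewrite divr_gt0.
have cF : continuous (E \o Ht).
  by move=> z; apply: continuous_comp; [exact: cHt|exact: cE].
have [h [ch hF [I [v hv]]]] := pl_approximation cF e0.
have [q qq0 hq'] := avoid_planes v q0 n3 e0.
have hq z : II z -> h z != q.
  by move=> /hv[i [w [w1 ->]]]; exact: hq'.
have chi01 s : 0 <= chi s <= 1 by exact: clamp_bounds.
(* outside the support of [chi \o nu] nothing moves; inside, [E] is the coordinate *)
have N1 y : cell d y -> chi (nu y) = 0 \/ a y < 2 / 3 * rho /\ E y = cinv d y.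
  move=> cy; have [lt|le] := ltP (1 / 3) (nu y); last first.
    left; rewrite /chi; apply/max_idPl; rewrite ge_min; apply/orP; right; lra.
  right; split.
    move: lt; rewrite nuE // lt_max => /orP[|]; first by lra.
    move=> H1; have H2 : a y / rho < 2 / 3 by lra.
    by rewrite ltr_pdivrMr in H2.
  by rewrite /E asboolT // min_l ?scale1r ?subrKC //; lra.
(* where [chi] is not 1 the coordinate is far from [q0], hence from [q] *)
have N2 y : cell d y -> chi (nu y) = 1 \/ rho / 3 < a y.
  move=> cy; have [le|lt] := leP (2 / 3) (nu y).
    by left; rewrite /chi min_l ?max_r ?ler01 //; lra.
  right; move: lt; rewrite nuE // gt_max => /andP[_ H1].
  have H2 : 1 / 3 < a y / rho by lra.
  by move: H2; rewrite ltr_pdivlMr //; lra.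
pose pt z := cinv d (Ht z) + chi (nu (Ht z)) *: (h z - cinv d (Ht z)).
have ptE z : cell d (Ht z) -> chi (nu (Ht z)) = 0 -> pt z = cinv d (Ht z).
  by move=> _ c0; rewrite /pt c0 scale0r addr0.
have hc z : II z -> cell d (Ht z) -> chi (nu (Ht z)) != 0 ->
    `|h z - cinv d (Ht z)| <= rho / 9.
  by move=> Iz cz; case: (N1 _ cz) => [->|[_ <-] _]; [rewrite eqxx|exact: hF].
have ptc z : II z -> cell d (Ht z) -> `|pt z - cinv d (Ht z)| <= rho / 9.
  move=> Iz cz; have [c0|c0] := eqVneq (chi (nu (Ht z))) 0.
    by rewrite ptE // subrr normr0 ltW.
  rewrite /pt addrC addKr normrZ; have /andP[chi0 chi1] := chi01 (nu (Ht z)).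
  rewrite ger0_norm //; apply: le_trans (hc _ Iz cz c0).
  by rewrite ler_piMl.
have ptS z : II z -> cell d (Ht z) -> simplex R n (pt z).
  move=> Iz cz; case: (N1 _ cz) => [c0|[alt _]].
    by rewrite ptE //; have [] := cinvP cz.
  apply: sub_positive_bary; apply: hrho.
  rewrite -(subrK (cinv d (Ht z)) (pt z)) -addrA; apply: le_trans (ler_normD _ _) _.
  have := ptc _ Iz cz; rewrite -/(a (Ht z)); move: alt; lra.
have ptq z : II z -> cell d (Ht z) -> pt z != q.
  move=> Iz cz; apply/eqP => ptq; case: (N2 _ cz) => [c1|agt].
    move: ptq; rewrite /pt c1 scale1r subrKC => hzq.
    by move: (hq z Iz); rewrite hzq eqxx.
  have := ptc _ Iz cz; rewrite ptq; move: agt qq0; rewrite /a.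
  have : `|cinv d (Ht z) - q0| <= `|q - cinv d (Ht z)| + `|q - q0|.
    rewrite (distrC q (cinv _ _)) -(subrK q (cinv d (Ht z))) -addrA.
    by rewrite [X in `|X + _| + _](subrK) ler_normD.
  by lra.
pose G z := if `[< cell d (Ht z) >] then d (pt z) else Ht z.
have GE z : ~ opencell d (Ht z) -> G z = Ht z.
  move=> no; rewrite /G; case: asboolP => // cz.
  rewrite ptE //; first by have [] := cinvP cz.
  by rewrite /chi nu0 // mulr0 sub0r; apply/max_idPl; rewrite ge_min; apply/orP; right; lra.
have cII : closed II.
  apply: compact_closed; first exact: norm_hausdorff.
  by apply: compact_setX; exact: segment_compact.
have cG : {within II, continuous G}.
  have -> : II = (II `&` Ht @^-1` (cell d)) `|` (II `&` Ht @^-1` (~` opencell d)).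
    rewrite predeqE => z; split=> [Iz|[[]|[]]//].
    by case: (cell_or (Ht z)); [left|right].
  have clo B : closed B -> closed (II `&` Ht @^-1` B).
    move=> cB; apply: closedI => //.
    by apply: closed_comp => // z _; exact: cHt.
  apply: withinU_continuous.
  - by apply: clo; exact: (cell_closed hM Td).
  - by apply: clo; rewrite closedC; exact: (top_opencell_open Td).
  - apply: (eq_within (f := d \o pt)); first by move=> z [_ cz]; rewrite /G asboolT.
    apply: (within_comp (B := simplex R n)).
    + have c1 : {within II `&` Ht @^-1` (cell d), continuous (cinv d \o Ht)}.
        apply: (within_comp (B := cell d)); last by move=> z [].
          exact: continuous_subspaceT.
        exact: (cinv_continuous hM Td).
      have c2 : {within II `&` Ht @^-1` (cell d), continuous (fun z => chi (nu (Ht z)))}.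
        apply: continuous_subspaceT => z.
        have c3 : {for z, continuous (nu \o Ht)}.
          by apply: continuous_comp; [exact: cHt|exact: cnu].
        exact: (continuous_max (@cst_continuous _ _ (0 : R) z)
          (continuous_min (@cst_continuous _ _ (1 : R) z) (continuousB
          (continuousM (@cst_continuous _ _ (3 : R) z) c3)
          (@cst_continuous _ _ (1 : R) z)))).
      have c3 : {within II `&` Ht @^-1` (cell d), continuous h}.
        exact: continuous_subspaceT.
      by move=> z; exact: (cvgD (c1 z) (cvgZ (c2 z) (cvgB (c3 z) (c1 z)))).
    + exact: (Phi_continuous Td).
    + by move=> z [Iz cz]; exact: ptS.
  - apply: (eq_within (f := Ht)); first by move=> z [_ /GE].
    exact: continuous_subspaceT.
have pq : positive_bary q by apply: hrho; lra.
have Gq z : II z -> G z != d q.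
  move=> Iz; apply/eqP; rewrite /G; case: asboolP => cz.
    move/(Phi_inj Td (ptS _ Iz cz) (sub_positive_bary pq)).
    by apply/eqP; exact: ptq.
  by move=> Hz; apply: cz; rewrite Hz; exists q => //; exact: sub_positive_bary.
pose V := opencell d `&` ~` (G @` II).
have oV : open V.
  apply: openI; first exact: (top_opencell_open Td).
  rewrite openC; apply: compact_closed => //; apply: continuous_compact => //.
  by apply: compact_setX; exact: segment_compact.
have Vq : V (d q).
  split; first by rewrite opencellE; exists q.
  by move=> [z Iz]; apply/eqP; exact: Gq.
have Vd : V `<=` opencell d by move=> y [].
have [r [cr rV _ rid]] := outside_retraction hM Td pq oV Vq Vd.
have GV z : II z -> (~` V) (G z) by move=> Iz [_]; apply; exists z.
exists (r \o G); split.
- exact: within_comp cr GV.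
- by move=> z Iz; apply: rV; exact: GV.
- by move=> z Iz; rewrite -HtE // => no; rewrite /= GE // rid.
Qed.

End PushOff.

Section OutsideSimplyConnected.
Variables (R : realType) (n : nat) (M : topologicalType).
Variables (A : smooth_atlas R n M) (T : triangulation A).
Hypothesis hM : hausdorff_space M.
Local Notation I01 := (`[0, 1]%classic : set R).
Local Notation II := (I01 `*` I01 : set (R * R)).

(** A path is treated as a homotopy that does not depend on the second variable. *)
Lemma outside_simply_connected d : (3 <= n)%N -> T n d ->
  ~` opencell d !=set0 ->
  simply_connected R [set: M] -> simply_connected R (~` opencell d).
Proof.
move=> n3 Td K0 [_ Mp Mh].
have I0 : (`[0, 1]%classic : set R) 0 by rewrite /= in_itv /= lexx ler01.
have I1 : (`[0, 1]%classic : set R) 1 by rewrite /= in_itv /= lexx ler01.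
split=> //.
  move=> x y Kx Ky; have [g [cg g0 g1 _]] := Mp x y Logic.I Logic.I.
  have cH : {within II, continuous (g \o (@fst R R))}.
    apply: (@within_comp _ _ _ II I01 (@fst R R) g) => //; last by move=> z [].
    by apply: continuous_subspaceT => z; exact: cvg_fst.
  have [H [cH' HK Hid]] := push_off hM Td n3 cH.
  exists (fun s => H (s, 0)); split.
  - apply: (@within_comp _ _ _ I01 II (fun s : R => (s, 0 : R)) H) => //.
    by apply: continuous_subspaceT => s; exact: (cvg_pair cvg_id (cvg_cst _)).
  - by rewrite Hid //= ?g0.
  - by rewrite Hid //= ?g1.
  - by move=> t It; exact: HK.
move=> x g Kx [cg g0 g1 gK].
have [H [cH _ H1 H2]] : null_homotopic_in [set: M] x g by apply: Mh.
have [H' [cH' HK Hid]] := push_off hM Td n3 cH.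
exists H'; split => //.
- move=> s Is; have [h1 h2] := H1 s Is.
  by split; rewrite Hid ?h1 ?h2 //; exact: gK.
- move=> t It; have [h1 h2] := H2 t It.
  by split; rewrite Hid ?h1 ?h2.
Qed.

End OutsideSimplyConnected.

Lemma simply_connected1 (R : realType) (M : topologicalType) (y : M) :
  simply_connected R [set y].
Proof.
have cc (X : topologicalType) (B : set X) : {within B, continuous (fun=> y)}.
  by apply: continuous_subspaceT => t; exact: cvg_cst.
split; first by exists y.
  by move=> _ _ -> ->; exists (fun=> y); split.
move=> _ g -> [cg g0 g1 gy]; exists (fun=> y); split => //.
by move=> s /gy ->.
Qed.

(** * Faces as members of the triangulation *)

Section Faces.
Variables (R : realType) (n : nat) (M : topologicalType).
Variables (A : smooth_atlas R n M) (T : triangulation A).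

Lemma is_face_uniq l (phi : 'rV[R]_l.+1 -> M) psi psi' i :
  T l psi -> T l psi' ->
  (forall x, simplex R l x -> psi x = phi (face_map i x)) ->
  (forall x, simplex R l x -> psi' x = phi (face_map i x)) -> psi = psi'.
Proof.
move=> Tp Tp' h h'.
have bp := @barycenter_positive R l; have bs := sub_positive_bary bp.
apply: (opencell_inj (p := psi (barycenter R l)) Tp Tp').
  by rewrite opencellE; exists (barycenter R l).
by rewrite opencellE h // -h' //; exists (barycenter R l).
Qed.

Definition face l (phi : 'rV[R]_l.+1 -> M) (i : 'I_l.+2) : 'rV[R]_l -> M :=
  xget (fun=> phi 0) [set psi | T l psi /\
    forall x, simplex R l x -> psi x = phi (face_map i x)].

Lemma faceP l (phi : 'rV[R]_l.+1 -> M) i : T l.+1 phi ->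
  T l (face phi i) /\ forall x, simplex R l x -> face phi i x = phi (face_map i x).
Proof.
move=> Tphi; have [psi Tpsi h] := Phi_face i Tphi.
by rewrite /face; case: xgetP => [_ -> //|/(_ psi) []].
Qed.

Lemma is_faceE l (phi : 'rV[R]_l.+1 -> M) psi : T l.+1 phi -> T l psi ->
  is_face psi phi -> exists i, psi = face phi i.
Proof.
move=> Tphi Tpsi [i h]; exists i; have [h1 h2] := faceP i Tphi.
exact: (is_face_uniq Tpsi h1 h h2).
Qed.

Lemma face_is_face l (phi : 'rV[R]_l.+1 -> M) i : T l.+1 phi ->
  is_face (face phi i) phi.
Proof. by move=> Tphi; exists i => x; exact: (faceP i Tphi).2. Qed.

Lemma face_inj l (phi : 'rV[R]_l.+1 -> M) : T l.+1 phi -> injective (face phi).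
Proof.
move=> Tphi i j E; have [_ hi] := faceP i Tphi; have [_ hj] := faceP j Tphi.
have bp := @barycenter_positive R l; have bs := sub_positive_bary bp.
have := hi _ bs; rewrite E hj // => /(Phi_inj Tphi) Eq.
have {}Eq := Eq (face_map_simplex _ bs) (face_map_simplex _ bs).
have := congr1 (fun x => bary x i) Eq; rewrite /= bary_face_self bary_face.
case: unliftP => [k _ k0|//]; by have := bp k; rewrite k0 ltxx.
Qed.

End Faces.

(** * Dimension one *)

Section DimensionOne.
Variables (R : realType) (M : topologicalType).
Variables (A : smooth_atlas R 1 M) (T : triangulation A).
Hypothesis hM : hausdorff_space M.
Hypothesis cM : connected [set: M].

(** The white edges form an arc, so at most two of their ends are still black: a
    step uses up one end of the arc and adds the other end of the new edge. *)
Lemma two_ends D E : stage T D E -> exists p1 p2,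
  forall d v, D d -> T 0%N v -> is_face v d -> ~ E v -> (v, d) = p1 \/ (v, d) = p2.
Proof.
elim=> [d Td|{}D {}E d d' tau st [p1 [p2 H]] Td nDd Dd' Ttau fd fd'].
  exists (face T d ord0, d), (face T d ord_max, d) => _ v -> Tv fv _.
  by have [i ->] := is_faceE Td Tv fv; case: (ord2P i) => ->; [left|right].
have [DT ET DE] := stage_inv hM st.
have nE : ~ E tau by move=> Et; apply: nDd; exact: DE Et Td fd.
have [j tj] := is_faceE Td Ttau fd.
have [q qj] : exists q, forall i, i != j -> i = q :> 'I_2.
  case: (ord2P j) => ->; [exists ord_max|exists ord0] => i; case: (ord2P i) => -> //;
    by rewrite eqxx.
have new p1' p2' : (forall d v, D d -> T 0%N v -> is_face v d -> ~ E v ->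
     (v, d) = p1' \/ (v, d) = p2') -> (tau, d') = p1' ->
   exists p1 p2, forall d1 v, (D `|` [set d]) d1 -> T 0%N v -> is_face v d1 ->
     ~ (E `|` [set tau]) v -> (v, d1) = p1 \/ (v, d1) = p2.
  move=> H' E1; exists p2', (face T d q, d) => d1 v Dd1 Tv fv nv.
  have nEv : ~ E v by move=> ?; apply: nv; left.
  case: Dd1 => [Dd1|E2].
    case: (H' d1 v Dd1 Tv fv nEv) => [E2|]; last by left.
    by exfalso; apply: nv; right; move: E2; rewrite -E1 => -[].
  rewrite E2 in fv *; right; have [i vi] := is_faceE Td Tv fv.
  rewrite vi (qj i) //; apply/eqP => ij; apply: nv; right.
  by rewrite vi ij -tj.
case: (H d' tau Dd' Ttau fd' nE) => E1; first exact: (new p1 p2).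
apply: (new p2 p1) => // d1 v h1 h2 h3 h4.
by case: (H d1 v h1 h2 h3 h4); [right|left].
Qed.

Lemma vertex_cell (v : 'rV[R]_0 -> M) y : cell v y -> y = v 0.
Proof. by move=> [x _ <-]; congr v; apply/rowP => -[]. Qed.

(** An isolated vertex would be open and closed in the connected space [M]. *)
Lemma vertex_coface D E v : stage T D E -> T 0%N v ->
  exists2 d, T 1%N d & is_face v d.
Proof.
move=> st Tv; apply: contrapT => H; pose p := v 0.
have ov : opencell v p by rewrite opencellE; exists 0 => //; exact: positive_bary0.
have [N [oN Np hN]] := star_nbhs T hM p.
have NE : N `<=` [set p].
  move=> x Nx; have [l [phi Tphi ophi]] := Phi_cover T x.
  have cphi := hN _ _ _ Tphi (opencell_sub ophi) Nx.
  have lm : (l <= 1)%N. by exact: (Phi_dim_le Tphi).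
  case: l lm phi Tphi ophi cphi => [|[|//]] _ phi Tphi ophi cphi.
    rewrite (vertex_cell (opencell_sub ophi)).
    by rewrite (cell_opencell_eq Tphi Tv cphi ov).
  by exfalso; apply: H; exists phi => //; exact: (cell_opencell_face Tphi Tv cphi ov).
have pT : [set p] = [set: M].
  apply: cM; first by exists p.
    exists N => //; rewrite setTI predeqE => x; split; last exact: NE.
    by move=> ->.
  exists [set p]; last by rewrite setTI.
  by apply: accessible_closed_set1; exact: hausdorff_accessible.
have [d Dd] : exists d, D d.
  by elim: st => [d _|{}D {}E d]; exists d; [|right].
have [DT _ _] := stage_inv hM st.
have op : opencell d (d (barycenter R 1)).
  by rewrite opencellE; exists (barycenter R 1) => //; exact: barycenter_positive.
have dp : d (barycenter R 1) = p.
  by have : [set: M] (d (barycenter R 1)) by []; rewrite -pT.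
rewrite dp in op.
by have := existT_inj1 (opencell_eq (DT _ Dd) Tv op ov).
Qed.

(** A black vertex is an end of two edges, so it takes up both ends of the arc. *)
Lemma dim1_point D E : stage T D E -> T 1%N `<=` D ->
  exists y, ~` white D E = [set y].
Proof.
move=> st TD; have [DT ET DE] := stage_inv hM st.
have [y Ky] : ~` white D E !=set0.
  apply: (retract_along_stage hM (P := fun B => B !=set0)) st.
    by move=> B B' r; exact: retract_nonempty.
  by move=> d Td; exact: (outside_opencell_nonempty Td).
exists y; rewrite predeqE => x; split; last by move=> ->.
have [p1 [p2 H]] := two_ends st.
have vert z : (~` white D E) z -> exists v, [/\ T 0%N v, z = v 0 & v = p1.1].
  move=> Kz; have [l [phi Tphi ophi]] := Phi_cover T z.
  have lm : (l <= 1)%N. by exact: (Phi_dim_le Tphi).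
  case: l lm phi Tphi ophi => [|[|//]] _ phi Tphi ophi; last first.
    by exfalso; apply: Kz; left; exists phi => //; exact: TD.
  exists phi; split => //; first exact: vertex_cell (opencell_sub ophi).
  have nE : ~ E phi by move=> Ep; apply: Kz; right; exists phi.
  have [d1 Td1 f1] := vertex_coface st Tphi.
  have [d2 [Td2 f2 d21 _]] := other_coface hM Tphi Td1 f1.
  case: (H d1 phi (TD _ Td1) Tphi f1 nE) => [<- //|E1].
  case: (H d2 phi (TD _ Td2) Tphi f2 nE) => [<- //|E2].
  by exfalso; apply: d21; move: E2; rewrite -E1 => -[].
by move=> /vert[v [_ -> ->]]; have [w [_ -> ->]] := vert _ Ky.
Qed.

End DimensionOne.

(** * Dimension two: cocycles modulo 2 *)

Section Cocycle.
Variables (R : realType) (M : topologicalType).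
Variables (A : smooth_atlas R 2 M) (T : triangulation A).
Hypothesis hM : hausdorff_space M.
Local Notation edge := ('rV[R]_1 -> M).
Local Notation triangle := ('rV[R]_2 -> M).
Implicit Types (c : edge -> bool) (D : set triangle) (E : set edge).

Definition coboundary c (phi : triangle) : bool :=
  \big[addb/false]_(i < 3) c (face T phi i).

Lemma coboundary_add c c' phi :
  coboundary (fun e => c e (+) c' e) phi = coboundary c phi (+) coboundary c' phi.
Proof. by rewrite /coboundary big_split. Qed.

Lemma coboundary_edge e phi : T 1%N e -> T 2%N phi ->
  coboundary (fun x => `[< x = e >]) phi = `[< is_face e phi >].
Proof.
move=> Te Tphi; apply/idP/idP; last first.
  move=> /asboolP/(is_faceE Tphi Te)[i ei]; rewrite /coboundary (bigD1 i) //=.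
  rewrite asboolT // big1 // => j ji; apply: asboolF => Ej.
  by move/eqP: ji; apply; apply: (face_inj Tphi); rewrite Ej.
apply: contraTT => /asboolPn nf; rewrite /coboundary big1 // => i _.
by apply: asboolF => Ei; apply: nf; rewrite -Ei; exact: face_is_face.
Qed.

Lemma coboundary_edge2 e d d' phi : T 1%N e -> T 2%N phi -> T 2%N d -> T 2%N d' ->
  d' <> d -> is_face e d -> is_face e d' ->
  coboundary (fun x => `[< x = e >]) phi = `[< phi = d >] (+) `[< phi = d' >].
Proof.
move=> Te Tphi Td Td' dd fd fd'; rewrite coboundary_edge //.
have [d2 [_ _ _ H]] := other_coface hM Te Td fd.
have [//|E2] := H _ Td' fd'; rewrite -{d2}E2 in H.
have [->|nd] := pselect (phi = d).
  by rewrite (asboolT fd) (asboolT (erefl d)) asboolF // => E; apply: dd.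
rewrite (asboolF nd); have [->|nd'] := pselect (phi = d'); first by rewrite (asboolT fd') asboolT.
by rewrite (asboolF nd') asboolF // => /(H _ Tphi)[].
Qed.

(** The triangles are connected across white edges; the edges crossed by a path from
    [d0] to [d] form a cochain whose coboundary is the sum of the ends of the path. *)
Lemma white_path D E : stage T D E -> exists d0, D d0 /\ forall d, D d ->
  exists c, (forall e, c e -> E e) /\
    forall phi, T 2%N phi -> coboundary c phi = `[< phi = d >] (+) `[< phi = d0 >].
Proof.
elim=> [d Td|{}D {}E d d' tau st [d0 [Dd0 H]] Td nDd Dd' Ttau fd fd'].
  exists d; split => // _ ->; exists (fun=> false); split => // phi Tphi.
  by rewrite /coboundary big1 // addbb.
have [DT ET DE] := stage_inv hM st.
exists d0; split; first by left.
move=> x [Dx|->].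
  by have [c [cE cd]] := H x Dx; exists c; split => // e /cE; left.
have [c [cE cd]] := H d' Dd'.
exists (fun e => `[< e = tau >] (+) c e); split.
  by move=> e; have [->|ne] := pselect (e = tau); [right|rewrite asboolF //= => /cE; left].
move=> phi Tphi; rewrite coboundary_add cd //.
rewrite (coboundary_edge2 Ttau Tphi Td (DT _ Dd')) //; last by move=> E'; rewrite E' in Dd'.
by case: `[< _ >]; case: `[< _ >]; case: `[< _ >].
Qed.

(** A white path joining the two triangles adjacent to [e] is closed up by crossing
    [e]. If [e] lies on no triangle, it is a cocycle by itself. *)
Lemma black_edge_cocycle D E e : stage T D E -> T 2%N `<=` D -> T 1%N e -> ~ E e ->
  exists c, [/\ c e, forall x, c x -> x = e \/ E x &
    forall phi, T 2%N phi -> coboundary c phi = false].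
Proof.
move=> st TD Te nE; have [DT ET DE] := stage_inv hM st.
have [[d [Td fd]]|nf] := pselect (exists d, T 2%N d /\ is_face e d); last first.
  exists (fun x => `[< x = e >]); split; first by rewrite asboolT.
    by move=> x /asboolP; left.
  by move=> phi Tphi; rewrite coboundary_edge // asboolF // => fe; apply: nf; exists phi.
have [d' [Td' fd' dd' _]] := other_coface hM Te Td fd.
have [d0 [_ H]] := white_path st.
have [c [cE cd]] := H d (TD _ Td); have [c' [cE' cd']] := H d' (TD _ Td').
exists (fun x => `[< x = e >] (+) (c x (+) c' x)); split.
- rewrite asboolT //; case ce : (c e); first by case: nE; exact: cE.
  by case ce' : (c' e); first by case: nE; exact: cE'.
- move=> x; have [->|ne] := pselect (x = e); [by left|rewrite (asboolF ne) /= => H1].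
  by right; case cx: (c x) H1 => /=; [move=> _; exact: cE|exact: cE'].
- move=> phi Tphi; rewrite !coboundary_add cd // cd' //.
  rewrite (coboundary_edge2 Te Tphi Td Td') //.
  by case: `[< _ >]; case: `[< _ >]; case: `[< _ >].
Qed.

End Cocycle.

(** * Lifting fields of lines over the square *)

Section Matrices.
Variable R : realType.

Lemma continuous_mulmx (X : topologicalType) m n p (f : X -> 'M[R]_(m, n))
    (g : X -> 'M[R]_(n, p)) :
  continuous f -> continuous g -> continuous (fun x => f x *m g x).
Proof.
move=> cf cg; apply: continuous_mx => i j.
rewrite (_ : (fun x => _) = fun x => \sum_k f x i k * g x k j); last first.
  by apply/funext => x; rewrite mxE.
apply: (@continuous_sumr _ R R^o) => k _ x.
have c1 := continuous_comp (cf x) (@coord_continuous _ _ _ i k _).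
have c2 := continuous_comp (cg x) (@coord_continuous _ _ _ k j _).
exact: (continuousM c1 c2).
Qed.

Lemma continuous_trmx (X : topologicalType) m n (f : X -> 'M[R]_(m, n)) :
  continuous f -> continuous (fun x => (f x)^T).
Proof.
move=> cf; apply: continuous_mx => i j.
rewrite (_ : (fun x => _) = fun x => f x j i); last by apply/funext => x; rewrite mxE.
move=> x; exact: (continuous_comp (cf x) (@coord_continuous _ _ _ j i _)).
Qed.

Definition dot n (v w : 'rV[R]_n) : R := (v *m w^T) 0 0.

Lemma dotE n (v w : 'rV[R]_n) : dot v w = \sum_j v 0 j * w 0 j.
Proof. by rewrite /dot mxE; apply: eq_bigr => j _; rewrite mxE. Qed.

Lemma dot_line n (v w : 'rV[R]_n) : v *m (w^T *m w) = dot v w *: w.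
Proof. by rewrite mulmxA [v *m _]mx11_scalar mul_scalar_mx. Qed.

Lemma dot_self n (w : 'rV[R]_n) : w != 0 -> dot w w != 0.
Proof.
apply: contraNN => /eqP; rewrite dotE => /eqP; rewrite psumr_eq0; last first.
  by move=> j _; rewrite -expr2 sqr_ge0.
move=> /allP H; apply/eqP/rowP => j; rewrite mxE.
by have := H j; rewrite mem_index_enum => /(_ isT); rewrite -expr2 sqrf_eq0 => /eqP.
Qed.

Lemma dotZ n (v w : 'rV[R]_n) a : dot (a *: v) w = a * dot v w.
Proof. by rewrite /dot -scalemxAl mxE. Qed.

Lemma dotNr n (v w : 'rV[R]_n) : dot v (- w) = - dot v w.
Proof. by rewrite !dotE -sumrN; apply: eq_bigr => j _; rewrite mxE mulrN. Qed.

Lemma dot_same_line n (x v w : 'rV[R]_n) a : w != 0 -> a != 0 -> x = a *: w ->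
  w^T *m w = v^T *m v -> dot x v != 0.
Proof.
move=> w0 a0 -> E; apply/eqP => d0.
have := dot_line (a *: w) w; rewrite E dot_line d0 scale0r dotZ => /esym/eqP.
by rewrite scaler_eq0 (negbTE w0) orbF mulf_eq0 (negbTE a0) (negbTE (dot_self w0)).
Qed.

Lemma continuous_dot (X : topologicalType) n (f g : X -> 'rV[R]_n) :
  continuous f -> continuous g -> continuous (fun x => dot (f x) (g x)).
Proof.
move=> cf cg x.
have cm := continuous_mulmx cf (continuous_trmx cg).
exact: (continuous_comp (cm x) (@coord_continuous _ _ _ 0 0 _)).
Qed.

Lemma same_sign (f : R -> R) a b : a <= b -> continuous f ->
  (forall t, a <= t <= b -> f t != 0) -> 0 < f a * f b.
Proof.
move=> ab cf f0; rewrite ltNge; apply/negP => H.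
have [|c cab fc] := @IVT R f a b 0 ab (continuous_subspaceT cf).
  rewrite ge_min le_max; case: (leP (f a) 0) => fa0 /=; last first.
    by rewrite -(pmulr_rle0 _ fa0) H (ltW fa0).
  have fa : f a < 0 by rewrite lt_neqAle fa0 andbT f0 // lexx ab.
  by rewrite (nmulr_rle0 _ fa) in H; rewrite H orbT.
by rewrite in_itv /= in cab; have := f0 c cab; rewrite fc eqxx.
Qed.

Local Notation I01 := (`[0, 1]%classic : set R).
Local Notation II := (I01 `*` I01 : set (R * R)).

(** [P z] projects orthogonally, up to a scalar, onto a line depending continuously
    on [z]. A vector of the line over the origin is projected successively onto the
    lines over [(k/N) z], k = 1, ..., N; by uniform continuity consecutive lines are
    not orthogonal when N is large, so the vector never vanishes. *)
Lemma line_lift n (P : R * R -> 'M[R]_n) : continuous P ->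
  (forall z, II z -> exists w : 'rV[R]_n, w != 0 /\ P z = w^T *m w) ->
  exists u : R * R -> 'rV[R]_n, continuous u /\
    forall z, II z -> exists w a, [/\ w != 0, P z = w^T *m w, a != 0 & u z = a *: w].
Proof.
move=> cP lP.
have cII : compact II by apply: compact_setX; exact: segment_compact.
have [delta d0 hd] : exists2 delta, 0 < delta &
    forall z z', II z -> ball z delta z' -> P z *m P z' != 0.
  apply: uniform_diagonal => // x /lP[w [w0 Px]].
  have /matrix0Pn[i [j Pij]] : P x *m P x != 0.
    apply/eqP => PP; have := dot_line w w; rewrite -Px => E.
    have : w *m P x *m P x = 0 by rewrite -mulmxA PP mulmx0.
    rewrite E -scalemxAl E scalerA => /eqP.
    by rewrite scaler_eq0 (negbTE w0) orbF mulf_eq0 (negbTE (dot_self w0)).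
  have cf : continuous (fun p : (R * R) * (R * R) => (P p.1 *m P p.2) i j).
    have cm : continuous (fun p : (R * R) * (R * R) => P p.1 *m P p.2).
      apply: continuous_mulmx => p.
        exact: (continuous_comp cvg_fst (cP _)).
      exact: (continuous_comp cvg_snd (cP _)).
    by move=> p; exact: (continuous_comp (cm p) (@coord_continuous _ _ _ i j _)).
  have n0 : 0 < `|(P x *m P x) i j| by rewrite normr_gt0.
  have /cvgrPdist_lt/(_ _ n0)/nbhs_ballP[e /= e0 he] := cf (x, x).
  exists e => // a b xa xb; apply/eqP => ab0.
  have Z : (P a *m P b) i j = 0 by rewrite ab0 mxE.
  by have := he (a, b) (conj xa xb); rewrite /= Z subr0 ltxx.
pose N := Num.truncn (delta^-1); pose nn : R := N.+1%:R.
have nn0 : 0 < nn by rewrite ltr0n.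
have nd : nn^-1 < delta.
  rewrite -[ltRHS]invrK ltf_pV2 ?posrE ?invr_gt0 //.
  by rewrite /nn /N; exact: truncnS_gt.
pose pt (k : nat) (z : R * R) : R * R := (k%:R / nn * z.1, k%:R / nn * z.2).
have ptI k z : (k <= N.+1)%N -> II z -> II (pt k z).
  move=> kN; case: z => z1 z2 [] /=; rewrite !in_itv /= => /andP[a1 a2] /andP[b1 b2].
  have k0 : 0 <= k%:R / nn by rewrite divr_ge0 // ltW.
  have k1 : k%:R / nn <= 1 by rewrite ler_pdivrMr // mul1r ler_nat.
  have H x : 0 <= x -> x <= 1 -> I01 (k%:R / nn * x).
    by move=> x0 x1; rewrite /= in_itv /=; apply/andP; split;
      [exact: mulr_ge0|exact: mulr_ile1].
  by split; exact: H.
have ptb k z : II z -> ball (pt k z) delta (pt k.+1 z).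
  case: z => z1 z2 [] /=; rewrite !in_itv /= => /andP[a1 a2] /andP[b1 b2].
  have H x : 0 <= x -> x <= 1 -> `|k%:R / nn * x - k.+1%:R / nn * x| < delta.
    move=> x0 x1; rewrite -!mulrBl -natr1 opprD addNKr mulN1r.
    rewrite mulNr normrN ger0_norm; last by rewrite mulr_ge0 // invr_ge0 ltW.
    by apply: le_lt_trans nd; rewrite ler_piMr // invr_ge0 ltW.
  by split; rewrite /ball /=; exact: H.
have I0 : II (pt 0%N (0, 0)) by apply: ptI => //; split; rewrite /= in_itv /= lexx ler01.
have [w0 [w00 Pw0]] := lP _ I0.
pose u := fix u (k : nat) (z : R * R) := if k is k'.+1 then u k' z *m P (pt k z) else w0.
have cpt k : continuous (pt k).
  move=> z.
  have c1 : {for z, continuous (fun z : R * R => k%:R / nn * z.1)}.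
    by apply: continuousM; [exact: cst_continuous|exact: cvg_fst].
  have c2 : {for z, continuous (fun z : R * R => k%:R / nn * z.2)}.
    by apply: continuousM; [exact: cst_continuous|exact: cvg_snd].
  exact: (cvg_pair c1 c2).
exists (u N.+1); split.
  elim: (N.+1) => [|k IH]; first by move=> z; exact: cvg_cst.
  apply: continuous_mulmx => // z.
  exact: (continuous_comp (cpt k.+1 z) (cP _)).
have H k z : (k <= N.+1)%N -> II z ->
    exists w a, [/\ w != 0, P (pt k z) = w^T *m w, a != 0 & u k z = a *: w].
  elim: k => [|k IH] kN Iz.
    exists w0, 1; split; rewrite ?oner_neq0 ?scale1r // -Pw0.
    by congr P; rewrite /pt !mul0r.
  have [w [a [wn Pw a0 uw]]] := IH (ltnW kN) Iz.
  have [w' [wn' Pw']] := lP _ (ptI _ _ kN Iz).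
  have := hd _ _ (ptI _ _ (ltnW kN) Iz) (ptb k z Iz).
  rewrite Pw Pw' -mulmxA dot_line => dn.
  have dn0 : dot w w' != 0.
    by apply: contraNN dn => /eqP ->; rewrite scale0r mulmx0.
  exists w', (a * dot w w'); split => //; first by rewrite mulf_neq0.
  by rewrite [u _ _]/= -/u uw Pw' dot_line dotZ.
move=> z Iz; have := H N.+1 z (leqnn _) Iz.
have -> : pt N.+1 z = z by rewrite /pt -/nn divff ?gt_eqF // !mul1r; case: z {Iz}.
by [].
Qed.

End Matrices.

(** * The line field of a cocycle *)

Section GlueFamily.
Variables (R : realType) (n : nat) (M : topologicalType).
Variables (A : smooth_atlas R n M) (T : triangulation A).
Hypothesis hM : hausdorff_space M.

Lemma glue_family (Y : Type) (F : forall l, ('rV[R]_l -> M) -> 'rV[R]_l -> Y) :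
  (forall l (phi : 'rV[R]_l.+1 -> M) i y, T l.+1 phi -> simplex R l y ->
     F _ phi (face_map i y) = F _ (face T phi i) y) ->
  exists f : M -> Y, forall l (phi : 'rV[R]_l -> M) y, T l phi -> simplex R l y ->
    f (phi y) = F _ phi y.
Proof.
move=> compat.
have : forall x, exists v, exists l (phi : 'rV[R]_l -> M),
    [/\ T l phi, opencell phi x & v = F _ phi (cinv phi x)].
  move=> x; have [l [phi Tphi ophi]] := Phi_cover T x.
  by exists (F _ phi (cinv phi x)), l, phi.
move=> /choice[f hf]; exists f.
elim=> [|l IH] phi y Tphi sy.
  have [k [psi [Tpsi opsi ->]]] := hf (phi y).
  have oy : opencell phi (phi y).
    by rewrite opencellE; exists y => //; exact: positive_bary0.
  have E := opencell_eq Tphi Tpsi oy opsi.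
  have Ek := existT_inj1 E; subst k; have Ep := existT_inj2 E; subst psi.
  by rewrite (cinvK Tphi).
have [py|npy] := pselect (positive_bary y).
  have [k [psi [Tpsi opsi ->]]] := hf (phi y).
  have oy : opencell phi (phi y) by rewrite opencellE; exists y.
  have E := opencell_eq Tphi Tpsi oy opsi.
  have Ek := existT_inj1 E; subst k; have Ep := existT_inj2 E; subst psi.
  by rewrite (cinvK Tphi).
have [i yi] := simplex_boundary sy npy; have [z yz zb] := bary_eq0_face yi.
have sz : simplex R l z.
  by apply/simplexE => k; rewrite zb; exact: ((simplexE y).1 sy).
rewrite yz; have [Tf ff] := faceP i Tphi.
by rewrite -ff // IH // compat.
Qed.

Lemma continuous_on_simplexes (Y : topologicalType) (f : M -> Y) :
  (forall l phi, T l phi -> {within simplex R l, continuous (f \o phi)}) ->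
  continuous f.
Proof.
move=> cf; apply/continuous_subspace_setT; rewrite -(cells_cover T).
apply: (@continuous_cells _ _ _ _ T hM _ f (cells T)); first exact: subset_refl.
by move=> l phi Tphi _; exact: cf.
Qed.

Definition vertices : set M := [set p | exists2 v, T 0%N v & v 0 = p].

Lemma vertices_finite : finite_set vertices.
Proof.
have -> : vertices = (fun v => v 0) @` T 0%N.
  by rewrite predeqE => p; split=> -[v Tv vp]; exists v.
exact: finite_image (Phi_finite _ _).
Qed.

Lemma vertex_in_vertices l (phi : 'rV[R]_l -> M) i :
  T l phi -> vertices (phi (vertex R i)).
Proof.
elim: l phi i => [|l IH] phi i Tphi.
  by exists phi => //; congr phi; apply/rowP => -[].
have [k [j ->]] : exists k j, i = lift k j.
  have [k ki] : exists k : 'I_l.+2, k != i.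
    have [->|i0] := eqVneq i ord0; first by exists ord_max.
    by exists ord0; rewrite eq_sym.
  by have [j -> _] := unlift_some ki; exists k, j.
have [Tf ff] := faceP k Tphi.
by rewrite -face_map_vertex -ff; [exact: IH|exact: vertex_simplex].
Qed.

End GlueFamily.

Lemma gram_sign (R : realType) n (b : bool) (v : 'rV[R]_n) :
  ((-1) ^+ b *: v)^T *m ((-1) ^+ b *: v) = v^T *m v.
Proof.
case: b; last by rewrite expr0 scale1r.
rewrite expr1 scaleN1r; apply/matrixP => i j; rewrite !mxE.
by apply: eq_bigr => k _; rewrite !mxE mulrNN.
Qed.

Section LineField.
Variables (R : realType) (M : topologicalType).
Variables (A : smooth_atlas R 2 M) (T : triangulation A).
Hypothesis hM : hausdorff_space M.
Variable s : seq M.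
Hypothesis sP : vertices T `<=` [set` s].
Local Notation edge := ('rV[R]_1 -> M).
Implicit Types (c : edge -> bool).
Local Notation N := (size s).

Definition vertex_row (p : M) : 'rV[R]_N := \row_(j < N) (nth p s j == p)%:R.

(** The signs at two vertices of a simplex differ if and only if [c] is nonzero on the
    edge joining them. On a triangle, where the [i]th face is opposite to the [i]th
    vertex, the value of [c] on the opposite face is such a sign when [c] is a
    cocycle. *)
Definition vertex_sign c l : ('rV[R]_l -> M) -> 'I_l.+1 -> bool :=
  match l return ('rV[R]_l -> M) -> 'I_l.+1 -> bool with
  | 1%N => fun e i => (i != ord0) && c e
  | 2%N => fun phi i => c (face T phi i)
  | _ => fun _ _ => false
  end.
Arguments vertex_sign : simpl never.

Definition signed_coord c l (phi : 'rV[R]_l -> M) (y : 'rV[R]_l) : 'rV[R]_N :=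
  \sum_i ((-1) ^+ vertex_sign c phi i * bary y i) *: vertex_row (phi (vertex R i)).

Lemma signed_coord_continuous c l (phi : 'rV[R]_l -> M) :
  continuous (signed_coord c phi).
Proof.
apply: continuous_sumr => i _ y.
have c1 : {for y, continuous (fun x => (-1) ^+ vertex_sign c phi i * bary x i)}.
  by apply: continuousM; [exact: cst_continuous|exact: bary_continuous].
exact: (cvgZr_tmp c1).
Qed.

Lemma signed_coord_vertex c l (phi : 'rV[R]_l -> M) i :
  signed_coord c phi (vertex R i) =
  (-1) ^+ vertex_sign c phi i *: vertex_row (phi (vertex R i)).
Proof.
rewrite /signed_coord (bigD1 i) //= bary_vertex eqxx mulr1 big1 ?addr0 // => j ji.
by rewrite bary_vertex eq_sym (negbTE ji) mulr0 scale0r.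
Qed.

Lemma signed_coord_neq0 c l (phi : 'rV[R]_l -> M) y : T l phi ->
  simplex R l y -> signed_coord c phi y != 0.
Proof.
move=> Tphi sy; have [i yi] : exists i, bary y i != 0.
  apply: contrapT => /forallNP H; have := sum_bary y.
  rewrite big1 => [/esym/eqP|i _]; first by rewrite oner_eq0.
  by apply/eqP; apply: contrapT => /negP; exact: H.
pose p := phi (vertex R i).
have ps : p \in s by exact: (sP (vertex_in_vertices i Tphi)).
have ix : (index p s < N)%N by rewrite index_mem.
apply/eqP => /rowP/(_ (Ordinal ix)); rewrite summxE (bigD1 i) //= big1 => [|j ji].
  rewrite !mxE /= nth_index // eqxx mulr1 addr0 => /eqP.
  by rewrite mulf_eq0 signr_eq0 (negbTE yi).
rewrite !mxE /= (set_nth_default p) // nth_index //.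
have [E|_] := eqVneq; last by rewrite mulr0.
have := Phi_inj Tphi (vertex_simplex _ i) (vertex_simplex _ j) E => Ev.
have := congr1 (fun x => bary x i) Ev; rewrite /= !bary_vertex eqxx (negbTE ji) => /eqP.
by rewrite oner_eq0.
Qed.

Lemma signed_coord_face c l (phi : 'rV[R]_l.+1 -> M) i b y : T l.+1 phi ->
  (forall k, vertex_sign c phi (lift i k) = b (+) vertex_sign c (face T phi i) k) ->
  signed_coord c phi (face_map i y) = (-1) ^+ b *: signed_coord c (face T phi i) y.
Proof.
move=> Tphi H; rewrite /signed_coord (bigD1_ord i) //=.
rewrite bary_face_self mulr0 scale0r add0r scaler_sumr; apply: eq_bigr => k _.
have [_ ff] := faceP i Tphi.
rewrite bary_face_lift H signr_addb -mulrA scalerA; congr (_ *: vertex_row _).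
by rewrite -face_map_vertex ff //; exact: vertex_simplex.
Qed.

(** On a face, the signs of a simplex agree with those of the face up to a global sign
    as [c] is a cocycle, so the lines spanned by the signed coordinates are well
    defined; the matrix of the projection does not depend on the global sign. *)
Lemma line_field c : (forall phi, T 2%N phi -> coboundary T c phi = false) ->
  exists P : M -> 'M[R]_N, continuous P /\
    forall l (phi : 'rV[R]_l -> M) y, T l phi -> simplex R l y ->
      P (phi y) = (signed_coord c phi y)^T *m signed_coord c phi y.
Proof.
move=> cocyc.
have [P PE] : exists P : M -> 'M[R]_N, forall l (phi : 'rV[R]_l -> M) y, T l phi ->
    simplex R l y -> P (phi y) = (signed_coord c phi y)^T *m signed_coord c phi y.
  apply: (glue_family (T := T)
    (F := fun l phi y => (signed_coord c phi y)^T *m signed_coord c phi y)).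
  move=> l phi i y Tphi sy.
  have [b H] : exists b, forall k,
      vertex_sign c phi (lift i k) = b (+) vertex_sign c (face T phi i) k.
    have l2 : (l.+1 <= 2)%N. by exact: (Phi_dim_le Tphi).
    case: l l2 phi i y Tphi sy => [|[|//]] _ phi i y Tphi _.
      exists (vertex_sign c phi (lift i ord0)) => k.
      by rewrite (ord1 k) [X in _ (+) X]/vertex_sign addbF.
    exists (vertex_sign c phi (lift i ord0)) => k.
    rewrite /vertex_sign; have := cocyc _ Tphi.
    rewrite /coboundary (bigD1_ord i) //= !big_ord_recl big_ord0 addbF /=.
    case: (unliftP ord0 k) => [k'|] ->; last by rewrite addbF.
    rewrite (ord1 k') => H1 /=.
    have -> : c (face T phi i) = c (face T phi (lift i ord0)) (+)
        c (face T phi (lift i (lift ord0 ord0))).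
      by move: H1; case: (c _); case: (c _); case: (c _).
    by case: (c _); case: (c _).
  by rewrite (signed_coord_face _ Tphi H) gram_sign.
exists P; split => //; apply: (continuous_on_simplexes hM (T := T)) => l phi Tphi.
apply: (eq_within (f := fun y => (signed_coord c phi y)^T *m signed_coord c phi y)).
  by move=> y sy /=; rewrite PE.
apply: continuous_subspaceT; apply: continuous_mulmx; last exact: signed_coord_continuous.
by apply: continuous_trmx; exact: signed_coord_continuous.
Qed.

Lemma vertex_sign0 l (phi : 'rV[R]_l -> M) i : vertex_sign (fun=> false) phi i = false.
Proof. by case: l phi i => [|[|[|l]]] phi i; rewrite /vertex_sign ?andbF. Qed.

Lemma unsigned_coord : exists w : M -> 'rV[R]_N, continuous w /\
    forall l (phi : 'rV[R]_l -> M) y, T l phi -> simplex R l y ->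
      w (phi y) = signed_coord (fun=> false) phi y.
Proof.
have [w wE] : exists w : M -> 'rV[R]_N, forall l (phi : 'rV[R]_l -> M) y, T l phi ->
    simplex R l y -> w (phi y) = signed_coord (fun=> false) phi y.
  apply: (glue_family (T := T) (F := fun l phi y => signed_coord (fun=> false) phi y)).
  move=> l phi i y Tphi sy; rewrite (@signed_coord_face _ _ _ _ false) ?scale1r //.
  by move=> k; rewrite !vertex_sign0.
exists w; split => //; apply: (continuous_on_simplexes hM (T := T)) => l phi Tphi.
apply: (eq_within (f := signed_coord (fun=> false) phi)); first by move=> y sy /=; rewrite wE.
by apply: continuous_subspaceT; exact: signed_coord_continuous.
Qed.

End LineField.

(** * Black edges are bridges *)

Section EdgeParam.
Variable R : realType.

Lemma bary_const (t : R) : bary (const_mx t : 'rV[R]_1) ord0 = 1 - t /\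
  bary (const_mx t : 'rV[R]_1) ord_max = t.
Proof.
have -> : ord_max = lift ord0 ord0 :> 'I_2 by apply: val_inj.
by rewrite bary0 baryS big_ord_recl big_ord0 addr0 !mxE.
Qed.

Lemma const_simplex (t : R) : 0 <= t <= 1 -> simplex R 1 (const_mx t).
Proof.
move=> /andP[t0 t1]; have [b0 b1] := bary_const t; apply/simplexE => i.
by case: (ord2P i) => ->; rewrite ?b0 ?b1 // subr_ge0.
Qed.

Lemma const_vertex0 : const_mx 0 = vertex R (ord0 : 'I_2).
Proof.
have [b0 b1] := bary_const 0; apply: bary_inj => i; rewrite bary_vertex.
by case: (ord2P i) => ->; rewrite ?b0 ?b1 ?subr0.
Qed.

Lemma const_vertex1 : const_mx 1 = vertex R (ord_max : 'I_2).
Proof.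
have [b0 b1] := bary_const 1; apply: bary_inj => i; rewrite bary_vertex.
by case: (ord2P i) => ->; rewrite ?b0 ?b1 ?subrr.
Qed.

Lemma const_continuous : continuous (fun t : R => const_mx t : 'rV[R]_1).
Proof.
apply: continuous_mx => i j.
rewrite (_ : (fun x => _) = id); last by apply/funext => x; rewrite mxE.
by move=> x; exact: cvg_id.
Qed.

Lemma row1_const (y : 'rV[R]_1) : y = const_mx (y 0 0).
Proof. by apply/rowP => j; rewrite mxE (ord1 j). Qed.

Lemma simplex1 (y : 'rV[R]_1) : simplex R 1 y -> 0 <= y 0 0 <= 1.
Proof. by move=> [/(_ 0)]. Qed.

Lemma mul_gt0_trans (x y z : R) : 0 < x * y -> 0 < y * z -> 0 < x * z.
Proof.
move=> xy yz; have y0 : y != 0.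
  by apply/eqP => y0; rewrite y0 mulr0 ltxx in xy.
have y2 : 0 < y ^+ 2 by rewrite exprn_even_gt0.
rewrite -(pmulr_rgt0 _ y2).
have -> : y ^+ 2 * (x * z) = (x * y) * (y * z) by ring.
exact: mulr_gt0.
Qed.

Lemma glue_half (X : topologicalType) (f g : R -> X) :
  continuous f -> continuous g -> f (1 / 2) = g (1 / 2) ->
  continuous (fun s : R => if s <= 1 / 2 then f s else g s).
Proof.
move=> cf cg fg; apply/continuous_subspace_setT.
have -> : [set: R] = [set s : R | s <= 1 / 2] `|` [set s : R | 1 / 2 <= s].
  by apply/esym; rewrite -subTset => s _ /=; apply/orP; exact: le_total.
apply: withinU_continuous.
- exact: closed_le.
- exact: closed_ge.
- by apply: (eq_within (f := f)); [move=> s /= ->|exact: continuous_subspaceT].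
- apply: (eq_within (f := g)); last exact: continuous_subspaceT.
  move=> s /= s2; case: ifPn => // s2'; suff -> : s = 1 / 2 by rewrite fg.
  by apply/eqP; rewrite eq_le s2 s2'.
Qed.

End EdgeParam.

Section Bridge.
Variables (R : realType) (M : topologicalType).
Variables (A : smooth_atlas R 2 M) (T : triangulation A).
Hypothesis hM : hausdorff_space M.
Hypothesis sM : simply_connected R [set: M].
Local Notation edge := ('rV[R]_1 -> M).
Local Notation I01 := (`[0, 1]%classic : set R).
Local Notation II := (I01 `*` I01 : set (R * R)).

(** A black path joining the ends of [e] outside [e] is closed up by [e]. The loop
    contracts in [M], so the line field of the cocycle of [e] has a nonvanishing
    section [u] along it, taking collinear values of the same sign at both ends of
    the loop. But along the black path the coordinates without signs also generate
    the line field, while along [e] the coordinates of the two ends have opposite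
    signs: comparing [u] with these generators gives opposite signs. *)
Lemma black_edge_bridge D E (e : edge) (g : R -> M) : stage T D E -> T 2%N `<=` D ->
  T 1%N e -> ~ E e ->
  ~ path_in (~` white D E `\` opencell e) (e (vertex R ord_max)) (e (vertex R ord0)) g.
Proof.
move=> st TD Te nE [cg g0 g1 gK].
set a := e (vertex R ord0) in g1; set b := e (vertex R ord_max) in g0.
have [c [ce cE cocyc]] := black_edge_cocycle hM st TD Te nE.
have /finite_seqP[s sE] := vertices_finite T.
have sP : vertices T `<=` [set` s] by rewrite sE.
have [P [cP PE]] := line_field hM s cocyc.
have [w [cw wE]] := unsigned_coord T hM s.
have h2 : 0 <= (1 / 2 : R) by lra.
have h21 : (1 / 2 : R) <= 1 by lra.
pose g' := g \o @clamp R.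
have cg' : continuous g' by exact: clamp_extend.
pose ga (t : R) := e (const_mx (clamp t)).
have cga : continuous ga.
  have -> : ga = (fun t => e (const_mx t)) \o @clamp R by [].
  apply: clamp_extend.
  apply: (@within_comp _ _ _ I01 (simplex R 1) (fun t : R => const_mx t)).
  - by apply: continuous_subspaceT; exact: const_continuous.
  - exact: (Phi_continuous Te).
  - by move=> t; rewrite /= in_itv /=; exact: const_simplex.
have c0 : clamp (0 : R) = 0 by rewrite clamp_id // lexx ler01.
have c1 : clamp (1 : R) = 1 by rewrite clamp_id // lexx ler01.
pose loop (s : R) := if s <= 1 / 2 then g' (2 * s) else ga (2 * s - 1).
have aff (k : R) : continuous (fun s : R => 2 * s - k).
  move=> x; apply: continuousB; last exact: cst_continuous.
  by apply: continuousM; [exact: cst_continuous|exact: cvg_id].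
have cloop : continuous loop.
  apply: (@glue_half _ _ (fun s => g' (2 * s)) (fun s => ga (2 * s - 1))).
  - move=> x; apply: (@continuous_comp _ _ _ (fun s : R => 2 * s) g'); last exact: cg'.
    by apply: continuousM; [exact: cst_continuous|exact: cvg_id].
  - move=> x; apply: (@continuous_comp _ _ _ (fun s : R => 2 * s - 1) ga); last exact: cga.
    exact: aff.
  - have -> : 2 * (1 / 2 : R) = 1 by lra.
    by rewrite /g' /ga /= subrr c0 c1 g1 const_vertex0.
have loop0 : loop 0 = b by rewrite /loop h2 mulr0 /g' /= c0.
have loop1 : loop 1 = b.
  rewrite /loop; case: ifPn => [h|_]; first by exfalso; move: h; lra.
  have -> : 2 * 1 - 1 = 1 :> R by lra.
  by rewrite /ga c1 const_vertex1.
have [_ _ Mh] := sM.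
have [H [cH _ H1 H2]] : null_homotopic_in [set: M] b loop.
  by apply: Mh => //; split => //; exact: continuous_subspaceT.
pose Ht := H \o @clamp2 R.
have cHt : continuous Ht by exact: clamp2_extend.
have HtE z : II z -> Ht z = H z by move=> Iz; rewrite /Ht /= clamp2_id.
have I0 : I01 0 by rewrite /= in_itv /= lexx ler01.
have I1 : I01 1 by rewrite /= in_itv /= lexx ler01.
have II' (t : R) : 0 <= t <= 1 -> I01 t by rewrite /= in_itv.
have [u [cu uE]] : exists u : R * R -> 'rV[R]_(size s), continuous u /\
    forall z, II z -> exists w a, [/\ w != 0, P (Ht z) = w^T *m w, a != 0 & u z = a *: w].
  apply: (line_lift (P := P \o Ht)).
    by move=> z; apply: continuous_comp; [exact: cHt|exact: cP].
  move=> z _; have [l [phi Tphi [y sy yz]]] := Phi_cover T (Ht z).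
  have {}sy := interior_subset sy.
  by exists (signed_coord T s c phi y); rewrite (signed_coord_neq0 sP) //= -yz PE.
have nz z v : II z -> P (Ht z) = v^T *m v -> dot (u z) v != 0.
  move=> Iz Pv; have [w' [k [w0 Pw k0 uz]]] := uE z Iz.
  by apply: (dot_same_line w0 k0 uz); rewrite -Pw Pv.
pose vr (p : M) : 'rV[R]_(size s) := vertex_row R s p.
have Pb : P b = (vr b)^T *m vr b.
  by rewrite PE //; [rewrite signed_coord_vertex gram_sign|exact: vertex_simplex].
have wv i : w (e (vertex R i)) = vr (e (vertex R i)).
  by rewrite wE //; [rewrite signed_coord_vertex vertex_sign0 scale1r|exact: vertex_simplex].
have cline (k l' : R) (v : R -> 'rV[R]_(size s)) (p : R -> R * R) :
    continuous p -> continuous v -> continuous (fun t => dot (u (p t)) (v t)).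
  move=> cp cv; apply: continuous_dot => // t.
  by apply: continuous_comp; [exact: cp|exact: cu].
have cfst (k : R) : continuous (fun t : R => (t, k)).
  by move=> t; exact: (cvg_pair cvg_id (cvg_cst _)).
have csnd (k : R) : continuous (fun t : R => (k, t)).
  by move=> t; exact: (cvg_pair (cvg_cst _) cvg_id).
have cvb : continuous (fun _ : R => vr b) by move=> t; exact: cvg_cst.
(* on these three sides the homotopy is constant *)
have s1 : 0 < dot (u (0, 0)) (vr b) * dot (u (0, 1)) (vr b).
  apply: (@same_sign _ (fun t => dot (u (0, t)) (vr b)) 0 1) => //.
    exact: (cline 0 0).
  by move=> t /II' It; apply: nz => //; rewrite HtE // (H2 t It).1.
have s2 : 0 < dot (u (0, 1)) (vr b) * dot (u (1, 1)) (vr b).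
  apply: (@same_sign _ (fun t => dot (u (t, 1)) (vr b)) 0 1) => //.
    exact: (cline 0 0).
  by move=> t /II' It; apply: nz => //; rewrite HtE // (H1 t It).2.
have s3 : 0 < dot (u (1, 0)) (vr b) * dot (u (1, 1)) (vr b).
  apply: (@same_sign _ (fun t => dot (u (1, t)) (vr b)) 0 1) => //.
    exact: (cline 0 0).
  by move=> t /II' It; apply: nz => //; rewrite HtE // (H2 t It).2.
(* [c] vanishes on all black edges but [e], so no sign occurs along the black path *)
have Pw x : ~ white D E x -> ~ opencell e x -> P x = (w x)^T *m w x.
  move=> nx ne; have [l [phi Tphi ophi]] := Phi_cover T x.
  have [y sy yx] := opencell_sub ophi; rewrite -yx PE // wE //.
  suff -> : signed_coord T s c phi y = signed_coord T s (fun=> false) phi y :> 'rV[R]_(size s).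
    by [].
  apply: eq_bigr => i _; rewrite vertex_sign0.
  suff -> : vertex_sign T c phi i = false by [].
  have l2 : (l <= 2)%N. by exact: (Phi_dim_le Tphi).
  case: l l2 phi Tphi ophi y sy yx i => [|[|[|//]]] _ phi Tphi ophi y sy yx i.
  - by [].
  - rewrite /vertex_sign; case cphi : (c phi); last by rewrite andbF.
    exfalso; case: (cE _ cphi) => [Ep|Ep]; first by apply: ne; rewrite -Ep.
    by apply: nx; right; exists phi.
  - by exfalso; apply: nx; left; exists phi => //; exact: TD.
have s4 : 0 < dot (u (0, 0)) (vr b) * dot (u (1 / 2, 0)) (vr a).
  have E1 : w (loop 0) = vr b by rewrite loop0 wv.
  have E2 : w (loop (1 / 2)) = vr a.
    rewrite /loop lexx; have -> : 2 * (1 / 2 : R) = 1 by lra.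
    by rewrite /g' /= c1 g1 wv.
  rewrite -E1 -E2.
  apply: (@same_sign _ (fun t => dot (u (t, 0)) (w (loop t))) 0 (1 / 2)) => //.
    apply: (cline 0 0) => // t; apply: (@continuous_comp _ _ _ loop w); [exact: cloop|exact: cw].
  move=> t /andP[t0 t2]; have It : I01 t by apply: II'; rewrite t0 /=; lra.
  apply: nz => //; rewrite HtE // (H1 t It).1 /loop t2 /g' /=.
  rewrite clamp_id; last by apply/andP; split; lra.
  have [] := gK (2 * t); first by apply: II'; apply/andP; split; lra.
  exact: Pw.
(* along [e] the end of the edge carries the sign -1, as [c e] holds *)
have s5 : 0 < dot (u (1 / 2, 0)) (vr a) * - dot (u (1, 0)) (vr b).
  pose v (t : R) := signed_coord T s c e (const_mx (clamp (2 * t - 1))) : 'rV[R]_(size s).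
  have E1 : v (1 / 2) = vr a.
    rewrite /v; have -> : 2 * (1 / 2) - 1 = 0 :> R by lra.
    by rewrite c0 const_vertex0 signed_coord_vertex /vertex_sign eqxx scale1r.
  have E2 : v 1 = - vr b.
    rewrite /v; have -> : 2 * 1 - 1 = 1 :> R by lra.
    by rewrite c1 const_vertex1 signed_coord_vertex /vertex_sign ce scaleN1r.
  rewrite -dotNr -E1 -E2.
  apply: (@same_sign _ (fun t => dot (u (t, 0)) (v t)) (1 / 2) 1) => //.
    apply: (cline 0 0) => // t; rewrite /v.
    apply: (@continuous_comp _ _ _ (fun t : R => 2 * t - 1)
      (fun t => signed_coord T s c e (const_mx (clamp t)))); first exact: aff.
    apply: (@continuous_comp _ _ _ (@clamp R)
      (fun t => signed_coord T s c e (const_mx t))); first exact: clamp_continuous.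
    apply: (@continuous_comp _ _ _ (fun t : R => const_mx t)
      (signed_coord T s c e)); first exact: const_continuous.
    exact: signed_coord_continuous.
  move=> t /andP[t0 t2]; have It : I01 t by apply: II'; rewrite t2 andbT; lra.
  apply: nz => //; rewrite HtE // (H1 t It).1.
  have -> : loop t = ga (2 * t - 1).
    rewrite /loop; case: ifPn => // t3.
    have -> : t = 1 / 2 by apply/eqP; rewrite eq_le t0 t3.
    have -> : 2 * (1 / 2 : R) = 1 by lra.
    by rewrite /g' /ga /= subrr c0 c1 g1 const_vertex0.
  by rewrite /ga PE //; apply: const_simplex; exact: clamp_bounds.
have := mul_gt0_trans (mul_gt0_trans s1 s2) (etrans (congr1 _ (mulrC _ _)) s3).
have := mul_gt0_trans s4 s5; rewrite mulrN => m1 m2.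
by move: m1; rewrite oppr_gt0 ltNge ltW.
Qed.

End Bridge.

(** * Trees are retracts of normed spaces *)

Definition normed_retract (R : realType) (M : topologicalType) (L : set M) : Prop :=
  exists (Y : normedModType R) (i : M -> Y) (r : Y -> M),
    [/\ {within L, continuous i}, continuous r, forall y, L (r y) &
        forall x, L x -> r (i x) = x].

Section NormedRetract.
Variables (R : realType) (M : topologicalType).
Implicit Types L : set M.
Local Notation I01 := (`[0, 1]%classic : set R).
Local Notation II := (I01 `*` I01 : set (R * R)).

Lemma normed_retract1 (p : M) : normed_retract R [set p].
Proof.
exists R^o, (fun=> 0), (fun=> p); split => //.
- by apply: continuous_subspaceT => x; exact: cvg_cst.
- by move=> x; exact: cvg_cst.
Qed.

Lemma normed_retract_path L x y : normed_retract R L -> L x -> L y ->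
  exists g : R -> M, path_in L x y g.
Proof.
move=> [Y [i [r [ci cr rL ri]]]] Lx Ly.
exists (fun t => r (i x + t *: (i y - i x))); split.
- apply: continuous_subspaceT => t.
  have c1 : {for t, continuous (fun t : R => i x + t *: (i y - i x))}.
    exact: (cvgD (cvg_cst _) (cvgZr_tmp cvg_id)).
  exact: (continuous_comp c1 (cr _)).
- by rewrite scale0r addr0 ri.
- by rewrite scale1r subrKC ri.
- by move=> t _; exact: rL.
Qed.

(** Loops contract along segments of the normed space. *)
Lemma normed_retract_simply_connected L : L !=set0 ->
  normed_retract R L -> simply_connected R L.
Proof.
move=> L0 nL; split => //; first by move=> x y; exact: normed_retract_path.
move: nL => [Y [i [r [ci cr rL ri]]]] x g Lx [cg g0 g1 gL].
exists (fun p => r (i (g p.1) + p.2 *: (i x - i (g p.1)))); split.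
- have cig : {within II, continuous (fun p : R * R => i (g p.1))}.
    apply: (@within_comp _ _ _ II I01 (@fst R R) (i \o g)).
    + by apply: continuous_subspaceT => z; exact: cvg_fst.
    + exact: within_comp ci gL.
    + by move=> z [].
  have c2 : {within II, continuous (fun p : R * R => p.2)}.
    by apply: continuous_subspaceT => z; exact: cvg_snd.
  have c3 : {within II, continuous
      (fun p : R * R => i (g p.1) + p.2 *: (i x - i (g p.1)))}.
    by move=> z; exact: (cvgD (cig z) (cvgZ (c2 z) (cvgB (cvg_cst _) (cig z)))).
  exact: within_comp_cont c3 cr.
- by move=> p _; exact: rL.
- move=> s Is /=; rewrite scale0r addr0 scale1r subrKC !ri //; exact: gL.
- by move=> t It /=; rewrite g0 g1 subrr scaler0 addr0 ri.
Qed.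

(** Radial contraction of the normed space decreasing norms by [t], down to 0. *)
Definition shrink (Y : normedModType R) (p : Y * R) : Y :=
  (Order.max 0 (`|p.1| - Order.max 0 p.2) / `|p.1|) *: p.1.

Lemma shrink_le (Y : normedModType R) (p : Y * R) : `|shrink p| <= `|p.1|.
Proof.
rewrite /shrink normrZ; have [->|n0] := eqVneq p.1 0; first by rewrite normr0 mulr0.
have p0 : 0 < `|p.1| by rewrite normr_gt0.
rewrite -[leRHS]mul1r ler_pM2r // ger0_norm; last by rewrite divr_ge0 // le_max lexx.
by rewrite ler_pdivrMr // mul1r ge_max normr_ge0 lerBlDr lerDl le_max lexx.
Qed.

Lemma shrink_id (Y : normedModType R) (v : Y) : shrink (v, 0) = v.
Proof.
rewrite /shrink /= maxxx subr0 max_r //.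
have [->|n0] := eqVneq v 0; first by rewrite scaler0.
by rewrite divff ?scale1r // normr_eq0.
Qed.

Lemma shrink_eq0 (Y : normedModType R) (v : Y) t : `|v| <= t -> shrink (v, t) = 0.
Proof.
move=> vt; have t0 : 0 <= t by exact: le_trans vt.
by rewrite /shrink /= (max_r t0) max_l ?subr_le0 // mul0r scale0r.
Qed.

Lemma shrink_continuous (Y : normedModType R) : continuous (@shrink Y).
Proof.
move=> [v t]; have [v0|n0] := eqVneq v 0.
  have cf : {for (v, t), continuous (fun p : Y * R => p.1)} by exact: cvg_fst.
  apply/cvgrPdist_lt => eps eps0.
  have s0 : shrink (v, t) = 0 by rewrite /shrink /= v0 scaler0.
  move/cvgrPdist_lt: cf => /(_ _ eps0); apply: filterS => p /=.
  rewrite s0 v0 !sub0r !normrN; exact: le_lt_trans (shrink_le p).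
have c1 : {for (v, t), continuous (fun p : Y * R => p.1)} by exact: cvg_fst.
have c2 : {for (v, t), continuous (fun p : Y * R => p.2)} by exact: cvg_snd.
have c3 : {for (v, t), continuous (fun p : Y * R => `|p.1|)} by exact: (cvg_norm c1).
have n1 : `|(v, t).1| != 0 by rewrite normr_eq0.
have c4 : {for (v, t), continuous (fun p : Y * R => `|p.1| ^-1)} by exact: (cvgV n1 c3).
have c5 : {for (v, t), continuous (fun p : Y * R => Order.max 0 p.2)}.
  by apply: continuous_max => //; exact: cst_continuous.
have c6 : {for (v, t), continuous
    (fun p : Y * R => Order.max 0 (`|p.1| - Order.max 0 p.2))}.
  apply: continuous_max; first exact: cst_continuous.
  by apply: continuousB.
have c7 : {for (v, t), continuous
    (fun p : Y * R => Order.max 0 (`|p.1| - Order.max 0 p.2) / `|p.1|)}.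
  exact: continuousM.
exact: (cvgZ c7 c1).
Qed.

(** The arc [B], attached to [L] at [ga 0], is sent to the second factor of [Y * R],
    over the image [e] of [ga 0]. The retraction of [Y * R] onto the union of [Y] and
    of this half line lets the time [t] first shrink the distance to [e], and run
    along the arc when this distance is used up. *)
Lemma normed_retract_attach L (B : set M) (ga : R -> M) (tau : M -> R) :
  closed L -> closed B -> normed_retract R L -> continuous ga ->
  {within B, continuous tau} ->
  (forall x, B x -> 0 <= tau x <= 1 /\ ga (tau x) = x) ->
  (forall t, 0 <= t <= 1 -> B (ga t)) ->
  L (ga 0) -> tau (ga 0) = 0 -> (forall x, L x -> B x -> x = ga 0) ->
  normed_retract R (L `|` B).
Proof.
move=> cL cB [Y [i [r [ci cr rL ri]]]] cga ct tB gB La t0 LB.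
pose a := ga 0; pose e := i a.
pose i' x : Y * R := if `[< L x >] then (i x, 0) else (e, tau x).
pose r' (p : Y * R) : M := if p.2 <= `|p.1 - e| then r (e + shrink (p.1 - e, p.2))
  else ga (clamp (p.2 - `|p.1 - e|)).
exists (Y * R)%type, i', r'; split.
- apply: withinU_continuous => //.
    apply: (eq_within (f := fun x => (i x, 0 : R))).
      by move=> x Lx; rewrite /i' asboolT.
    by move=> x; exact: (cvg_pair (ci x) (cvg_cst _)).
  apply: (eq_within (f := fun x => (e, tau x))).
    move=> x Bx; rewrite /i'; case: asboolP => // Lx.
    by rewrite (LB x Lx Bx) t0.
  by move=> x; exact: (cvg_pair (cvg_cst _) (ct x)).
- have c1 : continuous (fun p : Y * R => p.1 - e).
    by move=> p; exact: (cvgB cvg_fst (cvg_cst _)).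
  have c2 : continuous (fun p : Y * R => p.2) by move=> p; exact: cvg_snd.
  have c3 : continuous (fun p : Y * R => p.2 - `|p.1 - e|).
    by move=> p; exact: (continuousB (c2 p) (cvg_norm (c1 p))).
  apply/continuous_subspace_setT.
  have -> : [set: Y * R] = [set p : Y * R | p.2 - `|p.1 - e| <= 0] `|`
      [set p : Y * R | 0 <= p.2 - `|p.1 - e|].
    by apply/esym; rewrite -subTset => p _ /=; apply/orP; exact: le_total.
  apply: withinU_continuous.
  + apply: (closed_comp (f := fun p : Y * R => p.2 - `|p.1 - e|)) (@closed_le _ 0).
    by move=> p _; exact: c3.
  + apply: (closed_comp (f := fun p : Y * R => p.2 - `|p.1 - e|)) (@closed_ge _ 0).
    by move=> p _; exact: c3.
  + apply: (eq_within (f := fun p => r (e + shrink (p.1 - e, p.2)))).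
      by move=> p /=; rewrite subr_le0 /r' => ->.
    apply: continuous_subspaceT => p.
    have c4 : {for p, continuous (fun p : Y * R => (p.1 - e, p.2))}.
      exact: (cvg_pair (c1 p) (c2 p)).
    have c5 := continuous_comp c4 (@shrink_continuous Y _).
    have c6 : {for p, continuous (fun p : Y * R => e + shrink (p.1 - e, p.2))}.
      exact: (cvgD (cvg_cst _) c5).
    exact: (continuous_comp c6 (cr _)).
  + apply: (eq_within (f := fun p => ga (clamp (p.2 - `|p.1 - e|)))).
      move=> p /=; rewrite subr_ge0 /r' => ge; case: ifPn => // le.
      have E : p.2 = `|p.1 - e| by apply/eqP; rewrite eq_le le ge.
      by rewrite E subrr shrink_eq0 // addr0 ri // clamp_id // lexx ler01.
    apply: continuous_subspaceT => p.
    have c4 := continuous_comp (c3 p) (@clamp_continuous R _).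
    exact: (continuous_comp c4 (cga _)).
- move=> p; rewrite /r'; case: ifP => _; first by left; exact: rL.
  by right; apply: gB; exact: clamp_bounds.
- move=> x LBx; rewrite /i'; case: asboolP => [Lx|nLx].
    by rewrite /r' /= normr_ge0 shrink_id subrKC ri.
  have Bx : B x by case: LBx.
  have [/andP[tx0 tx1] gx] := tB x Bx.
  rewrite /r' /= subrr normr0 subr0; case: ifPn => [le|_].
    have tx : tau x = 0 by apply/eqP; rewrite eq_le le tx0.
    by exfalso; apply: nLx; rewrite -gx tx.
  by rewrite clamp_id // tx0.
Qed.

End NormedRetract.

(** * The black set is a tree in dimension two *)

Lemma count_lt (I : eqType) (s : seq I) (p q : pred I) x :
  subpred p q -> x \in s -> q x -> ~~ p x -> (count p s < count q s)%N.
Proof.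
move=> pq xs qx px; rewrite (permP (perm_to_rem xs) p) (permP (perm_to_rem xs) q).
by rewrite /= qx (negbTE px) add0n add1n ltnS; exact: sub_count.
Qed.

Section DimensionTwo.
Variables (R : realType) (M : topologicalType).
Variables (A : smooth_atlas R 2 M) (T : triangulation A).
Hypothesis hM : hausdorff_space M.
Hypothesis sM : simply_connected R [set: M].
Local Notation edge := ('rV[R]_1 -> M).
Variables (D : set ('rV[R]_2 -> M)) (E : set edge).
Hypothesis st : stage T D E.
Hypothesis TD : T 2%N `<=` D.
Let K := ~` white D E.
Hypothesis cK : connected K.

Let black (e : edge) := T 1%N e /\ ~ E e.

Lemma black_edge_sub e : black e -> cell e `<=` K.
Proof.
move=> [Te nE] x cx; have [DT ET _] := stage_inv hM st.
case=> [[d Dd od]|[t Et ot]].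
  by have := cell_opencell_le Te (DT _ Dd) cx od.
by apply: nE; rewrite (cell_opencell_eq Te (ET _ Et) cx ot).
Qed.

Lemma vertex_black v : T 0%N v -> K (v 0).
Proof.
move=> Tv; have [DT ET _] := stage_inv hM st.
have cv : cell v (v 0) by exists 0 => //; exact: sub_positive_bary (positive_bary0 _).
case=> [[d Dd od]|[t Et ot]].
  by have := cell_opencell_le Tv (DT _ Dd) cv od.
by have := cell_opencell_le Tv (ET _ Et) cv ot.
Qed.

Lemma black_point x : K x ->
  (exists2 v, T 0%N v & x = v 0) \/ exists2 e, black e & opencell e x.
Proof.
move=> Kx; have [l [phi Tphi ophi]] := Phi_cover T x.
have l2 : (l <= 2)%N. by exact: (Phi_dim_le Tphi).
case: l l2 phi Tphi ophi => [|[|[|//]]] _ phi Tphi ophi.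
- by left; exists phi => //; exact: vertex_cell (opencell_sub ophi).
- right; exists phi => //; split => // Ep.
  by apply: Kx; right; exists phi.
- by exfalso; apply: Kx; left; exists phi => //; exact: TD.
Qed.

Lemma edge_point (e : edge) x : T 1%N e -> cell e x -> ~ opencell e x ->
  x = e (vertex R ord0) \/ x = e (vertex R ord_max).
Proof.
move=> Te [y sy <-] no; have npy : ~ positive_bary y.
  by move=> py; apply: no; rewrite opencellE; exists y.
have [i yi] := simplex_boundary sy npy.
have E1 : y 0 0 = bary y ord_max.
  by rewrite (row1_const y) (bary_const (y 0 0)).2 mxE.
case: (ord2P i) => ie; rewrite ie in yi.
  right; rewrite (row1_const y) -const_vertex1; congr (e (const_mx _)).
  move: yi; rewrite [in bary y _](row1_const y) (bary_const (y 0 0)).1 => /eqP.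
  by rewrite subr_eq0 => /eqP.
by left; rewrite (row1_const y) -const_vertex0 E1 yi.
Qed.

Let subtree (L : set M) := [/\ L `<=` K, closed L, L !=set0, normed_retract R L &
  forall e, black e -> cell e `<=` L \/ (forall x, opencell e x -> ~ L x)].

Lemma subtree1 : K !=set0 -> exists L, subtree L.
Proof.
move=> [x Kx].
have [v Tv] : exists v, T 0%N v.
  case: (black_point Kx) => [[v Tv _]|[e [Te _] _]]; first by exists v.
  by exists (face T e ord0); exact: (faceP ord0 Te).1.
have cv : cell v = [set v 0].
  rewrite predeqE => y; split; first exact: vertex_cell.
  by move=> ->; exists 0 => //; exact: sub_positive_bary (positive_bary0 _).
exists (cell v); split.
- by rewrite cv => _ ->; exact: vertex_black.
- exact: (cell_closed hM Tv).
- by rewrite cv; exists (v 0).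
- by rewrite cv; exact: normed_retract1.
- move=> e [Te _]; right => y oy cy.
  by have := cell_opencell_le Tv Te cy oy.
Qed.

(** By [black_edge_bridge], the connected set [L] contains one end of [e] only, and
    [e] is attached to [L] at that end. *)
Lemma subtree_attach L e : subtree L -> black e -> ~ (cell e `<=` L) ->
  (exists2 x, cell e x & L x) -> subtree (L `|` cell e).
Proof.
move=> [LK cL L0 nL Ledge] be ncL [x cx Lx]; have [Te nE] := be.
have oL : forall y, opencell e y -> ~ L y by case: (Ledge e be).
have noends : ~ (L (e (vertex R ord0)) /\ L (e (vertex R ord_max))).
  move=> [L1 L2]; have [g [cg g0 g1 gL]] := normed_retract_path nL L2 L1.
  apply: (black_edge_bridge hM sM st TD Te nE (g := g)); split => //.
  by move=> t /gL Lt; split; [exact: LK|move=> /oL].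
have ends : forall y, L y -> cell e y ->
    y = e (vertex R ord0) \/ y = e (vertex R ord_max).
  by move=> y Ly cy; apply: edge_point => // /oL.
have ccl : closed (cell e) by exact: (cell_closed hM Te).
have cinv01 y : cell e y -> 0 <= cinv e y 0 0 <= 1 /\ e (const_mx (cinv e y 0 0)) = y.
  by move=> /cinvP[s1 s2]; rewrite -row1_const s2; split => //; exact: simplex1.
have cpar (f : R -> R) : continuous f -> (forall t, 0 <= t <= 1 -> 0 <= f t <= 1) ->
    continuous ((fun t => e (const_mx (f t))) \o @clamp R).
  move=> cf f01; apply: clamp_extend.
  apply: (@within_comp _ _ _ (`[0, 1]%classic : set R) (simplex R 1) (fun t : R => const_mx (f t))).
  - apply: continuous_subspaceT => t.
    exact: (continuous_comp (cf t) (@const_continuous R _)).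
  - exact: (Phi_continuous Te).
  - by move=> t; rewrite /= in_itv /= => /f01; exact: const_simplex.
have ctau (f : R -> R) : continuous f -> {within cell e, continuous (fun y => f (cinv e y 0 0))}.
  move=> cf; apply: (within_comp_cont (g := fun z : 'rV[R]_1 => f (z 0 0))).
    exact: (cinv_continuous hM Te).
  move=> z; exact: (continuous_comp (@coord_continuous _ _ _ 0 0 z) (cf _)).
have nL' : normed_retract R (L `|` cell e).
  have c0 : clamp (0 : R) = 0 by rewrite clamp_id // lexx ler01.
  have cid : continuous (fun t : R => t) by move=> t; exact: cvg_id.
  have cop : continuous (fun t : R => 1 - t).
    by move=> t; exact: (continuousB (@cst_continuous _ _ (1 : R) t) cvg_id).
  have op01 (t : R) : 0 <= t <= 1 -> 0 <= 1 - t <= 1.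
    by move=> /andP[t0 t1]; apply/andP; split; lra.
  have inj t : 0 <= t <= 1 -> cinv e (e (const_mx t)) 0 0 = t.
    by move=> t01; rewrite (cinvK Te) ?mxE //; exact: const_simplex.
  have le01 : 0 <= (1 : R) <= 1 by rewrite ler01 lexx.
  have le00 : 0 <= (0 : R) <= 1 by rewrite ler01 lexx.
  case: (ends x Lx cx) => xE; rewrite xE in Lx cx.
    apply: (normed_retract_attach (ga := (fun t => e (const_mx t)) \o @clamp R)
      (tau := fun y => cinv e y 0 0)) => //=.
    + exact: (cpar (fun t => t)).
    + exact: (ctau (fun t => t)).
    + by move=> y /cinv01[y01 ey]; rewrite clamp_id.
    + by move=> t t01; rewrite clamp_id //; exists (const_mx t) => //; exact: const_simplex.
    + by rewrite c0 const_vertex0.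
    + by rewrite c0 inj.
    + move=> y Ly cy; rewrite c0 const_vertex0; case: (ends y Ly cy) => // yE.
      by exfalso; apply: noends; rewrite -yE.
  apply: (normed_retract_attach (ga := (fun t => e (const_mx (1 - t))) \o @clamp R)
    (tau := fun y => 1 - cinv e y 0 0)) => //=.
  + exact: (cpar (fun t => 1 - t)).
  + exact: (ctau (fun t => 1 - t)).
  + move=> y /cinv01[y01 ey]; rewrite clamp_id; last exact: op01.
    by rewrite subKr; split => //; exact: op01.
  + move=> t t01; rewrite clamp_id //; exists (const_mx (1 - t)) => //.
    by apply: const_simplex; exact: op01.
  + by rewrite c0 subr0 const_vertex1.
  + by rewrite c0 subr0 inj // subrr.
  + move=> y Ly cy; rewrite c0 subr0 const_vertex1; case: (ends y Ly cy) => // yE.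
    by exfalso; apply: noends; rewrite -yE.
split => //.
- by move=> y [/LK//|]; exact: black_edge_sub.
- exact: closedU.
- by case: L0 => y Ly; exists y; left.
- move=> e' be'; case: (Ledge e' be') => [sub|dis]; first by left => y /sub; left.
  have [->|ne] := pselect (e' = e); first by left => y; right.
  right=> y oy [/(dis _ oy)//|cy]; apply: ne.
  by rewrite (cell_opencell_eq Te be'.1 cy oy).
Qed.

(** As long as [L] is not the whole of [K], some edge leaves [L]: otherwise the
    black simplexes disjoint from [L] would disconnect [K]. *)
Lemma subtree_grow L : subtree L -> L <> K -> exists e,
  [/\ black e, ~ (cell e `<=` L) & exists2 x, cell e x & L x].
Proof.
move=> [LK cL L0 nL Ledge] LnK; apply: contrapT => H.
have {}H e : black e -> cell e `<=` L \/ cell e `&` L = set0.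
  move=> be; have [sub|nsub] := pselect (cell e `<=` L); first by left.
  right; rewrite predeqE => x; split => // -[cx Lx]; apply: H.
  by exists e; split => //; exists x.
pose X := \bigcup_(B in cells T `&` [set B | B `<=` K /\ B `&` L = set0]) B.
have cX : closed X by apply: (closed_cells hM (T := T)) => B [].
have XL x : X x -> ~ L x.
  move=> [B [_ [_ BL]] Bx] Lx; have : (B `&` L) x by [].
  by rewrite BL.
apply: LnK; apply: cK => //; last first.
  by exists L => //; rewrite predeqE => x; split => [Lx|[]//]; split => //; exact: LK.
exists (~` X); first by rewrite openC.
rewrite predeqE => x; split => [Lx|[Kx nX]].
  by split; [exact: LK|move=> /XL].
apply: contrapT => nLx; apply: nX.
case: (black_point Kx) => [[v Tv xv]|[e be ox]].
  exists (cell v); last first.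
    by rewrite xv; exists 0 => //; exact: sub_positive_bary (positive_bary0 _).
  split; first by exists 0%N, v.
  split; first by move=> y /vertex_cell ->; exact: vertex_black.
  rewrite predeqE => y; split => // -[/vertex_cell -> Lv].
  by apply: nLx; rewrite xv.
exists (cell e); last exact: opencell_sub.
split; first by exists 1%N, e => //; case: be.
split; first exact: black_edge_sub.
by case: (H e be) => // sub; exfalso; apply: nLx; apply: sub; exact: opencell_sub.
Qed.

(** Starting from a vertex, edges are attached until the whole of [K] is obtained; the
    number of edges not contained in [L] decreases. *)
Lemma dim2_simply_connected : K !=set0 -> simply_connected R K.
Proof.
move=> K0; apply: normed_retract_simply_connected => //.
have fB : finite_set (cells T `&` [set B | exists2 e, black e & B = cell e]).
  by apply: sub_finite_set (cells_finite T) => B [].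
have /finite_seqP[s sE] := fB.
have cin e : black e -> cell e \in s.
  move=> be; suff : [set` s] (cell e) by [].
  rewrite -sE; split; last by exists e.
  by exists 1%N, e => //; case: be.
pose mu L := count (fun B : set M => ~~ `[< B `<=` L >]) s.
suff H k : forall L, subtree L -> (mu L <= k)%N -> subtree K.
  have [L sL] := subtree1 K0.
  by have [] := H _ L sL (leqnn _).
have step L : subtree L -> L <> K -> exists e,
    [/\ black e, ~ (cell e `<=` L), subtree (L `|` cell e) & (0 < mu L)%N].
  move=> sL LK; have [e [be ne ex]] := subtree_grow sL LK.
  exists e; split => //; first exact: subtree_attach.
  rewrite /mu -has_count; apply/hasP; exists (cell e); first exact: cin.
  exact/asboolPn.
elim: k => [|k IH] L sL muL.
  have [<- //|/(step L sL)[e [_ _ _]]] := pselect (L = K).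
  by rewrite ltnNge muL.
have [<- //|/(step L sL)[e [be ne sL' _]]] := pselect (L = K).
apply: (IH (L `|` cell e)) => //.
rewrite -ltnS; apply: leq_trans muL.
apply: (count_lt (x := cell e)); last 3 first.
- exact: cin.
- exact/asboolPn.
- by rewrite negbK; apply/asboolP => y; right.
move=> B /asboolPn nB; apply/asboolPn => BL; apply: nB => y /BL; by left.
Qed.

End DimensionTwo.

(** * The theorem *)

Theorem corollary2p1 (R : realType) (n : nat) (M : topologicalType)
    (A : smooth_atlas R n.+1 M) (T : triangulation A) (C K : set M) :
  hausdorff_space M -> compact [set: M] -> connected [set: M] ->
  cell_decomposition T C K ->
  connected K /\
  (simply_connected R [set: M] -> simply_connected R K).
Proof.
move=> hM _ cM [[sigma ws full] ->].
have [D [E [st sE ->]]] := white_stageP hM ws.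
have [DT _ _] := stage_inv hM st.
have TD : T n.+1 `<=` D.
  by move=> d Td; apply: (cell_sub_stage DT Td); rewrite -sE; exact: full.
have K0 : ~` white D E !=set0.
  apply: (retract_along_stage hM (P := fun B => B !=set0)) st.
    by move=> B B' r; exact: retract_nonempty.
  by move=> d Td; exact: (outside_opencell_nonempty Td).
case: n A T D E st sE DT TD K0 ws full => [|n] A T D E st sE DT TD K0 _ _.
  have [y ->] := dim1_point hM cM st TD.
  by split; [exact: connected1|move=> _; exact: simply_connected1].
have cK : connected (~` white D E).
  apply: (retract_along_stage hM (P := fun B => connected B)) st.
    by move=> B B' r; exact: retract_connected.
  by move=> d Td; exact: (outside_opencell_connected hM cM Td).
split=> // sM.
case: n A T D E st sE DT TD K0 cK => [|n] A T D E st sE DT TD K0 cK.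
  exact: (dim2_simply_connected hM sM st TD cK).
apply: (retract_along_stage hM (P := fun B => simply_connected R B)) st.
  by move=> B B' r; exact: retract_simply_connected.
move=> d Td; apply: (outside_simply_connected hM _ Td) => //.
exact: (outside_opencell_nonempty Td).
Qed.
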